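(* Let $(M,g,I,J,K)$ be a hyperkähler manifold of real dimension $4n$. The following three $\mathbb{CP}^1\times\mathbb{CP}^1$-families of generalized complex structures on $M$, with parameter $(\alpha,\beta)\in\mathbb{CP}^1\times\mathbb{CP}^1$, are actually the same family: (1) the family with pure spinor $$\Phi_{\alpha,\beta}=i^n(\alpha-\beta)^n\exp\left(\frac{\sigma-(\alpha+\beta)\omega_I-\alpha\beta\bar\sigma}{i(\alpha-\beta)}\right);$$ (2) (which exists only when $n=1$) the family with pure spinor $$(\omega_J+i\omega_K)-(\alpha+\beta)\omega_I+i(\alpha-\beta)(1-\mathrm{vol})-\alpha\beta(\omega_J-i\omega_K),\qquad \mathrm{vol}=\tfrac12\omega_I^2;$$ (3) the family $$\mathcal{J}_{\alpha,\beta}=\frac12\begin{pmatrix}-(I_\alpha+I_\beta)&-(\omega_\alpha^{-1}-\omega_\beta^{-1})\\ \omega_\alpha-\omega_\beta&I_\alpha^*+I_\beta^*\end{pmatrix}$$ attached to the bi-Hermitian structures $(g,I_+,I_-)=(g,I_\alpha,I_\beta)$.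
   Context: Generalized geometry. $E=TM\oplus T^*M$ carries $\langle X+\xi,Y+\eta\rangle=\frac12(\xi(Y)+\eta(X))$. A generalized almost complex structure is an orthogonal endomorphism $\mathcal{J}$ of $E$ with $\mathcal{J}^2=-1$; it is a generalized complex structure if its $+i$-eigenbundle $L\subset E\otimes\mathbb{C}$ is closed under $[X+\xi,Y+\eta]=[X,Y]+\mathcal{L}_X\eta-\iota_Yd\xi$. $E\otimes\mathbb{C}$ acts on $\wedge^\bullet T^*M\otimes\mathbb{C}$ by $(X+\xi)\cdot\varphi=\iota_X\varphi+\xi\wedge\varphi$; a pure spinor for $\mathcal{J}$ is a (local) complex form $\Phi$ whose annihilator at every point is exactly the fibre of $L$. It is unique up to a nowhere zero factor and determines $\mathcal{J}$. Products of forms are wedge products. Hyperkähler notation. $g$ is Kähler with respect to complex structures $I,J,K$ with $IJ=K=-JI$, $JK=I=-KJ$, $KI=J=-IK$. For a $g$-compatible complex structure $A$, $\omega_A=g(A\cdot,\cdot)$ is its Kähler form, also regarded as the map $X\mapsto\iota_X\omega_A$, and $A^*\xi=\xi\circ A$. Put $\sigma=\omega_J+i\omega_K$. For $\eta\in\mathbb{CP}^1=\mathbb{C}\cup\{\infty\}$, $I_\eta=\frac{1-|\eta|^2}{1+|\eta|^2}I+\frac{2\mathrm{Re}\,\eta}{1+|\eta|^2}J+\frac{2\mathrm{Im}\,\eta}{1+|\eta|^2}K$ (with $I_\infty=-I$), and $\omega_\eta$ is its Kähler form. After expanding the exponential, $\Phi_{\alpha,\beta}$ is a polynomial in $\alpha,\beta$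 (with differential forms as coefficients) of degree at most $n$ in each variable; this defines it also for $\alpha=\beta$, and, after rescaling by $\alpha^{-n}$ and/or $\beta^{-n}$, when $\alpha$ and/or $\beta$ is $\infty$. The same applies (with $n=1$) in (2).
   Formalization: With the stated conventions the parameters match only after exchange: the structure with pure spinor (1) or (2) at (α,β) is J_{β,α}, not J_{α,β} (at (0,∞) the spinor is exp(-iω_I) but J_{0,∞} has exp(iω_I)); the families are proved equal as sets and with parameters exchanged. *)

(* Defs.v *)
From HB Require Import structures.
From mathcomp Require Import all_boot all_order all_algebra.
From mathcomp Require Import all_classical all_reals all_analysis.
From mathcomp Require Import complex.

Set Implicit Arguments.
Unset Strict Implicit.
Unset Printing Implicit Defensive.

Import Order.TTheory GRing.Theory Num.Theory.
Import numFieldNormedType.Exports.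

Local Open Scope classical_set_scope.
Local Open Scope ring_scope.

(* Tangent vectors and covectors are both columns, holding the components in
   the coordinate (co)frame of a chart; an endomorphism A of the tangent space
   acts by A *m X, and its transpose A^* by A^T *m xi. *)

Section Calculus.
Context {R : realType} {m : nat}.
Notation C := R[i].
Implicit Types (V U : set 'cV[R]_m).

Definition pd (a : 'I_m) (f : 'cV[R]_m -> R) (x : 'cV[R]_m) : R :=
  'D_(delta_mx a 0) f x.

Fixpoint Ck (k : nat) V (f : 'cV[R]_m -> R) : Prop :=
  (forall x, V x -> {for x, continuous f}) /\
  (if k is k'.+1 then
     forall a, (forall x, V x -> derivable f x (delta_mx a 0)) /\
               Ck k' V (pd a f)
   else True).

Definition smooth V (f : 'cV[R]_m -> R) : Prop := forall k, Ck k V f.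

Definition smooth_mx p q V (F : 'cV[R]_m -> 'M[R]_(p, q)) : Prop :=
  forall i j, smooth V (fun x => F x i j).

Definition smoothC V (f : 'cV[R]_m -> C) : Prop :=
  smooth V (fun x => complex.Re (f x)) /\ smooth V (fun x => complex.Im (f x)).

Definition smoothC_mx p q V (F : 'cV[R]_m -> 'M[C]_(p, q)) : Prop :=
  forall i j, smoothC V (fun x => F x i j).

Definition pdC (a : 'I_m) (f : 'cV[R]_m -> C) (x : 'cV[R]_m) : C :=
  (pd a (fun y => complex.Re (f y)) x +i*
   pd a (fun y => complex.Im (f y)) x)%C.

Definition toC p q (A : 'M[R]_(p, q)) : 'M[C]_(p, q) :=
  map_mx (real_complex R) A.

Definition jacobian_mx (f : 'cV[R]_m -> 'cV[R]_m) (x : 'cV[R]_m) : 'M[R]_m :=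
  \matrix_(a, b) pd b (fun y => f y a 0) x.

Definition lie (X Y : 'cV[R]_m -> 'cV[R]_m) (x : 'cV[R]_m) : 'cV[R]_m :=
  \col_a \sum_b (X x b 0 * pd b (fun y => Y y a 0) x
                 - Y x b 0 * pd b (fun y => X y a 0) x).

Definition nijenhuis (A : 'cV[R]_m -> 'M[R]_m) (X Y : 'cV[R]_m -> 'cV[R]_m)
    (x : 'cV[R]_m) : 'cV[R]_m :=
  let AX y := A y *m X y in
  let AY y := A y *m Y y in
  lie AX AY x - A x *m lie AX Y x - A x *m lie X AY x - lie X Y x.

Definition integrable_cx V (A : 'cV[R]_m -> 'M[R]_m) : Prop :=
  forall U X Y, open U -> U `<=` V -> smooth_mx U X -> smooth_mx U Y ->
  forall x, U x -> nijenhuis A X Y x = 0.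

(* W x a b = omega_x(e_a, e_b), for a skew-symmetric W. *)
Definition closed2 V (W : 'cV[R]_m -> 'M[R]_m) : Prop :=
  forall x, V x -> forall a b c,
    pd a (fun y => W y b c) x + pd b (fun y => W y c a) x
    + pd c (fun y => W y a b) x = 0.

(* Complex sections X + xi of E are columns, with X above xi. *)

Definition pairing (u v : 'cV[R]_(m + m)) : R :=
  2^-1 * (((dsubmx u)^T *m usubmx v) 0 0 + ((dsubmx v)^T *m usubmx u) 0 0).

Definition lieC (X Y : 'cV[R]_m -> 'cV[C]_m) (x : 'cV[R]_m) : 'cV[C]_m :=
  \col_a \sum_b (X x b 0 * pdC b (fun y => Y y a 0) x
                 - Y x b 0 * pdC b (fun y => X y a 0) x).

(* The Lie derivative L_X eta of a 1-form. *)
Definition lie_form (X eta : 'cV[R]_m -> 'cV[C]_m) (x : 'cV[R]_m) : 'cV[C]_m :=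
  \col_a \sum_b (X x b 0 * pdC b (fun y => eta y a 0) x
                 + eta x b 0 * pdC a (fun y => X y b 0) x).

(* The contraction iota_Y (d xi). *)
Definition contr_d (Y xi : 'cV[R]_m -> 'cV[C]_m) (x : 'cV[R]_m) : 'cV[C]_m :=
  \col_a \sum_b Y x b 0 * (pdC b (fun y => xi y a 0) x
                           - pdC a (fun y => xi y b 0) x).

Definition courant (u v : 'cV[R]_m -> 'cV[C]_(m + m)) (x : 'cV[R]_m) :
    'cV[C]_(m + m) :=
  let X y := usubmx (u y) in let xi y := dsubmx (u y) in
  let Y y := usubmx (v y) in let eta y := dsubmx (v y) in
  col_mx (lieC X Y x) (lie_form X eta x - contr_d Y xi x).

Definition eigen_i (A : 'M[R]_(m + m)) : set 'cV[C]_(m + m) :=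
  [set u | toC A *m u = ('i)%C *: u].

Definition involutive_i V (A : 'cV[R]_m -> 'M[R]_(m + m)) : Prop :=
  forall U u v, open U -> U `<=` V -> smoothC_mx U u -> smoothC_mx U v ->
  (forall x, U x -> eigen_i (A x) (u x)) ->
  (forall x, U x -> eigen_i (A x) (v x)) ->
  forall x, U x -> eigen_i (A x) (courant u v x).

End Calculus.

Section Exterior.
Context {R : realType} {m : nat}.
Notation C := R[i].

(* The complexified exterior algebra of the cotangent space: phi S is the
   coefficient of e^{s_1} /\ ... /\ e^{s_k} for S = {s_1 < ... < s_k}. *)
Definition form := {ffun {set 'I_m} -> C}.
Implicit Types (phi psi : form).

Definition inversions (S T : {set 'I_m}) : nat :=
  #|[set p : 'I_m * 'I_m |
     [&& p.1 \in S, p.2 \in T & (p.2 < p.1)%N]]%SET|.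

Definition wedge phi psi : form :=
  [ffun U : {set 'I_m} => \sum_(S : {set 'I_m} | S \subset U)
     (-1) ^+ inversions S (U :\: S) * (phi S * psi (U :\: S))].

Definition interior (X : 'cV[C]_m) phi : form :=
  [ffun U : {set 'I_m} => \sum_(j | j \notin U)
     (-1) ^+ #|[set k in U | (k < j)%N]%SET| * (X j 0 * phi (j |: U))].

Definition form_one : form := [ffun S : {set 'I_m} => (S == finset.set0)%:R].

Definition form1 (xi : 'cV[C]_m) : form :=
  [ffun S : {set 'I_m} => \sum_(j | S == [set j]%SET) xi j 0].

Definition form2 (W : 'M[C]_m) : form :=
  [ffun S : {set 'I_m} =>
     \sum_(a < m) \sum_(b < m | (a < b)%N && (S == [set a; b]%SET)) W a b].

(* For phi without component of degree 0 the powers beyond the m-th vanish,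
   so that this is the whole exponential series. *)
Definition form_exp phi : form :=
  \sum_(k < m.+1) (k`!%:R)^-1 *: iter k (wedge phi) form_one.

Definition clifford (u : 'cV[C]_(m + m)) phi : form :=
  interior (usubmx u) phi + wedge (form1 (dsubmx u)) phi.

Definition pure_spinor_on (V : set 'cV[R]_m) (Phi : 'cV[R]_m -> form)
    (A : 'cV[R]_m -> 'M[R]_(m + m)) : Prop :=
  (forall S, smoothC V (fun x => Phi x S)) /\
  (forall x, V x -> forall u, clifford u (Phi x) = 0 <-> eigen_i (A x) u).

End Exterior.
Arguments form : clear implicits.

Record chart (R : realType) (T : topologicalType) (m : nat) := Chart {
  dom : set T;
  cod : set 'cV[R]_m;
  fwd : T -> 'cV[R]_m;
  bwd : 'cV[R]_m -> T;
  dom_open : open dom;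
  cod_open : open cod;
  fwd_cod : forall p, dom p -> cod (fwd p);
  bwd_dom : forall x, cod x -> dom (bwd x);
  fwdK : forall p, dom p -> bwd (fwd p) = p;
  bwdK : forall x, cod x -> fwd (bwd x) = x;
  fwd_cont : {within dom, continuous fwd};
  bwd_cont : {within cod, continuous bwd} }.

Definition overlap (R : realType) (T : topologicalType) (m : nat)
    (c d : chart R T m) : set 'cV[R]_m :=
  [set x | cod c x /\ dom d (bwd c x)].

Definition transition (R : realType) (T : topologicalType) (m : nat)
    (c d : chart R T m) (x : 'cV[R]_m) : 'cV[R]_m := fwd d (bwd c x).

Record manifold (R : realType) (m : nat) := Manifold {
  space :> topologicalType;
  space_hausdorff : hausdorff_space space;
  space_countable : @second_countable space;
  idx : Type;
  atlas : idx -> chart R space m;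
  atlas_cover : forall p : space, exists i, dom (atlas i) p;
  atlas_smooth : forall i j,
    smooth_mx (overlap (atlas i) (atlas j)) (transition (atlas i) (atlas j)) }.

Section Fields.
Context {R : realType} {m : nat} (M : manifold R m).

(* A tensor field is given by its components in every chart, as functions of
   the coordinates, subject to the transformation law; the values outside the
   image of the chart are irrelevant. *)
Definition field p q := idx M -> 'cV[R]_m -> 'M[R]_(p, q).

Definition img (i : idx M) : set 'cV[R]_m := cod (atlas i).
Definition trans (i j : idx M) := transition (atlas i) (atlas j).
Definition jac (i j : idx M) (x : 'cV[R]_m) : 'M[R]_m :=
  jacobian_mx (trans i j) x.

Definition smooth_field p q (F : field p q) : Prop :=
  forall i, smooth_mx (img i) (F i).

Definition bilinear_field (F : field m m) : Prop :=
  forall i j x, overlap (atlas i) (atlas j) x ->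
    F i x = (jac i j x)^T *m F j (trans i j x) *m jac i j x.

Definition endo_field (F : field m m) : Prop :=
  forall i j x, overlap (atlas i) (atlas j) x ->
    jac i j x *m F i x = F j (trans i j x) *m jac i j x.

Definition gjac (i j : idx M) (x : 'cV[R]_m) : 'M[R]_(m + m) :=
  block_mx (jac i j x) 0 0 (invmx (jac i j x))^T.

Definition gendo_field (F : field (m + m) (m + m)) : Prop :=
  forall i j x, overlap (atlas i) (atlas j) x ->
    gjac i j x *m F i x = F j (trans i j x) *m gjac i j x.

Definition metric (g : field m m) : Prop :=
  [/\ bilinear_field g, smooth_field g &
      forall i x, img i x -> (g i x)^T = g i x /\
        forall v : 'cV[R]_m, v != 0 -> 0 < (v^T *m g i x *m v) 0 0].

(* omega_A = g(A., .) : entry (a, b) is g(A e_a, e_b). *)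
Definition kform (g A : field m m) : field m m :=
  fun i x => (A i x)^T *m g i x.

(* The matrix of X |-> iota_X omega_A. *)
Definition kmap (g A : field m m) : field m m :=
  fun i x => (kform g A i x)^T.

Definition kahler (g A : field m m) : Prop :=
  [/\ endo_field A /\ smooth_field A,
      forall i x, img i x -> A i x *m A i x = - 1%:M,
      forall i, integrable_cx (img i) (A i),
      forall i x, img i x -> (A i x)^T *m g i x *m A i x = g i x &
      forall i, closed2 (img i) (kform g A i)].

Definition gcs (F : field (m + m) (m + m)) : Prop :=
  [/\ gendo_field F /\ smooth_field F,
      forall i x, img i x -> forall u v,
        pairing (F i x *m u) (F i x *m v) = pairing u v,
      forall i x, img i x -> F i x *m F i x = - 1%:M &
      forall i, involutive_i (img i) (F i)].

End Fields.

Record hyperkahler (R : realType) (n : nat) := Hyperkahler {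
  mfd :> manifold R (4 * n);
  hg : field mfd (4 * n) (4 * n);
  hI : field mfd (4 * n) (4 * n);
  hJ : field mfd (4 * n) (4 * n);
  hK : field mfd (4 * n) (4 * n);
  hg_metric : metric hg;
  hI_kahler : kahler hg hI;
  hJ_kahler : kahler hg hJ;
  hK_kahler : kahler hg hK;
  hIJ : forall i x, img i x -> hI i x *m hJ i x = hK i x;
  hJI : forall i x, img i x -> hJ i x *m hI i x = - hK i x;
  hJK : forall i x, img i x -> hJ i x *m hK i x = hI i x;
  hKJ : forall i x, img i x -> hK i x *m hJ i x = - hI i x;
  hKI : forall i x, img i x -> hK i x *m hI i x = hJ i x;
  hIK : forall i x, img i x -> hI i x *m hK i x = - hJ i x }.

Arguments hg {R n} h.
Arguments hI {R n} h.
Arguments hJ {R n} h.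
Arguments hK {R n} h.

(* None is the point at infinity. *)
Definition CP1 (R : realType) : Type := option R[i].

Section Families.
Context {R : realType} {n : nat} (M : hyperkahler R n).
Notation C := R[i].
Notation m := (4 * n)%N.
Notation gfield := (field M (m + m) (m + m)).

(* A CP^1 x CP^1-family of generalized complex structures, as the relation
   "F is the member with parameter (a, b)". *)
Definition gcs_family := CP1 R -> CP1 R -> gfield -> Prop.

Definition same_family (P Q : gcs_family) : Prop :=
  forall F, (exists a b, P a b F) <-> (exists a b, Q a b F).

Definition I_eta (eta : CP1 R) : field M m m := fun i x =>
  if eta is Some z then
    let N := complex.Re z ^+ 2 + complex.Im z ^+ 2 in
    ((1 - N) / (1 + N)) *: hI M i x
    + (2 * complex.Re z / (1 + N)) *: hJ M i x
    + (2 * complex.Im z / (1 + N)) *: hK M i x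
  else - hI M i x.

Definition J_field (a b : CP1 R) : gfield := fun i x =>
  let Ia := I_eta a i x in let wa := kmap (hg M) (I_eta a) i x in
  let Ib := I_eta b i x in let wb := kmap (hg M) (I_eta b) i x in
  2^-1 *: block_mx (- (Ia + Ib))  (- (invmx wa - invmx wb))
                   (wa - wb)      (Ia^T + Ib^T).

Definition family3 : gcs_family := fun a b F =>
  gcs F /\ forall i x, img i x -> F i x = J_field a b i x.

Definition omegaI (i : idx M) x : form R m :=
  form2 (toC (kform (hg M) (hI M) i x)).
Definition omegaJ (i : idx M) x : form R m :=
  form2 (toC (kform (hg M) (hJ M) i x)).
Definition omegaK (i : idx M) x : form R m :=
  form2 (toC (kform (hg M) (hK M) i x)).
Definition sigma (i : idx M) x : form R m :=
  omegaJ i x + ('i)%C *: omegaK i x.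
Definition sigmabar (i : idx M) x : form R m :=
  omegaJ i x - ('i)%C *: omegaK i x.

(* The value of the monomial alpha^j (j <= d) at a point of CP^1; at infinity,
   after rescaling by alpha^-d, only alpha^d survives. *)
Definition mono (d : nat) (a : CP1 R) (j : nat) : C :=
  if a is Some z then z ^+ j else (j == d)%:R.

(* The member (a, b) is the structure whose pure spinor is Psi at (a, b), where Psi is a polynomial c of degree at
   most d in each parameter.  Psi need only be given by a formula meaningful for
   alpha <> beta, which determines the coefficients c. *)
Definition spinor_family (d : nat)
    (Psi : C -> C -> idx M -> 'cV[R]_m -> form R m) : gcs_family :=
  fun a b F => gcs F /\
    exists c : 'I_d.+1 -> 'I_d.+1 -> idx M -> 'cV[R]_m -> form R m,
      (forall i x, img i x -> forall (alpha beta : C), alpha != beta ->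
         Psi alpha beta i x =
         \sum_(j < d.+1) \sum_(k < d.+1)
           (alpha ^+ j * beta ^+ k) *: c j k i x) /\
      (forall i, pure_spinor_on (img i)
         (fun x => \sum_(j < d.+1) \sum_(k < d.+1)
                    (mono d a j * mono d b k) *: c j k i x)
         (F i)).

Definition spinor1 (alpha beta : C) (i : idx M) x : form R m :=
  (('i)%C ^+ n * (alpha - beta) ^+ n) *:
    form_exp ((('i)%C * (alpha - beta))^-1 *:
      (sigma i x - (alpha + beta) *: omegaI i x
       - (alpha * beta) *: sigmabar i x)).

Definition vol (i : idx M) x : form R m :=
  2^-1 *: wedge (omegaI i x) (omegaI i x).

Definition spinor2 (alpha beta : C) (i : idx M) x : form R m :=
  (omegaJ i x + ('i)%C *: omegaK i x) - (alpha + beta) *: omegaI i x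
  + (('i)%C * (alpha - beta)) *: (form_one - vol i x)
  - (alpha * beta) *: (omegaJ i x - ('i)%C *: omegaK i x).

Definition family1 : gcs_family := spinor_family n spinor1.

(* Only meant for n = 1. *)
Definition family2 : gcs_family := spinor_family 1 spinor2.

(* Pitfall: the parameters of family3 match those of family1 and family2 only
   up to the exchange of the two factors.  At (0, oo) the spinor is, up to a
   constant, exp(- i omega_I), while J_field is
   block_mx 0 (- omega_I^-1) omega_I 0, which has pure spinor
   exp(i omega_I). *)

End Families.

Arguments gcs_family {R n} M.
Arguments J_field {R n} M.
Arguments family1 {R n} M.
Arguments family2 {R n} M.
Arguments family3 {R n} M.

(* Main.v *)
From HB Require Import structures.
From mathcomp Require Import all_boot all_order all_algebra.
From mathcomp Require Import all_classical all_reals all_analysis.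
From mathcomp Require Import complex ring lra zify fintype finset.
Require Import Defs.

(* Homogenize the parameters, alpha = a1/a0 and beta = b1/b0, and let
   S_b = b0^2 sigma - 2 b0 b1 omega_I - b1^2 sigmabar, an I_beta-holomorphic symplectic
   form.  Put s = <a, b> / <b, b> and tau = i (a1 b0 - a0 b1).  The numerator of the
   exponent in (1) is s S_b + i tau omega_beta and its denominator is tau, so the spinor is
     exp(i omega_beta) /\ sum_{k <= n} tau^(n-k) s^k S_b^k / k!
   because S_b^(n+1) = 0 <> S_b^n, by a degree count with the number operator.  This
   makes sense for all parameters, and is s^n S_b^n / n! <> 0 when a = b.
   It is polynomial in a, and in b after exchanging the roles of a and b.
   Its annihilator is isotropic and contains the +i-eigenbundle of the bi-Hermitian
   structure, which is maximal isotropic.  The sections X + g Y of this eigenbundle are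
   those with S_b X = tau S_b Z and Y = - i I_beta X - s S_b Z for some Z (S_b read as an
   endomorphism), so that involutivity only uses d omega_beta = d S_b = 0.
   For n = 1 the quadratic form (x omega_I + y omega_J + z omega_K)^2 vanishes on the
   null vectors S_b, hence is (x^2 + y^2 + z^2) omega_I^2, which identifies (1) and (2). *)

(** Factoring out [exp(i omega_beta)] makes sense for all parameters but hides polynomiality in [b]:
    both [I_beta] and [s] involve the conjugate of [b]. The cure is that the factorization based at
    [b] with sign [e = 1] equals the one based at [a] with [e = -1]. The first involves only the
    conjugate of [b], the second only that of [a]. So the spinor is polynomial in each parameter
    separately, and interpolation makes it jointly polynomial. Conjugates are carried as independent
    variables, [c] for [b] and [d] for [a], so that quaternionic identities become rational
    identities over a field with [i * i = -1]. The obstacle is the diagonal [a = b], where the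
    eigenbundle is not the graph of a 2-form. The description of the eigenbundle therefore never
    divides by [tau]: the vector [Z] plays the role of [X / tau], and it comes from an explicit
    matrix because the Courant bracket has to differentiate it. The base point [b] of the spinor
    becomes the first complex structure of the bi-Hermitian pair, whence the exchange of parameters
    between (1) and (3). *)

Set Implicit Arguments.
Unset Strict Implicit.
Unset Printing Implicit Defensive.

Import Order.TTheory GRing.Theory Num.Theory.
Import numFieldNormedType.Exports.

Local Open Scope ring_scope.

(** * Exterior algebra in coordinates: creation and annihilation operators *)

Section Exterior.
Context {R : realType} {m : nat}.
Notation C := R[i].
Notation form := (form R m).
Implicit Types (phi psi : form) (X Y xi : 'cV[C]_m) (U : {set 'I_m}).

Definition sgn (a : 'I_m) U : C := (-1) ^+ #|[set k in U | (k < a)%N]%SET|.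

Definition ewedge a phi : form :=
  [ffun U : {set 'I_m} => if a \in U then sgn a U * phi (U :\ a)%SET else 0].

Definition icontr a phi : form :=
  [ffun U : {set 'I_m} => if a \in U then 0 else sgn a U * phi (a |: U)%SET].

Lemma interiorE X phi : interior X phi = \sum_a X a 0 *: icontr a phi.
Proof.
apply/ffunP => U; rewrite !ffunE sum_ffunE big_mkcond; apply: eq_bigr => a _.
rewrite !ffunE; case: (a \in U) => /=; first by rewrite scaler0.
by rewrite /sgn /GRing.scale /= mulrCA.
Qed.

Lemma inversions1 a U : a \in U -> (-1) ^+ inversions [set a] (U :\ a)%SET = sgn a U.
Proof.
move=> aU; rewrite /sgn /inversions; congr (_ ^+ _).
rewrite -(card_imset _ (f := fun k : 'I_m => (a, k))); last by move=> x y [].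
apply: eq_card => -[p q]; rewrite !inE /=; apply/idP/imsetP.
  case/and3P => /eqP -> /andP [_ qU] qa; exists q => //; by rewrite inE qU.
case=> k; rewrite inE => /andP [kU ka] [-> ->]; rewrite eqxx kU ka /= !andbT.
by apply/eqP => ka'; rewrite ka' ltnn in ka.
Qed.

Lemma wedge1E xi phi : wedge (form1 xi) phi = \sum_a xi a 0 *: ewedge a phi.
Proof.
apply/ffunP => U; rewrite !ffunE sum_ffunE.
transitivity (\sum_(S : {set 'I_m} | S \subset U) \sum_(a | S == [set a]%SET)
   (-1) ^+ inversions S (U :\: S) * (xi a 0 * phi (U :\: S))).
  apply: eq_bigr => S SU; rewrite ffunE -mulr_sumr -mulr_suml //.
rewrite (exchange_big_dep predT) //=; apply: eq_bigr => a _.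
rewrite !ffunE.
case: ifPn => aU.
  rewrite (big_pred1 [set a]%SET) ?inversions1 //; first by rewrite mulrCA.
  move=> S /=; case: eqP => [->|_]; rewrite ?andbF ?andbT //; by rewrite sub1set.
rewrite scaler0 big1 // => S /andP [SU /eqP SE].
by rewrite SE sub1set (negPf aU) in SU.
Qed.

Lemma sgnU1 a b U : b \notin U -> sgn a (b |: U)%SET = (-1) ^+ (b < a)%N * sgn a U.
Proof.
move=> bU; rewrite /sgn -exprD; congr (_ ^+ _).
have := cardsD1 b [set k in (b |: U)%SET | (k < a)%N]%SET.
rewrite !inE eqxx /= => ->; congr (_ + _)%N; apply: eq_card => k.
rewrite !inE; case: (eqVneq k b) => [->|_] //=; by rewrite (negPf bU).
Qed.

Lemma sgnD1 a b U : b \in U -> sgn a (U :\ b)%SET = (-1) ^+ (b < a)%N * sgn a U.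
Proof.
move=> bU; rewrite -{2}(setD1K bU) sgnU1 ?setD11 // mulrA -exprD addnn.
by rewrite -signr_odd odd_double expr0 mul1r.
Qed.

Lemma sgn_sq a U : sgn a U * sgn a U = 1.
Proof. by rewrite /sgn -exprD addnn -signr_odd odd_double. Qed.

Lemma sgnaD1 a U : sgn a (U :\ a)%SET = sgn a U.
Proof.
case: (boolP (a \in U)) => aU; last by rewrite setDE setIC; congr (sgn a _);
  apply/setP => k; rewrite !inE; case: eqVneq => [->|] //=; rewrite (negPf aU).
by rewrite sgnD1 // ltnn expr0 mul1r.
Qed.

(** Deleting the other index from [U] flips exactly one of the two signs, the one belonging to the
    larger index. *)
Lemma ewedge_anti a b phi : ewedge a (ewedge b phi) = - ewedge b (ewedge a phi).
Proof.
apply/ffunP => U; rewrite !ffunE !inE.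
case: (eqVneq a b) => [->|nab].
  rewrite /=; by case: (b \in U); rewrite ?mulr0 ?oppr0.
rewrite /=; case: ifPn => aU; case: ifPn => bU; rewrite ?mulr0 ?oppr0 //.
rewrite !sgnD1 // setDDl [_ :|: _]setUC -setDDl.
by case: (ltngtP a b) nab => [||/ord_inj ->]; rewrite ?eqxx // => _ _; ring.
Qed.

Lemma icontr_anti a b phi : icontr a (icontr b phi) = - icontr b (icontr a phi).
Proof.
apply/ffunP => U; rewrite !ffunE !inE.
case: (eqVneq a b) => [->|nab].
  rewrite /=; by case: (b \in U); rewrite ?mulr0 ?oppr0.
rewrite /=; case: ifPn => aU; case: ifPn => bU; rewrite ?mulr0 ?oppr0 //.
rewrite !sgnU1 // setUCA.
by case: (ltngtP a b) nab => [||/ord_inj ->]; rewrite ?eqxx // => _ _; ring.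
Qed.

(** The canonical anticommutation relation. For [a = b] exactly one of the two orders contributes at
    a given [U], depending on whether [a] lies in [U]. *)
Lemma icontr_ewedge a b phi :
  icontr a (ewedge b phi) = (a == b)%:R *: phi - ewedge b (icontr a phi).
Proof.
apply/ffunP => U; rewrite !ffunE !inE.
case: (eqVneq a b) => [<-|nab]; rewrite ?scale1r ?scale0r /=.
  case: (boolP (a \in U)) => aU; rewrite /= ?setD11.
    by rewrite setD1K // sgnaD1 mulrA sgn_sq mul1r subrr.
  by rewrite sgnU1 // ltnn mul1r setU1K // mulrA sgn_sq mul1r subr0.
rewrite /=.
case: (boolP (a \in U)) => aU; case: (boolP (b \in U)) => bU;
  rewrite /= ?mulr0 ?subr0 ?sub0r ?oppr0 //.
rewrite sgnU1 // sgnD1 //.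
have -> : ((a |: U) :\ b)%SET = (a |: U :\ b)%SET.
  by apply/setP => k; rewrite !inE; case: (eqVneq k a) => [->|]; rewrite ?nab ?andbT.
by case: (ltngtP a b) nab => [||/ord_inj ->]; rewrite ?eqxx // => _ _; ring.
Qed.

Lemma ewedge_is_linear a : linear (ewedge a).
Proof.
move=> c phi psi; apply/ffunP => U; rewrite !ffunE; case: ifP => _.
  by rewrite /GRing.scale /=; ring.
by rewrite scaler0 addr0.
Qed.
HB.instance Definition _ a := GRing.isLinear.Build C form form _ (ewedge a) (ewedge_is_linear a).

Lemma icontr_is_linear a : linear (icontr a).
Proof.
move=> c phi psi; apply/ffunP => U; rewrite !ffunE; case: ifP => _.
  by rewrite scaler0 addr0.
by rewrite /GRing.scale /=; ring.
Qed.
HB.instance Definition _ a := GRing.isLinear.Build C form form _ (icontr a) (icontr_is_linear a).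

Lemma wedge_is_linear phi : linear (wedge phi).
Proof.
move=> c psi psi'; apply/ffunP => U; rewrite !ffunE scaler_sumr -big_split /=.
by apply: eq_bigr => S _; rewrite !ffunE /GRing.scale /=; ring.
Qed.
HB.instance Definition _ phi := GRing.isLinear.Build C form form _ (wedge phi) (wedge_is_linear phi).

Lemma wedgeDl phi phi' psi : wedge (phi + phi') psi = wedge phi psi + wedge phi' psi.
Proof.
apply/ffunP => U; rewrite !ffunE -big_split /=.
by apply: eq_bigr => S _; rewrite !ffunE; ring.
Qed.

Lemma wedgeZl c phi psi : wedge (c *: phi) psi = c *: wedge phi psi.
Proof.
apply/ffunP => U; rewrite !ffunE scaler_sumr.
by apply: eq_bigr => S _; rewrite !ffunE /GRing.scale /=; ring.
Qed.

Lemma interior_is_linear X : linear (interior X).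
Proof.
move=> c phi psi; rewrite !interiorE scaler_sumr -big_split /=.
by apply: eq_bigr => a _; rewrite linearP scalerDr !scalerA mulrC.
Qed.
HB.instance Definition _ X := GRing.isLinear.Build C form form _ (interior X) (interior_is_linear X).

Lemma interiorDl X Y phi : interior (X + Y) phi = interior X phi + interior Y phi.
Proof.
by rewrite !interiorE -big_split; apply: eq_bigr => a _; rewrite mxE scalerDl.
Qed.

Lemma interiorZl c X phi : interior (c *: X) phi = c *: interior X phi.
Proof.
by rewrite !interiorE scaler_sumr; apply: eq_bigr => a _; rewrite mxE scalerA.
Qed.

Lemma form1D xi eta : form1 (xi + eta) = form1 xi + form1 eta.
Proof.
by apply/ffunP => U; rewrite !ffunE -big_split; apply: eq_bigr => a _; rewrite mxE.
Qed.

Lemma form1Z c xi : form1 (c *: xi) = c *: form1 xi.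
Proof.
by apply/ffunP => U; rewrite !ffunE scaler_sumr; apply: eq_bigr => a _; rewrite mxE.
Qed.

Lemma form2D (W W' : 'M[C]_m) : form2 (W + W') = form2 W + form2 W'.
Proof.
apply/ffunP => U; rewrite !ffunE -big_split; apply: eq_bigr => a _.
by rewrite -big_split; apply: eq_bigr => b _; rewrite mxE.
Qed.

Lemma form2Z c (W : 'M[C]_m) : form2 (c *: W) = c *: form2 W.
Proof.
apply/ffunP => U; rewrite !ffunE scaler_sumr; apply: eq_bigr => a _.
by rewrite scaler_sumr; apply: eq_bigr => b _; rewrite mxE.
Qed.

Lemma wedge_one phi : wedge phi (@form_one R m) = phi.
Proof.
apply/ffunP => U; rewrite ffunE (bigD1 U) ?subxx //= setDv big1 ?addr0.
  rewrite ffunE eqxx mulr1 /inversions eq_card0 ?expr0 ?mul1r // => p.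
  by rewrite !inE /= andbF.
move=> S /andP [SU nSU]; rewrite ffunE setD_eq0; case: (boolP (U \subset S)) => US.
  by rewrite eqEsubset SU US in nSU.
by rewrite !mulr0.
Qed.

Lemma inversions2 (a b : 'I_m) U : (a < b)%N -> a \in U -> b \in U ->
  (-1) ^+ inversions [set a; b] (U :\: [set a; b])%SET = sgn a U * sgn b (U :\ a)%SET.
Proof.
move=> ab aU bU; have nab : b != a by apply/eqP => e; rewrite e ltnn in ab.
rewrite -[LHS]mulr1 -(expr1n C 2).
have -> : inversions [set a; b] (U :\: [set a; b])%SET =
  (inversions [set a] (U :\: [set a; b]) + inversions [set b] (U :\: [set a; b]))%N.
  rewrite /inversions -cardsUI [X in (_ + #|pred_of_set X|)%N](_ : _ = set0)%SET ?cards0 ?addn0.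
    apply: eq_card => -[p q]; rewrite !inE /=.
    by case: (p == a); case: (p == b); rewrite /= ?orbF ?orbb //.
  apply/setP => -[p q]; rewrite !inE /=; case: (eqVneq p a) => [->|] //=.
  by rewrite [a == b]eq_sym (negPf nab) /= ?andbF.
rewrite exprD expr1n mulr1.
have -> : (U :\: [set a; b] = (U :\ b) :\ a)%SET by rewrite setDDl setUC.
have aUb : a \in (U :\ b)%SET by rewrite !inE [a == b]eq_sym nab.
have bUa : b \in (U :\ a)%SET by rewrite !inE nab.
rewrite inversions1 // setDDl setUC -setDDl inversions1 //.
by rewrite sgnD1 // ltnNge ltnW // expr0 mul1r.
Qed.

Lemma wedge2_ltE (W : 'M[C]_m) phi :
  wedge (form2 W) phi =
  \sum_(a < m) \sum_(b < m | (a < b)%N) W a b *: ewedge a (ewedge b phi).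
Proof.
apply/ffunP => U; rewrite !ffunE sum_ffunE.
transitivity (\sum_(S : {set 'I_m} | S \subset U) \sum_(a < m)
   \sum_(b < m | (a < b)%N && (S == [set a; b])%SET)
   (-1) ^+ inversions S (U :\: S) * (W a b * phi (U :\: S))).
  apply: eq_bigr => S SU; rewrite ffunE mulr_suml mulr_sumr; apply: eq_bigr => a _.
  by rewrite mulr_suml mulr_sumr.
rewrite exchange_big; apply: eq_bigr => a _ /=.
rewrite sum_ffunE (exchange_big_dep (fun b : 'I_m => (a < b)%N)) /=; last first.
  by move=> S b _ /andP [].
apply: eq_bigr => b ab; rewrite !ffunE !inE.
have nab : b != a by apply/eqP => e; rewrite e ltnn in ab.
case: (boolP (a \in U)) => aU; last first.
  rewrite scaler0 big1 // => S /and3P [SU _ /eqP SE]; move: SU.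
  by rewrite SE subUset sub1set (negPf aU).
rewrite nab; case: (boolP (b \in U)) => bU; last first.
  rewrite /= mulr0 scaler0 big1 // => S /and3P [SU _ /eqP SE]; move: SU.
  by rewrite SE subUset !sub1set (negPf bU) andbF.
rewrite /= (big_pred1 [set a; b]%SET).
  by rewrite inversions2 // setDDl /GRing.scale /=; ring.
move=> S /=; rewrite ab /=; case: eqP => [->|_]; rewrite ?andbF ?andbT //.
by rewrite subUset !sub1set aU bU.
Qed.

Lemma addff (v : form) : v + v = (2 : C) *: v.
Proof. by rewrite -[2]/(1 + 1) scalerDl !scale1r. Qed.

Definition skew (W : 'M[C]_m) := W^T = - W.

(** Skewness makes the summand symmetric in [a] and [b], and it vanishes on the diagonal, so the sum
    over all ordered pairs counts each pair [a < b] twice. *)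
Lemma wedge2E (W : 'M[C]_m) phi : skew W ->
  wedge (form2 W) phi =
  2^-1 *: \sum_a \sum_b W a b *: ewedge a (ewedge b phi).
Proof.
move=> /matrixP skW; rewrite wedge2_ltE.
set F := fun a b => W a b *: ewedge a (ewedge b phi).
have FC a b : F a b = F b a.
  have := skW b a; rewrite !mxE /F => ->.
  by rewrite ewedge_anti scalerN scaleNr opprK.
have F0 a : F a a = 0.
  rewrite /F; have /eqP := ewedge_anti a a phi; rewrite -addr_eq0 addff.
  by rewrite scaler_eq0 pnatr_eq0 /= => /eqP ->; rewrite scaler0.
rewrite [in RHS](_ : \sum_a _ =
   \sum_(a < m) \sum_(b < m | (a < b)%N) F a b + \sum_(a < m) \sum_(b < m | (b < a)%N) F a b).
  rewrite [X in _ + X](exchange_big_dep predT) //=.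
  rewrite [X in _ + X](_ : _ = \sum_(a < m) \sum_(b < m | (a < b)%N) F a b).
    rewrite addff scalerA.
    by rewrite mulVf ?pnatr_eq0 ?scale1r.
  by apply: eq_bigr => a _; apply: eq_bigr => b _; rewrite FC.
rewrite -big_split; apply: eq_bigr => a _ /=.
rewrite [LHS](bigID (fun b : 'I_m => (a < b)%N)) /=; congr (_ + _).
rewrite [LHS](bigD1 a) /= ?ltnn // -/(F a a) F0 add0r; apply: eq_bigl => b.
by rewrite -leqNgt ltn_neqAle andbC.
Qed.

End Exterior.

Notation ext xi := (wedge (form1 xi)).
Notation tw W := (wedge (form2 W)).

(** * Clifford action, powers and exponentials of 2-forms *)

Section Clifford.
Context {R : realType} {m : nat}.
Notation C := R[i].
Notation form := (form R m).
Notation one := (@form_one R m).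
Implicit Types (phi psi : form) (X Y xi eta : 'cV[C]_m) (U : {set 'I_m}) (W : 'M[C]_m).

Lemma ext_delta a phi : ext (delta_mx a 0) phi = ewedge a phi.
Proof.
rewrite wedge1E (bigD1 a) //= mxE !eqxx scale1r big1 ?addr0 // => b ba.
by rewrite mxE (negPf ba) scale0r.
Qed.

Lemma extDl xi eta phi : ext (xi + eta) phi = ext xi phi + ext eta phi.
Proof. by rewrite form1D wedgeDl. Qed.

Lemma extZl c xi phi : ext (c *: xi) phi = c *: ext xi phi.
Proof. by rewrite form1Z wedgeZl. Qed.

Lemma ext_sum (I : finType) (c : I -> C) (xi : I -> 'cV[C]_m) phi :
  ext (\sum_k c k *: xi k) phi = \sum_k c k *: ext (xi k) phi.
Proof.
rewrite wedge1E; under [RHS]eq_bigr do rewrite wedge1E scaler_sumr.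
rewrite exchange_big /=; apply: eq_bigr => a _.
rewrite summxE scaler_suml; apply: eq_bigr => k _.
by rewrite mxE scalerA.
Qed.

Lemma ext_anti xi eta phi : ext xi (ext eta phi) = - ext eta (ext xi phi).
Proof.
rewrite !wedge1E -sumrN.
under eq_bigr do rewrite linear_sum scaler_sumr.
under [RHS]eq_bigr do rewrite linear_sum scaler_sumr -sumrN.
rewrite exchange_big /=; apply: eq_bigr => a _; apply: eq_bigr => b _.
by rewrite !linearZ /= ewedge_anti !scalerA scalerN mulrC.
Qed.

Lemma interior_anti X Y phi : interior X (interior Y phi) = - interior Y (interior X phi).
Proof.
rewrite !interiorE -sumrN.
under eq_bigr do rewrite linear_sum scaler_sumr.
under [RHS]eq_bigr do rewrite linear_sum scaler_sumr -sumrN.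
rewrite exchange_big /=; apply: eq_bigr => a _; apply: eq_bigr => b _.
by rewrite !linearZ /= icontr_anti !scalerA scalerN mulrC.
Qed.

Lemma interior_ext X xi phi :
  interior X (ext xi phi) = (xi^T *m X) 0 0 *: phi - ext xi (interior X phi).
Proof.
rewrite wedge1E linear_sum wedge1E mxE scaler_suml -sumrB; apply: eq_bigr => b _.
rewrite linearZ /= !interiorE !linear_sum /= mxE.
rewrite (bigD1 b) //= [in RHS](bigD1 b) //= icontr_ewedge eqxx scale1r.
rewrite linearZ /= !scalerBr !scalerA -addrA.
congr (_ + (_ + _)); first by rewrite mulrC.
  by rewrite [ewedge b (_ *: _)]linearZ /= scalerA mulrC.
apply: eq_bigr => a ab.
by rewrite icontr_ewedge (negPf ab) scale0r sub0r [ewedge b (_ *: _)]linearZ /= !scalerN.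
Qed.

(** The matrix [U] need not be skew: its columns can be chosen among covectors with a known effect
    on [phi], as is done in [tw_topA]. *)
Lemma tw_colE (U : 'M[C]_m) phi :
  tw (U - U^T) phi = \sum_b ext (col b U) (ext (delta_mx b 0) phi).
Proof.
rewrite wedge2E; last by rewrite /skew linearB /= trmxK opprB.
under eq_bigr do under eq_bigr do rewrite mxE [X in _ + X]mxE [X in _ - X]mxE scalerBl.
under eq_bigr do rewrite sumrB; rewrite sumrB /=.
under [X in _ - X]eq_bigr do under eq_bigr do rewrite ewedge_anti scalerN.
under [X in _ - X]eq_bigr do rewrite sumrN; rewrite sumrN opprK.
rewrite [X in _ + X]exchange_big /= addff scalerA mulVf ?pnatr_eq0 // scale1r.
rewrite exchange_big; apply: eq_bigr => b _.
rewrite wedge1E; apply: eq_bigr => a _.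
by rewrite mxE ext_delta.
Qed.

Lemma twE W phi : skew W ->
  tw W phi = 2^-1 *: \sum_b ext (col b W) (ext (delta_mx b 0) phi).
Proof.
move=> skW; have {1}-> : W = (2^-1 *: W) - (2^-1 *: W)^T.
  rewrite linearZ /= skW scalerN opprK.
  by apply/matrixP => i j; rewrite !mxE; field.
rewrite tw_colE scaler_sumr; apply: eq_bigr => b _.
by rewrite linearZ /= extZl.
Qed.

Lemma ext_tw W xi phi : skew W -> ext xi (tw W phi) = tw W (ext xi phi).
Proof.
move=> skW; rewrite !twE // !linear_sum /=; apply: eq_bigr => b _.
rewrite linearZ /=; congr (_ *: _); rewrite ext_anti [ext xi (ext (delta_mx _ _) _)]ext_anti.
by rewrite linearN opprK.
Qed.

Lemma tw_tw W W' phi : skew W -> skew W' -> tw W (tw W' phi) = tw W' (tw W phi).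
Proof.
move=> skW skW'; rewrite (twE phi skW) (twE (tw W' phi) skW) !linear_sum /=.
by apply: eq_bigr => b _; rewrite linearZ /= !ext_tw.
Qed.

Lemma interior_tw W X phi : skew W ->
  interior X (tw W phi) = ext (W^T *m X) phi + tw W (interior X phi).
Proof.
move=> skW; rewrite (twE _ skW) linearZ /= (linear_sum (interior X)) /= (twE (interior X phi) skW).
under eq_bigr do rewrite interior_ext interior_ext linearB linearZ /=.
under eq_bigr do rewrite opprB addrCA addrC.
rewrite big_split /= scalerDr; congr (_ + _).
(* Both slots of the 2-form contribute the same covector by skewness; the resulting 2 cancels the
   [2^-1] of [twE]. *)
have -> : \sum_b (((col b W)^T *m X) 0 0 *: ext (delta_mx b 0) phi -
       ((delta_mx b 0 : 'cV_m)^T *m X) 0 0 *: ext (col b W) phi) =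
   (2 : C) *: ext (W^T *m X) phi; last by rewrite scalerA mulVf ?pnatr_eq0 // scale1r.
rewrite sumrB /= -addff -!ext_sum.
have -> : \sum_b ((delta_mx b 0 : 'cV_m)^T *m X) 0 0 *: col b W = W *m X.
  apply/matrixP => a z; rewrite (ord1 z) summxE mxE; apply: eq_bigr => b _.
  by rewrite trmx_delta -rowE !mxE mulrC.
have -> : \sum_b ((col b W)^T *m X) 0 0 *: delta_mx b 0 = W^T *m X.
  apply/matrixP => a z; rewrite (ord1 z) summxE (bigD1 a) //= big1 ?addr0.
    by rewrite tr_col !mxE !eqxx mulr1; apply: eq_bigr => b _; rewrite !mxE.
  by move=> b ba; rewrite !mxE eq_sym (negPf ba) mulr0.
by rewrite -scaleN1r -extZl scaleN1r -mulNmx -skW.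
Qed.

Definition homog (d : nat) phi := forall U : {set 'I_m}, #|U| != d -> phi U = 0.

Lemma tw_support W phi U : skew W ->
  (forall V : {set 'I_m}, #|V|.+2 = #|U| -> phi V = 0) ->
  tw W phi U = 0.
Proof.
move=> skW phi0; rewrite wedge2E // ffunE sum_ffunE big1 ?scaler0 // => a _.
rewrite sum_ffunE big1 // => b _; rewrite !ffunE.
case: ifPn => aU; last by rewrite scaler0.
case: ifPn => bU; last by rewrite mulr0 scaler0.
have card2 : #|((U :\ a) :\ b)%SET|.+2 = #|U|.
  by rewrite [RHS](cardsD1 a) aU (cardsD1 b (U :\ a)%SET) bU.
by rewrite phi0 ?mulr0 ?scaler0 ?card2.
Qed.

Lemma iter_tw_low W phi k U : skew W -> (#|U| < k.*2)%N -> iter k (tw W) phi U = 0.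
Proof.
move=> skW; elim: k U => [|k IH] U //= Uk; apply: tw_support => // V VU.
by apply: IH; move: Uk; rewrite -VU doubleS.
Qed.

Lemma iter_tw_nil W phi k : skew W -> (m < k.*2)%N -> iter k (tw W) phi = 0.
Proof.
move=> skW mk; apply/ffunP => U; rewrite ffunE iter_tw_low //.
by apply: leq_ltn_trans mk; rewrite -[X in (_ <= X)%N]card_ord max_card.
Qed.

Lemma iter_tw_homog W k : skew W -> homog k.*2 (iter k (tw W) one).
Proof.
move=> skW; elim: k => [|k IH] U /=.
  by rewrite ffunE cards_eq0 => /negPf ->.
rewrite doubleS => Uk; apply: tw_support => // V VU; apply: IH.
by apply: contraNN Uk => /eqP <-; rewrite VU.
Qed.

(** Each index of [U] contributes one copy of the coefficient at [U], multiplied by the square of a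
    sign, so this operator measures the degree. *)
Lemma number_op d phi : homog d phi ->
  \sum_a ewedge a (icontr a phi) = d%:R *: phi.
Proof.
move=> hphi; apply/ffunP => U; rewrite sum_ffunE !ffunE.
have [Ud|Ud] := eqVneq #|U| d; last first.
  rewrite (hphi _ Ud) scaler0 big1 // => a _; rewrite !ffunE.
  by case: ifP => // aU; rewrite setD11 setD1K // (hphi _ Ud) !mulr0.
rewrite -Ud -sum1_card natr_sum scaler_suml [RHS]big_mkcond /=; apply: eq_bigr => a _.
rewrite !ffunE; case: ifP => // aU.
by rewrite setD11 setD1K // sgnaD1 mulrA sgn_sq mul1r scale1r.
Qed.

Lemma interior_one X : interior X one = 0.
Proof.
apply/ffunP => U; rewrite !ffunE big1 // => j jU; rewrite ffunE.
by rewrite -cards_eq0 cardsU1 jU !mulr0.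
Qed.

(** The derivation rule for a k-th power. At [k = 0] the predecessor [k.-1] is a default value,
    harmless because its coefficient is 0. *)
Lemma interior_iter W X k phi : skew W ->
  interior X (iter k (tw W) phi) =
  iter k (tw W) (interior X phi) + k%:R *: ext (W^T *m X) (iter k.-1 (tw W) phi).
Proof.
move=> skW; elim: k => [|k IH] /=; first by rewrite scale0r addr0.
rewrite interior_tw // IH linearD linearZ /= addrCA; congr (_ + _).
case: k {IH} => [|k] /=; first by rewrite scale0r addr0 scale1r.
rewrite -(ext_tw _ _ skW) -[X in X + _ *: _]scale1r -scalerDl.
by rewrite -[1]/(1%:R) -natrD.
Qed.

Lemma interior_pow W X k : skew W ->
  interior X (iter k (tw W) one) = k%:R *: ext (W^T *m X) (iter k.-1 (tw W) one).
Proof.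
move=> skW; rewrite interior_iter // interior_one.
suff -> : iter k (tw W) 0 = 0 by rewrite add0r.
by elim: k => //= k ->; rewrite linear0.
Qed.

(** The equation determines the coefficients of degree d by those of degree d - 2, since contraction
    lowers the degree and the covector raises it. Off the diagonal this identifies two spinors that
    have the same annihilator. *)
Lemma graph_spinor_unique W psi :
  (forall X, interior X psi = ext (W^T *m X) psi) -> psi set0 = 0 -> psi = 0.
Proof.
move=> psiW psi0; apply/ffunP => U; rewrite [RHS]ffunE.
have [k] := ubnP #|U|; elim: k U => // k IH U.
have [->|/set0Pn [j jU]] := eqVneq U set0 => //; rewrite ltnS => Uk.
have /ffunP /(_ (U :\ j)%SET) := psiW (delta_mx j 0).
have low (V : {set 'I_m}) : (#|V| < #|U|)%N -> psi V = 0 by move=> ?; apply: IH; apply: leq_trans Uk.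
have cU : (#|(U :\ j)%SET| < #|U|)%N by rewrite [X in (_ < X)%N](cardsD1 j) jU.
rewrite wedge1E sum_ffunE [RHS]big1 => [|a _]; last first.
  rewrite !ffunE; case: ifP => aU; last by rewrite scaler0.
  rewrite low ?mulr0 ?scaler0 //; apply: leq_ltn_trans cU.
  by apply: subset_leq_card; apply: subsetDl.
rewrite interiorE sum_ffunE (bigD1 j) //= big1 ?addr0 => [|a aj]; last first.
  by rewrite !ffunE mxE (negPf aj) scale0r.
rewrite !ffunE mxE !eqxx scale1r setD11 setD1K // => /eqP.
by rewrite mulf_eq0 signr_eq0 => /eqP.
Qed.

(** The exponential of the 2-form of [W], wedged with [phi]. For skew [W] the cut-off loses nothing,
    since the k-th power vanishes as soon as 2k exceeds [m]. *)
Definition expo W phi : form := \sum_(k < m.+1) (k`!%:R)^-1 *: iter k (tw W) phi.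

Lemma iter_tw_is_linear W k : linear (iter k (tw W)).
Proof. by move=> c phi psi; elim: k => //= k ->; rewrite linearP. Qed.

Lemma iter_tw0 W k : iter k (tw W) 0 = 0.
Proof. by elim: k => //= k ->; rewrite linear0. Qed.

Lemma expo_is_linear W : linear (expo W).
Proof.
move=> c phi psi; rewrite /expo scaler_sumr -big_split; apply: eq_bigr => k _ /=.
by rewrite iter_tw_is_linear scalerDr !scalerA mulrC.
Qed.
HB.instance Definition _ W := GRing.isLinear.Build C form form _ (expo W) (expo_is_linear W).

Lemma ext_expo W xi phi : skew W -> ext xi (expo W phi) = expo W (ext xi phi).
Proof.
move=> skW; rewrite /expo linear_sum; apply: eq_bigr => k _ /=.
rewrite linearZ /=; congr (_ *: _); elim: {k}(k : nat) => //= k IH.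
by rewrite ext_tw // IH.
Qed.

(** The boundary term of [interior_expo]: contraction shifts the series by one, which leaves the
    term [k = m] without a partner. For [m = 0] this is no degree count; there are simply no
    covectors. *)
Lemma ext_iter_top W xi phi : skew W -> ext xi (iter m (tw W) phi) = 0.
Proof.
move=> skW; have [m0|m0] := posnP m.
  by rewrite wedge1E big1 // => a _; move: (ltn_ord a); rewrite {2}m0.
by rewrite iter_tw_nil ?linear0 // -addnn -[X in (X < _)%N]addn0 ltn_add2l.
Qed.

Lemma interior_expo W X phi : skew W ->
  interior X (expo W phi) = expo W (interior X phi) + ext (W^T *m X) (expo W phi).
Proof.
move=> skW; rewrite /expo !linear_sum.
under eq_bigr do rewrite linearZ /= interior_iter // scalerDr.
rewrite big_split /=; congr (_ + _).
rewrite big_ord_recl scale0r scaler0 add0r big_ord_recr /=.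
rewrite [ext _ (_ *: iter m _ _)]linearZ /= ext_iter_top // scaler0 addr0.
apply: eq_bigr => k _; rewrite [ext _ (_ *: _)]linearZ /= scalerA; congr (_ *: _).
rewrite /bump add1n factS natrM invfM mulrC mulrA divff ?mul1r //.
Qed.

Lemma expo_set0 W phi : skew W -> expo W phi set0 = phi set0.
Proof.
move=> skW; rewrite /expo sum_ffunE big_ord_recl big1 ?addr0 => [|k _].
  by rewrite ffunE fact0 invr1 scale1r.
by rewrite ffunE iter_tw_low ?scaler0 // cards0.
Qed.

Lemma expo_id W phi : tw W phi = 0 -> expo W phi = phi.
Proof.
move=> W0; rewrite /expo big_ord_recl big1 ?addr0 => [|k _].
  by rewrite fact0 invr1 scale1r.
by rewrite iterSr W0 iter_tw0 scaler0.
Qed.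

(** If [u] and [v] both kill a nonzero [phi], the scalar on the right must vanish: annihilators are
    isotropic. *)
Lemma clifford_anti u v phi : clifford u (clifford v phi) + clifford v (clifford u phi) =
  (((dsubmx u)^T *m usubmx v) 0 0 + ((dsubmx v)^T *m usubmx u) 0 0) *: phi.
Proof.
rewrite /clifford !linearD /= !interior_ext ext_anti interior_anti scalerDl.
move: (interior _ (interior _ _)) (ext _ (ext _ _)) => A B.
move: (ext _ (interior _ _)) (ext _ (interior _ _)) => c d.
by apply/ffunP => U; rewrite !ffunE /GRing.scale /=; ring.
Qed.

(** Conjugation by the exponential is the B-field transform, which adds [iota_X W] to the covector
    part. *)
Lemma clifford_expo W u phi : skew W ->
  clifford u (expo W phi) =
  expo W (clifford (col_mx (usubmx u) (dsubmx u + W^T *m usubmx u)) phi).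
Proof.
move=> skW; rewrite /clifford col_mxKu col_mxKd extDl !linearD /=.
by rewrite interior_expo // -!ext_expo // -addrA [_ + ext (dsubmx u) _]addrC.
Qed.

(* At the largest k with W^k <> 0, contracting W^(k+1) = 0 shows that W^k is killed by the image of W; a
   form killed by im W and ker W is a multiple of the product of all the
   covectors in im W, and so has degree rk W. *)
Lemma top_power_degree W (P Z : 'M[C]_m) k d : skew W ->
  W^T *m (1%:M - P) = 0 -> P^T = W^T *m Z -> \tr P = d%:R ->
  iter k (tw W) one != 0 -> iter k.+1 (tw W) one = 0 -> k.*2 = d.
Proof.
move=> skW WP PZ trP pk_neq0 pk1; set psi := iter k (tw W) one.
have ker X : W^T *m X = 0 -> interior X psi = 0.
  by move=> WX; rewrite interior_pow // WX wedge1E big1 ?scaler0 // => a _; rewrite mxE scale0r.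
have im X : ext (W^T *m X) psi = 0.
  have := interior_pow X k.+1 skW; rewrite pk1 linear0 /= => /esym/eqP.
  by rewrite scaler_eq0 pnatr_eq0 => /eqP.
have icontrP a : icontr a psi = \sum_b P b a *: icontr b psi.
  have : interior ((1%:M - P) *m delta_mx a 0) psi = 0.
    by apply: ker; rewrite mulmxA WP mul0mx.
  rewrite -colE interiorE; under eq_bigr do rewrite !mxE scalerBl.
  rewrite sumrB (bigD1 a) //= eqxx scale1r big1 ?addr0 => [|b ba]; last first.
    by rewrite (negPf ba) scale0r.
  by move/eqP; rewrite subr_eq0 => /eqP.
(* The number operator is computed in two ways. By [icontrP] it is the sum over [b] of [icontr b]
   followed by [ext (P^T e_b)]. In the opposite order [ext (P^T e_b)] kills [psi], so only the
   anticommutators remain, and they add up to the trace of [P]. *)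
have : k.*2%:R *: psi = d%:R *: psi.
  rewrite -(number_op (@iter_tw_homog W k skW)) -/psi.
  under eq_bigr do rewrite icontrP linear_sum.
  rewrite exchange_big /= -trP /mxtrace scaler_suml; apply: eq_bigr => b _.
  have bE : interior (delta_mx b 0) psi = icontr b psi.
    rewrite interiorE (bigD1 b) //= mxE !eqxx scale1r big1 ?addr0 // => a ab.
    by rewrite mxE (negPf ab) scale0r.
  transitivity (ext (P^T *m delta_mx b 0) (icontr b psi)).
    rewrite wedge1E; apply: eq_bigr => a _.
    by rewrite linearZ /= -colE !mxE.
  have := interior_ext (delta_mx b 0) (P^T *m delta_mx b 0) psi.
  rewrite {1}PZ -mulmxA im linear0 bE => /esym/eqP; rewrite subr_eq0 => /eqP <-.
  by congr (_ *: _); rewrite trmx_mul trmxK trmx_delta -rowE -colE !mxE.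
by move/eqP; rewrite -subr_eq0 -scalerBl scaler_eq0 (negPf pk_neq0) orbF subr_eq0 eqr_nat => /eqP.
Qed.

(** [P] plays the role of a projection along the kernel of [W^T], with [P^T] valued in the image, so
    its trace is the rank. The last nonvanishing power of [W], which exists for degree reasons, must
    then be the n-th. *)
Lemma top_powerP W (P Z : 'M[C]_m) n : skew W ->
  W^T *m (1%:M - P) = 0 -> P^T = W^T *m Z -> \tr P = n.*2%:R ->
  iter n (tw W) one != 0 /\ iter n.+1 (tw W) one = 0.
Proof.
move=> skW WP PZ trP.
have one_neq0 : one != 0.
  apply/eqP => /ffunP /(_ set0); rewrite !ffunE eqxx => /eqP.
  by rewrite oner_eq0.
have ex : exists k, iter k (tw W) one == 0.
  by exists m.+1; rewrite iter_tw_nil // doubleS -addnn; lia.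
have [[|k] /eqP k0 kmin] := ex_minnP ex; first by case/negP: one_neq0; apply/eqP.
have kn0 : iter k (tw W) one != 0.
  by apply/negP => /kmin; rewrite ltnn.
have := top_power_degree skW WP PZ trP kn0 k0.
by move=> /double_inj <-.
Qed.

End Clifford.

(** * Quaternion algebra and the twistor sphere in homogeneous coordinates *)

Record quaternionic (F : fieldType) (m : nat) (I J K : 'M[F]_m) : Prop := Quaternionic {
  quatII : I *m I = - 1%:M; quatJJ : J *m J = - 1%:M; quatKK : K *m K = - 1%:M;
  quatIJ : I *m J = K; quatJI : J *m I = - K;
  quatJK : J *m K = I; quatKJ : K *m J = - I;
  quatKI : K *m I = J; quatIK : I *m K = - J }.

Section Quaternions.
Context {F : fieldType} {m : nat} (I J K : 'M[F]_m).
Hypothesis HQ : quaternionic I J K.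

Definition quat w x y z : 'M[F]_m := w%:M + x *: I + y *: J + z *: K.

(** Reduces matrix identities to four scalar ones; equality of the scalars suffices even where [1],
    [I], [J], [K] are linearly dependent. *)
Lemma quatM w x y z w' x' y' z' : quat w x y z *m quat w' x' y' z' =
  quat (w * w' - x * x' - y * y' - z * z') (w * x' + x * w' + y * z' - z * y')
       (w * y' + y * w' + z * x' - x * z') (w * z' + z * w' + x * y' - y * x').
Proof.
case: HQ => II JJ KK IJ JI JK KJ KI IK.
rewrite /quat !(mulmxDl, mulmxDr, mul_scalar_mx, mul_mx_scalar).
rewrite -?scalemxAl -?scalemxAr ?II ?JJ ?KK ?IJ ?JI ?JK ?KJ ?KI ?IK.
by apply/matrixP => i j; rewrite !mxE; ring.
Qed.

Lemma quatD w x y z w' x' y' z' : quat w x y z + quat w' x' y' z' =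
  quat (w + w') (x + x') (y + y') (z + z').
Proof. by rewrite /quat; apply/matrixP => i j; rewrite !mxE; ring. Qed.

Lemma quatZ k w x y z : k *: quat w x y z = quat (k * w) (k * x) (k * y) (k * z).
Proof. by rewrite /quat; apply/matrixP => i j; rewrite !mxE; ring. Qed.

Lemma quatN w x y z : - quat w x y z = quat (- w) (- x) (- y) (- z).
Proof. by rewrite /quat; apply/matrixP => i j; rewrite !mxE; ring. Qed.

Lemma quat_scalar w : w%:M = quat w 0 0 0.
Proof. by rewrite /quat !scale0r !addr0. Qed.

(** The imaginary units are halves of commutators, hence traceless once 2 is invertible. *)
Lemma quat_tr w x y z : (2 : F) != 0 -> \tr (quat w x y z) = m%:R * w.
Proof.
case: HQ => II JJ KK IJ JI JK KJ KI IK n2; have tr0 (A B D : 'M[F]_m) : A *m B = D -> B *m A = - D -> \tr D = 0.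
  move=> AB BA; have := mxtrace_mulC A B; rewrite AB BA linearN => /eqP.
  rewrite -addr_eq0 -mulr2n -[_ *+ 2]mulr_natl mulf_eq0 (negPf n2).
  by move=> /eqP.
rewrite /quat !linearD !linearZ /= mxtrace_scalar (tr0 _ _ _ IJ JI) (tr0 _ _ _ JK KJ).
by rewrite (tr0 _ _ _ KI IK) !mulr0 !addr0 mulr_natl.
Qed.

Variables (i : F).
Hypothesis i2 : i * i = -1.
Let i2' : i ^+ 2 = -1.
Proof. by rewrite expr2. Qed.

Ltac conds := repeat (apply/andP; split); by [].
Ltac fi := first [by [] | field: i2; conds | field: i2'; conds | by field; conds].

(** With [c] the conjugate of [b] this is [I_beta] for [beta = b1 / b0], without a case distinction
    at infinity. *)
Definition endoA (b0 b1 c0 c1 : F) :=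
  let N := b0 * c0 + b1 * c1 in
  quat 0 ((b0 * c0 - b1 * c1) / N) ((b1 * c0 + b0 * c1) / N)
    (- i * (b1 * c0 - b0 * c1) / N).
(** The homogenized numerator of the exponent in (1), read as an endomorphism. It is symmetric and
    bilinear in the two points, and its diagonal values are the [S_b]. *)
Definition endoB (a0 a1 b0 b1 : F) :=
  quat 0 (- (a1 * b0 + a0 * b1)) (a0 * b0 - a1 * b1) (i * (a0 * b0 + a1 * b1)).
(** The complex conjugate of [S_b], again with [c] in place of the conjugate of [b]. *)
Definition endoBc (c0 c1 : F) :=
  quat 0 (- (2 * c0 * c1)) (c0 * c0 - c1 * c1) (- i * (c0 * c0 + c1 * c1)).

Lemma endoB_sq b0 b1 : endoB b0 b1 b0 b1 *m endoB b0 b1 b0 b1 = 0.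
Proof.
rewrite [RHS](_ : _ = quat 0 0 0 0); last by rewrite -quat_scalar raddf0.
by rewrite quatM; congr quat; fi.
Qed.

Lemma endoB_scale s b0 b1 :
  endoB (s * b0) (s * b1) (s * b0) (s * b1) = s ^+ 2 *: endoB b0 b1 b0 b1.
Proof. by rewrite /endoB quatZ; congr quat; ring. Qed.

Lemma endoB_sym a0 a1 b0 b1 : endoB a0 a1 b0 b1 = endoB b0 b1 a0 a1.
Proof. by rewrite /endoB; congr quat; ring. Qed.

Section Point.
Variables (b0 b1 c0 c1 : F).
Local Notation N := (b0 * c0 + b1 * c1).
Hypothesis N0 : N != 0.
Local Notation A := (endoA b0 b1 c0 c1).
Local Notation S := (endoB b0 b1 b0 b1).
Local Notation Sc := (endoBc c0 c1).

Lemma endoA_sq : A *m A = - 1%:M.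
Proof. by rewrite quat_scalar quatN quatM; congr quat; fi. Qed.

Lemma endoA_endoB : A *m S = - i *: S.
Proof. by rewrite quatZ quatM; congr quat; fi. Qed.

Lemma endoB_endoA : S *m A = i *: S.
Proof. by rewrite quatZ quatM; congr quat; fi. Qed.

(** [1 + i A] and [1 - i A] are twice the projectors onto the -i- and +i-eigenspaces of [A]. So [S]
    maps the +i-eigenspace isomorphically onto the -i-eigenspace, with [Sc] as inverse up to
    scale. *)
Lemma endoB_endoBc : S *m Sc = (- 2 * N ^+ 2) *: (1%:M + i *: A).
Proof. by rewrite quat_scalar !(quatZ, quatD) quatM; congr quat; fi. Qed.

Lemma endoBc_endoB : Sc *m S = (- 2 * N ^+ 2) *: (1%:M - i *: A).
Proof. by rewrite quat_scalar -scaleNr !(quatZ, quatD) quatM; congr quat; fi. Qed.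

Section Two.
Variables (a0 a1 d0 d1 : F).
Local Notation M := (a0 * d0 + a1 * d1).
Hypothesis M0 : M != 0.
Hypotheses (n2 : (2 : F) != 0) (n4 : (4 : F) != 0).
Local Notation D := (endoA a0 a1 d0 d1).
Local Notation s := ((a0 * c0 + a1 * c1) / N).
Local Notation tau := (i * (a1 * b0 - a0 * b1)).
Local Notation P := (tau *: (1%:M - i *: A) - s *: S).

Lemma endoB_decomp : endoB a0 a1 b0 b1 = s *: S + (i * tau) *: A.
Proof. by rewrite !(quatZ, quatD); congr quat; fi. Qed.

(** [P] kills the -i-eigenspace of [A] and sends [v] in the +i-eigenspace to [2 tau v - s S v]. The
    -i-eigenspace of [I_alpha] thus appears as a graph, which degenerates to the image of [S] when
    [tau = 0]. *)
Lemma endoA_proj : D *m P = - i *: P.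
Proof.
rewrite quat_scalar -!scaleNr !(quatZ, quatD) quatM; congr quat; fi.
Qed.

(** [(1 + i D) / 2] projects onto the -i-eigenspace of [D], so every vector there is [P Z] for some
    [Z]. The witness combines the two available maps into the +i-eigenspace of [A]. Its denominators
    contain [M] and [N] but not [tau], so it survives on the diagonal. *)
Lemma proj_section :
  P *m (((i * (c1 * d0 - c0 * d1) / N / (4 * M)) *: (1%:M - i *: A))
        + ((b0 * d0 + b1 * d1) / N / (4 * M * N)) *: Sc) = 2^-1 *: (1%:M + i *: D).
Proof.
rewrite quat_scalar -!scaleNr !(quatZ, quatD) quatM; congr quat; fi.
Qed.

End Two.
End Point.

Lemma endoA_tr b0 b1 c0 c1 : (2 : F) != 0 -> b0 * c0 + b1 * c1 != 0 ->
  \tr (2^-1 *: (1%:M - i *: endoA b0 b1 c0 c1)) = m%:R / 2.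
Proof.
by move=> n2 N0; rewrite quat_scalar -!scaleNr !(quatZ, quatD) quat_tr // !(mulr0, addr0, mulr1).
Qed.

End Quaternions.

(** * Coordinates of one point of the projective line relative to another *)

Section RelativeCoordinates.
Context {F : fieldType}.
Implicit Types (i a b c d : F).

(* In terms of b and its conjugate c, a = s b + t' b^perp with t = i t' <b, c>. *)
Definition sparam a0 a1 b0 b1 c0 c1 := (a0 * c0 + a1 * c1) / (b0 * c0 + b1 * c1).
Definition tparam i a0 a1 b0 b1 := i * (a1 * b0 - a0 * b1).

Lemma tparamC i a0 a1 b0 b1 : tparam i b0 b1 a0 a1 = - tparam i a0 a1 b0 b1.
Proof. by rewrite /tparam; ring. Qed.

Lemma sparam_lin a0 a1 b0 b1 c0 c1 : sparam a0 a1 b0 b1 c0 c1 =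
  c0 / (b0 * c0 + b1 * c1) * a0 + c1 / (b0 * c0 + b1 * c1) * a1.
Proof. by rewrite /sparam; ring. Qed.

Lemma tparam_lin i a0 a1 b0 b1 : tparam i a0 a1 b0 b1 = - (i * b1) * a0 + (i * b0) * a1.
Proof. by rewrite /tparam; ring. Qed.

Lemma sparam_parallel a0 a1 b0 b1 c0 c1 : b0 * c0 + b1 * c1 != 0 -> a1 * b0 = a0 * b1 ->
  a0 = sparam a0 a1 b0 b1 c0 c1 * b0 /\ a1 = sparam a0 a1 b0 b1 c0 c1 * b1.
Proof.
move=> N0 ab; rewrite /sparam ![_ / _ * _]mulrAC; split; apply: (canRL (mulfK N0)).
  by ring: ab.
by ring: ab.
Qed.

Lemma sparam_inv a0 a1 b0 b1 c0 c1 d0 d1 : a0 * d0 + a1 * d1 != 0 ->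
  b0 * c0 + b1 * c1 != 0 -> a1 * b0 = a0 * b1 ->
  sparam b0 b1 a0 a1 d0 d1 * sparam a0 a1 b0 b1 c0 c1 = 1.
Proof.
move=> M0 N0 ab; have [] := sparam_parallel N0 ab.
set s := sparam a0 a1 _ _ _ _ => a0E a1E.
rewrite [X in X * _]/sparam mulrAC; apply: (canLR (mulfK M0)).
by clearbody s; rewrite a0E a1E; ring.
Qed.

End RelativeCoordinates.

(** Six unknown coefficients and five conditions: the vectors are five distinct points of the smooth
    conic [x^2 + y^2 + z^2 = 0], which determine it, so [Q] is a multiple of its equation. *)
Lemma null_quadric (F : fieldType) (i a b c d e f : F) :
  let Q x y z := x * x * a + y * y * b + z * z * c + 2 * (x * y) * d + 2 * (x * z) * e
                 + 2 * (y * z) * f in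
  (2 : F) != 0 -> i * i = -1 -> Q 0 1 i = 0 -> Q 0 (-1) i = 0 -> Q (-2) 0 (2 * i) = 0 ->
  Q 2 0 (2 * i) = 0 -> Q (-2 * i) 2 0 = 0 ->
  forall x y z, Q x y z = (x * x + y * y + z * z) * a.
Proof.
move=> Q n2 i2 e1 e2 e3 e4 e5.
have i0 : i != 0 by apply: contra_eq_neq i2 => ->; rewrite mul0r eq_sym oppr_eq0 oner_eq0.
have n4 : (4 : F) != 0 by rewrite (natrM _ 2 2) mulf_neq0.
have n8 : (8 : F) != 0 by rewrite (natrM _ 2 4) mulf_neq0.
have n16 : (16 : F) != 0 by rewrite (natrM _ 2 8) mulf_neq0.
have f0 : f = 0.
  apply: (mulfI (mulf_neq0 n4 i0)); rewrite mulr0.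
  transitivity (Q 0 1 i - Q 0 (-1) i); first by rewrite /Q; ring.
  by rewrite e1 e2 subrr.
have e0 : e = 0.
  apply: (mulfI (mulf_neq0 n16 i0)); rewrite mulr0.
  transitivity (Q 2 0 (2 * i) - Q (-2) 0 (2 * i)); first by rewrite /Q; ring.
  by rewrite e3 e4 subrr.
have bc : b = c.
  apply/eqP; rewrite -subr_eq0; apply/eqP.
  transitivity (Q 0 1 i - 2 * i * f - (i * i + 1) * c); first by rewrite /Q; ring.
  by rewrite e1 f0 i2; ring.
have ac : a = c.
  apply/eqP; rewrite -subr_eq0; apply/eqP; apply: (mulfI n4); rewrite mulr0.
  transitivity (Q 2 0 (2 * i) - 8 * i * e - 4 * (i * i + 1) * c); first by rewrite /Q; ring.
  by rewrite e4 e0 i2; ring.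
have d0 : d = 0.
  apply: (mulfI (mulf_neq0 n8 i0)); rewrite mulr0.
  transitivity (4 * (i * i + 1) * a + 4 * (b - a) - Q (-2 * i) 2 0); first by rewrite /Q; ring.
  by rewrite e5 bc ac i2; ring.
by move=> x y z; rewrite /Q f0 e0 d0 bc ac; ring.
Qed.

Section NullVectors.
Context {F : fieldType} {m : nat} (I J K : 'M[F]_m) (i : F).

(** The null vectors [S_b] at beta = 0, infinity, 1, -1 and [i], in the order in which
    [null_quadric] takes them. *)
Lemma endoB10 : endoB I J K i 1 0 1 0 = quat I J K 0 0 1 i.
Proof. by congr quat; ring. Qed.
Lemma endoB01 : endoB I J K i 0 1 0 1 = quat I J K 0 0 (-1) i.
Proof. by congr quat; ring. Qed.
Lemma endoB11 : endoB I J K i 1 1 1 1 = quat I J K 0 (-2) 0 (2 * i).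
Proof. by congr quat; ring. Qed.
Lemma endoB1N1 : endoB I J K i 1 (-1) 1 (-1) = quat I J K 0 2 0 (2 * i).
Proof. by congr quat; ring. Qed.
Lemma endoB1i : i * i = -1 -> endoB I J K i 1 i 1 i = quat I J K 0 (-2 * i) 2 0.
Proof. by move=> i2; congr quat; rewrite ?i2; ring. Qed.

End NullVectors.

(** * The exponential with its denominators cleared *)

Section Psi.
Context {R : realType} {m n : nat}.
Notation C := R[i].
Notation form := (form R m).
Notation one := (@form_one R m).
Variables (W : 'M[C]_m) (skW : skew W).
Implicit Types (t s : C) (X Z : 'cV[C]_m).

(* exp (s W / t) scaled by t ^ n, cut off at the degree n *)
Definition psi t s : form :=
  \sum_(k < n.+1) (t ^+ (n - k) * s ^+ k / k`!%:R) *: iter k (tw W) one.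

Lemma psi_set0 t s : psi t s set0 = t ^+ n.
Proof.
rewrite /psi sum_ffunE big_ord_recl big1 ?addr0 => [|k _].
  by rewrite !ffunE eqxx subn0 expr0 fact0 divr1 mulr1 /GRing.scale /= mulr1.
by rewrite ffunE iter_tw_low ?scaler0 // cards0.
Qed.

Lemma psi_t0 s : psi 0 s = (s ^+ n / n`!%:R) *: iter n (tw W) one.
Proof.
rewrite /psi big_ord_recr /= big1 ?add0r => [|k _].
  by rewrite subnn expr0 mul1r.
by rewrite expr0n subn_eq0 leqNgt ltn_ord /= !mul0r scale0r.
Qed.

Lemma psi_ker X t s : W^T *m X = 0 -> interior X (psi t s) = 0.
Proof.
move=> WX; rewrite linear_sum big1 // => k _; rewrite linearZ /= interior_pow // WX.
by rewrite wedge1E [X in _ *: (_ *: X)]big1 ?scaler0 // => a _; rewrite mxE scale0r.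
Qed.

Hypothesis top : iter n.+1 (tw W) one = 0.

Lemma ext_top Z : ext (W^T *m Z) (iter n (tw W) one) = 0.
Proof.
have := interior_pow Z n.+1 skW; rewrite top linear0 /= => /esym/eqP.
by rewrite scaler_eq0 pnatr_eq0 => /eqP.
Qed.

(** The derivation rule for [exp(s W / t)], multiplied by [t]. Contraction shifts the index, and the
    leftover term on the right is killed by [ext_top], so the identity also holds at [t = 0]. *)
Lemma psi_contr Z t s : t *: interior Z (psi t s) = s *: ext (W^T *m Z) (psi t s).
Proof.
set P := fun k => iter k (tw W) one; set E := ext (W^T *m Z).
have contr k c : t *: interior Z (c *: P k.+1) = (t * c * k.+1%:R) *: E (P k).
  by rewrite [interior Z _]linearZ /= -[tw W _]/(iter k.+1 (tw W) one) interior_pow // !scalerA.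
have exte k c : s *: E (c *: P k) = (s * c) *: E (P k).
  by rewrite [E _]linearZ /= scalerA.
have -> : t *: interior Z (psi t s) =
    \sum_(k < n) (t * (t ^+ (n - k.+1) * s ^+ k.+1 / k.+1`!%:R) * k.+1%:R) *: E (P k).
  rewrite /psi linear_sum scaler_sumr big_ord_recl [X in X + _](_ : _ = 0) ?add0r.
    by apply: eq_bigr => k _; rewrite contr.
  by rewrite linearZ /= interior_one !scaler0.
have -> : s *: E (psi t s) =
    \sum_(k < n) (s * (t ^+ (n - k) * s ^+ k / k`!%:R)) *: E (P k).
  rewrite /psi {1}/E linear_sum scaler_sumr big_ord_recr /= -/E exte.
  rewrite [E (P n)]ext_top scaler0 addr0.
  by apply: eq_bigr => k _; rewrite exte.
apply: eq_bigr => k _; congr (_ *: _).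
have -> : (n - k = (n - k.+1).+1)%N by rewrite subnSK.
have f0 : k`!%:R != 0 :> C by rewrite pnatr_eq0 -lt0n fact_gt0.
have k0 : k.+1%:R != 0 :> C by rewrite pnatr_eq0.
rewrite factS natrM; move: f0 k0; move: (k`!%:R) (k.+1%:R) => u v u0 v0.
by rewrite !exprS; field; apply/andP.
Qed.

End Psi.
Arguments psi {R m} n W t s.

(** * Vector-valued homogeneous polynomials in two variables *)

Section HomogeneousPolynomials.
Context {C : fieldType} {V : lmodType C}.

(** Homogeneity is what allows the value at infinity to be read off at [(a0, a1) = (0, 1)], in
    agreement with [mono]. *)
Definition hpoly (n : nat) (f : C -> C -> V) :=
  exists c : nat -> V, forall a0 a1, f a0 a1 = \sum_(j < n.+1) (a1 ^+ j * a0 ^+ (n - j)) *: c j.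

Lemma hpoly_ext n f g : (forall a0 a1, f a0 a1 = g a0 a1) -> hpoly n f -> hpoly n g.
Proof. by move=> fg [c fE]; exists c => a0 a1; rewrite -fg. Qed.

Lemma hpoly0 v : hpoly 0 (fun _ _ => v).
Proof. by exists (fun=> v) => a0 a1; rewrite big_ord1 !expr0 mulr1 scale1r. Qed.

Lemma hpolyM1 n f x y : hpoly n f -> hpoly n.+1 (fun a0 a1 => (x * a0 + y * a1) *: f a0 a1).
Proof.
move=> [c fE]; exists (fun j => (if j is j'.+1 then y *: c j' else 0) +
                         (if (j <= n)%N then x *: c j else 0)) => a0 a1.
rewrite fE scalerDl !scaler_sumr.
under [RHS]eq_bigr do rewrite scalerDr.
rewrite big_split /= addrC; congr (_ + _); last first.
  rewrite [RHS]big_ord_recl scaler0 add0r; apply: eq_bigr => j _.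
  by rewrite /= !scalerA /bump /= add1n subSS exprS; congr (_ *: _); ring.
rewrite [RHS]big_ord_recr /= ltnn scaler0 addr0; apply: eq_bigr => j _.
have jn : (j <= n)%N by rewrite -ltnS.
by rewrite jn !scalerA subSn // exprS; congr (_ *: _); ring.
Qed.

Lemma hpolyZ n f k : hpoly n f -> hpoly n (fun a0 a1 => k *: f a0 a1).
Proof.
move=> [c fE]; exists (fun j => k *: c j) => a0 a1.
by rewrite fE scaler_sumr; apply: eq_bigr => j _; rewrite !scalerA mulrC.
Qed.

Lemma hpoly_sum n (I : finType) (f : I -> C -> C -> V) :
  (forall i, hpoly n (f i)) -> hpoly n (fun a0 a1 => \sum_i f i a0 a1).
Proof.
move=> /boolp.choice [c fE]; exists (fun j => \sum_i c i j) => a0 a1.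
under eq_bigr do rewrite fE.
by rewrite exchange_big; apply: eq_bigr => j _; rewrite scaler_sumr.
Qed.

Lemma hpolyX n p f x y : hpoly n f -> hpoly (p + n) (fun a0 a1 => (x * a0 + y * a1) ^+ p *: f a0 a1).
Proof.
move=> fn; elim: p => [|p IH]; first by apply: hpoly_ext fn => a0 a1; rewrite scale1r.
by apply: hpoly_ext (hpolyM1 x y IH) => a0 a1; rewrite scalerA exprS.
Qed.

End HomogeneousPolynomials.

(** * Linear algebra of bi-Hermitian structures *)

Definition natpair (F : fieldType) (m : nat) (u v : 'cV[F]_(m + m)) : F :=
  ((dsubmx u)^T *m usubmx v) 0 0 + ((dsubmx v)^T *m usubmx u) 0 0.

(** [G *m A] is the matrix of [X |-> iota_X omega_A], so [A = I_alpha] and [D = I_beta] give the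
    matrix of (3). *)
Definition bihermitian (F : fieldType) (m : nat) (G A D : 'M[F]_m) : 'M[F]_(m + m) :=
  2^-1 *: block_mx (- (A + D)) (- (invmx (G *m A) - invmx (G *m D)))
                   (G *m A - G *m D) (A^T + D^T).

Section Bihermitian.
Context {F : fieldType} {m : nat} (G A D : 'M[F]_m).
Hypotheses (n2 : (2 : F) != 0) (Gsym : G^T = G) (Gunit : G \in unitmx).
Hypotheses (AA : A *m A = - 1%:M) (DD : D *m D = - 1%:M).
Hypotheses (AG : A^T *m G = - (G *m A)) (DG : D^T *m G = - (G *m D)).
Implicit Types (X Y : 'cV[F]_m) (u v : 'cV[F]_(m + m)).

Lemma invmx_kmap (B : 'M[F]_m) : B *m B = - 1%:M -> invmx (G *m B) = - (B *m invmx G).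
Proof.
move=> BB; have BGB : (- (B *m invmx G)) *m (G *m B) = 1%:M.
  by rewrite mulNmx mulmxA mulmxKV // BB opprK.
have [_ GBu] := mulmx1_unit BGB.
by rewrite -[RHS]mulmx1 -(mulmxV GBu) mulmxA BGB mul1mx.
Qed.

(** Writing covectors as [G *m Y] turns the structure into an operator on pairs [(X, Y)]; on [X + Y]
    it acts as [- D] and on [X - Y] as [- A]. *)
Lemma bihermitianE X Y : bihermitian G A D *m col_mx X (G *m Y) =
  col_mx (2^-1 *: ((A - D) *m Y - (A + D) *m X))
         (G *m (2^-1 *: ((A - D) *m X - (A + D) *m Y))).
Proof.
rewrite /bihermitian !invmx_kmap // -scalemxAl mul_block_col scale_col_mx.
congr col_mx; last rewrite -scalemxAr; congr (_ *: _).
  rewrite opprB opprK addrC [- _ + _]addrC -mulmxBl -mulmxA mulKmx //.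
  by rewrite mulNmx.
have -> : (A^T + D^T) *m (G *m Y) = - (G *m (A + D)) *m Y.
  by rewrite mulmxA mulmxDl AG DG -opprD -mulmxDr.
by rewrite -mulmxBr mulNmx -!mulmxA -mulmxBr.
Qed.

Lemma colGE u : u = col_mx (usubmx u) (G *m (invmx G *m dsubmx u)).
Proof. by rewrite mulKVmx // vsubmxK. Qed.

Lemma bihermitian_sq : bihermitian G A D *m bihermitian G A D = - 1%:M.
Proof.
suff E u : bihermitian G A D *m (bihermitian G A D *m u) = - u.
  apply/matrixP => a b; have := E (delta_mx b 0).
  by rewrite mulmxA -colE => /matrixP /(_ a 0); rewrite !mxE eqxx andbT.
rewrite [u]colGE; move: (usubmx u) (invmx G *m _) => X Y {u}.
rewrite !bihermitianE.
have -> : - col_mx X (G *m Y) = col_mx (- X) (G *m (- Y)) by rewrite opp_col_mx mulmxN.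
set P := (A - D) *m Y - _; set Q := (A - D) *m X - _.
(* Sum and difference decouple the structure; the factor 2 is there because [P] and [Q] have not
   been halved yet. *)
have PQ : P + Q = - (2 *: (D *m (X + Y))).
  rewrite /P /Q !(mulmxBl, mulmxDl, mulmxBr, mulmxDr).
  by apply/matrixP => a b; rewrite !mxE; ring.
have QP : P - Q = - (2 *: (A *m (X - Y))).
  rewrite /P /Q !(mulmxBl, mulmxDl, mulmxBr, mulmxDr).
  by apply/matrixP => a b; rewrite !mxE; ring.
clearbody P Q.
have DPQ : D *m (P + Q) = 2 *: (X + Y).
  by rewrite PQ mulmxN -scalemxAr mulmxA DD mulNmx mul1mx scalerN opprK.
have APQ : A *m (P - Q) = 2 *: (X - Y).
  by rewrite QP mulmxN -scalemxAr mulmxA AA mulNmx mul1mx scalerN opprK.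
have [ePX ePY] : (A - D) *m Q - (A + D) *m P = - (4 *: X) /\
                 (A - D) *m P - (A + D) *m Q = - (4 *: Y).
  split.
    transitivity (- (A *m (P - Q) + D *m (P + Q))).
      rewrite !(mulmxBl, mulmxDl, mulmxBr, mulmxDr) ?mulNmx ?mulmxN.
    move: (A *m P) (A *m Q) (D *m P) (D *m Q) => AP AQ DP DQ.
    by apply/matrixP => a b; rewrite !mxE; ring.
    by rewrite DPQ APQ; apply/matrixP => a b; rewrite !mxE; ring.
  transitivity (A *m (P - Q) - D *m (P + Q)).
    rewrite !(mulmxBl, mulmxDl, mulmxBr, mulmxDr) ?mulNmx ?mulmxN.
    move: (A *m P) (A *m Q) (D *m P) (D *m Q) => AP AQ DP DQ.
    by apply/matrixP => a b; rewrite !mxE; ring.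
  by rewrite DPQ APQ; apply/matrixP => a b; rewrite !mxE; ring.
rewrite -!scalemxAr -!scalerBr ePX ePY !mulmxN -!scalemxAr !scalerA.
have -> : 2^-1 * 2^-1 = 4^-1 :> F by rewrite -invfM -natrM.
have n4 : (4 : F) != 0 by rewrite (natrM _ 2 2) mulf_neq0.
by rewrite !mulmxN -!scalemxAr !scalerN !scalerA mulVf // !scale1r.
Qed.

(** Infinitesimal orthogonality: the off-diagonal blocks are skew and the diagonal ones are minus
    each other's transpose. Together with the square -1 this gives orthogonality. *)
Lemma bihermitian_natpair u v :
  natpair (bihermitian G A D *m u) v = - natpair u (bihermitian G A D *m v).
Proof.
have skewL (B : 'M[F]_m) X Y : B^T = - B -> (X^T *m B *m Y) 0 0 = - (Y^T *m B *m X) 0 0.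
  move=> skB; rewrite -[X^T *m B *m Y]trmxK mxE !trmx_mul trmxK skB.
  by rewrite mulNmx mulmxN mxE mulmxA.
have kmap_skew (B : 'M[F]_m) : B^T *m G = - (G *m B) -> (G *m B)^T = - (G *m B).
  by move=> BG; rewrite trmx_mul Gsym.
have inv_skew (B : 'M[F]_m) : B *m B = - 1%:M -> B^T *m G = - (G *m B) ->
    (invmx (G *m B))^T = - invmx (G *m B).
  move=> BB BG; rewrite invmx_kmap // linearN /= trmx_mul trmx_inv Gsym opprK.
  by rewrite -[B^T](mulmxK Gunit) BG mulNmx mulmxN mulmxA mulKmx // opprK.
rewrite -[u]vsubmxK -[v]vsubmxK /natpair /bihermitian -!scalemxAl !mul_block_col.
rewrite !scale_col_mx !col_mxKu !col_mxKd.
move: (usubmx u) (dsubmx u) (usubmx v) (dsubmx v) => X xi Y eta {u v}.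
set w := G *m A - G *m D; set b := invmx _ - invmx _.
have skw : w^T = - w by rewrite linearB /= !kmap_skew // opprD.
have skb : b^T = - b by rewrite linearB /= !inv_skew // opprD.
clearbody w b.
rewrite !linearZ /= !linearD /= !trmx_mul skw linearD /= !trmxK.
rewrite !(mulmxDl, mulmxDr, mulmxBl, mulmxN, mulNmx) -!scalemxAl ?scalerDr !(mulmxDl, mulmxDr, mulmxN, mulNmx) !mulmxA.
have := skewL w X Y skw; have := skewL b eta xi skb.
move: (X^T *m w *m Y) (Y^T *m w *m X) (eta^T *m b *m xi) (xi^T *m b *m eta).
move: (xi^T *m A *m Y) (xi^T *m D *m Y) (eta^T *m A *m X) (eta^T *m D *m X).
by move=> m1 m2 m3 m4 m5 m6 m7 m8 e1 e2; rewrite !mxE e1 e2; ring.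
Qed.

(** As the structure is [- D] on [X + Y] and [- A] on [X - Y], its +i-eigenspace is assembled from
    the -i-eigenspaces of [D] and [A]. *)
Lemma bihermitian_eigen (i : F) u : i * i = -1 ->
  let X := usubmx u in let Y := invmx G *m dsubmx u in
  bihermitian G A D *m u = i *: u <->
  D *m (X + Y) = - i *: (X + Y) /\ A *m (X - Y) = - i *: (X - Y).
Proof.
move=> i2 X Y; rewrite [u in bihermitian _ _ _ *m u]colGE [u in _ *: u]colGE -/X -/Y.
rewrite bihermitianE scale_col_mx scalemxAr.
set P := 2^-1 *: _; set Q := 2^-1 *: _.
have PQ : P + Q = - (D *m (X + Y)).
  rewrite /P /Q !(mulmxBl, mulmxDl, mulmxBr, mulmxDr).
  move: (A *m X) (A *m Y) (D *m X) (D *m Y) => AX AY DX DY.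
  by apply/matrixP => a b; rewrite !mxE; field.
have QP : P - Q = - (A *m (X - Y)).
  rewrite /P /Q !(mulmxBl, mulmxDl, mulmxBr, mulmxDr).
  move: (A *m X) (A *m Y) (D *m X) (D *m Y) => AX AY DX DY.
  by apply/matrixP => a b; rewrite !mxE; field.
clearbody P Q; split=> [/eq_col_mx [eP eQ]|[eD eA]].
  have {}eQ : Q = i *: Y by rewrite -[Q](mulKmx Gunit) eQ mulKmx.
  split; first by rewrite scaleNr -[LHS]opprK -PQ eP eQ -scalerDr.
  by rewrite scaleNr -[LHS]opprK -QP eP eQ -scalerBr.
have eP : P = i *: X.
  transitivity (2^-1 *: ((P + Q) + (P - Q))).
    by apply/matrixP => a b; rewrite !mxE; field.
  by rewrite PQ QP eD eA; apply/matrixP => a b; rewrite !mxE; field.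
have -> : Q = i *: Y; last by rewrite eP.
transitivity (2^-1 *: ((P + Q) - (P - Q))).
  by apply/matrixP => a b; rewrite !mxE; field.
by rewrite PQ QP eD eA; apply/matrixP => a b; rewrite !mxE; field.
Qed.

(* If u is orthogonal to the eigenspace, then it is orthogonal to every
   (J + i) w, so that (J - i) u is orthogonal to everything. *)
Lemma bihermitian_max_isotropic (i : F) u : i * i = -1 ->
  (forall v, bihermitian G A D *m v = i *: v -> natpair u v = 0) ->
  bihermitian G A D *m u = i *: u.
Proof.
move=> i2 ort; set J := bihermitian G A D.
have pairDr v w w' : natpair v (w + w') = natpair v w + natpair v w'.
  by rewrite /natpair !linearD /= ?mulmxDr ?mulmxDl !mxE; ring.
have pairDl v w w' : natpair (w + w') v = natpair w v + natpair w' v.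
  by rewrite /natpair !linearD /= ?mulmxDr ?mulmxDl !mxE; ring.
have pairZr k v w : natpair v (k *: w) = k * natpair v w.
  by rewrite /natpair !linearZ /= -?scalemxAr -?scalemxAl !mxE; ring.
have pairZl k v w : natpair (k *: w) v = k * natpair w v.
  by rewrite /natpair !linearZ /= -?scalemxAr -?scalemxAl !mxE; ring.
have ort2 w : natpair (J *m u - i *: u) w = 0.
  have : natpair u (J *m w + i *: w) = 0.
    apply: ort; rewrite mulmxDr mulmxA bihermitian_sq mulNmx mul1mx -scalemxAr.
    by rewrite scalerDr scalerA i2 scaleN1r addrC.
  rewrite pairDr pairZr -[natpair u _]opprK -bihermitian_natpair => /eqP.
  by rewrite pairDl -scaleNr pairZl -oppr_eq0 opprD opprK mulNr => /eqP.
apply/eqP; rewrite -subr_eq0; apply/eqP; set v := _ - _ in ort2 *.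
have vd k : dsubmx v k 0 = 0.
  have := ort2 (col_mx (delta_mx k 0) 0); rewrite /natpair col_mxKu col_mxKd.
  by rewrite trmx0 mul0mx -colE !mxE addr0.
have vu k : usubmx v k 0 = 0.
  have := ort2 (col_mx 0 (delta_mx k 0)); rewrite /natpair col_mxKu col_mxKd.
  by rewrite mulmx0 trmx_delta -rowE !mxE add0r.
rewrite -[v]vsubmxK; apply/matrixP => a b; rewrite (ord1 b) [RHS]mxE mxE.
by case: split.
Qed.

End Bihermitian.

(** * The pure spinor at a point and its annihilator *)

Section HyperkahlerPoint.
Context {R : realType} {n : nat}.
Notation C := R[i].
Notation m := (4 * n)%N.
Notation one := (@form_one R m).
Notation i := ('i)%C.
Variables (G : 'M[C]_m).
Hypotheses (Gsym : G^T = G) (Gunit : G \in unitmx).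

Lemma i_sq : i * i = -1 :> C.
Proof. by rewrite -expr2 sqr_i. Qed.

Let i2' : i ^+ 2 = -1 :> C. Proof. exact: sqr_i. Qed.
Let n2 : (2 : C) != 0. Proof. by rewrite pnatr_eq0. Qed.

Lemma trE (E : 'M[C]_m) : (E^T *m G)^T = G *m E.
Proof. by rewrite trmx_mul trmxK Gsym. Qed.

Lemma skewE (E : 'M[C]_m) : E^T *m G = - (G *m E) -> skew (E^T *m G).
Proof. by move=> EG; rewrite /skew trE EG opprK. Qed.

Variables (A S Sc D Zm : 'M[C]_m) (k s t : C).

(* S spans the holomorphic symplectic forms of the complex structure A, with
   conjugate Sc up to scale; D is the complex structure with homogeneous
   coordinates (s, t) relative to (A, - A). *)
Record twistor_pair : Prop := TwistorPair {
  tpAA : A *m A = - 1%:M; tpDD : D *m D = - 1%:M;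
  tpAT : A^T *m G = - (G *m A); tpDT : D^T *m G = - (G *m D);
  tpST : S^T *m G = - (G *m S);
  tpAS : A *m S = - i *: S; tpSA : S *m A = i *: S; tpSS : S *m S = 0;
  tpSSc : S *m Sc = k *: (1%:M + i *: A);
  tpScS : Sc *m S = k *: (1%:M - i *: A);
  tpk : k != 0;
  tptr : \tr (2^-1 *: (1%:M - i *: A)) = m%:R / 2;
  tpDP : D *m (t *: (1%:M - i *: A) - s *: S) = - i *: (t *: (1%:M - i *: A) - s *: S);
  tpPZ : (t *: (1%:M - i *: A) - s *: S) *m Zm = 2^-1 *: (1%:M + i *: D);
  tps : t = 0 -> s != 0 }.
Hypothesis TP : twistor_pair.

Notation WA := (A^T *m G).
Notation WS := (S^T *m G).

Lemma skewA : skew WA. Proof. exact/skewE/(tpAT TP). Qed.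
Lemma skewB : skew WS. Proof. exact/skewE/(tpST TP). Qed.
Lemma top_power : iter n (tw WS) one != 0 /\ iter n.+1 (tw WS) one = 0.
Proof.
have k0 := tpk TP.
(* [P] is the projector onto the +i-eigenspace of [A], complementary to the kernel of [S] and of
   rank [2 n]. [Sc] inverts [S] up to [k], and transposing across [G] changes the sign of [A]. *)
apply: (@top_powerP _ _ _ (2^-1 *: (1%:M - i *: A))
   ((2^-1 / k) *: (Sc *m invmx G)) n skewB).
- rewrite trE -mulmxA.
  have -> : 1%:M - 2^-1 *: (1%:M - i *: A) = 2^-1 *: (1%:M + i *: A).
    by apply/matrixP => a b; rewrite !mxE; field.
  rewrite -scalemxAr mulmxDr mulmx1 -[S *m (i *: A)]scalemxAr (tpSA TP) scalerA i_sq.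
  by rewrite scaleN1r subrr scaler0 mulmx0.
- rewrite trE -scalemxAr mulmxA -[G *m _ *m _]mulmxA (tpSSc TP).
  rewrite linearZ /= linearB /= linearZ /= trmx1 -scalemxAr -scalemxAl scalerA divfK //.
  congr (_ *: _); rewrite mulmxDr mulmxDl mulmx1 mulmxV // -scalemxAr -scalemxAl.
  by rewrite -[G *m A]opprK -(tpAT TP) mulNmx mulmxK // scalerN.
rewrite (tptr TP) natrM -muln2 natrM.
by rewrite (natrM _ 2 2); field.
Qed.

Lemma ext_topB Z : ext (G *m S *m Z) (iter n (tw WS) one) = 0.
Proof. by rewrite -trE ext_top //; [exact: skewB | case: top_power]. Qed.

(** Up to scale [omega_A] is the skew part of [G S Sc], so one of its two covector factors always
    lies in the image of [G S] and kills the n-th power of [S]. In terms of types: a (1,1)-form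
    times a holomorphic volume form vanishes. *)
Lemma tw_topA : tw WA (iter n (tw WS) one) = 0.
Proof.
have k0 := tpk TP.
set U := (i / (2 * k)) *: (G *m S *m Sc).
have -> : WA = U - U^T.
  have GAT : (G *m A)^T = - (G *m A) by rewrite trmx_mul Gsym (tpAT TP).
  have -> : U = (i / (2 * k) * k) *: (G + i *: (G *m A)).
    by rewrite /U -mulmxA (tpSSc TP) -scalemxAr scalerA mulmxDr mulmx1 -scalemxAr.
  have UT : (G + i *: (G *m A))^T = G - i *: (G *m A).
    by rewrite linearD /= [(i *: _)^T]linearZ /= Gsym GAT scalerN.
  rewrite linearZ /= UT (tpAT TP).
  move: (G *m A) => GA; apply/matrixP => a b; rewrite !mxE.
  by field: i2'.
rewrite tw_colE big1 // => b _; rewrite ext_anti.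
by rewrite colE /U -scalemxAl -mulmxA extZl ext_topB scaler0 linear0 oppr0.
Qed.

(** Solves the eigenvector equations without dividing by [t]. The solution [Z] depends linearly on
    the eigenvector through the given matrix [Zm], which makes it differentiable along sections. *)
Lemma eigen_param (X Y : 'cV[C]_m) :
  D *m (X + Y) = - i *: (X + Y) -> A *m (X - Y) = - i *: (X - Y) ->
  let Z := Zm *m (X + Y) in
  Y = - i *: (A *m X) - s *: (S *m Z) /\ S *m X = t *: (S *m Z).
Proof.
set p := X + Y; set q := X - Y => Dp Aq Z.
have SA := tpSA TP.
(* [p] is fixed by the projector [(1 + i D) / 2], which [tpPZ] factors through [Zm]. *)
have pE : p = t *: (Z - i *: (A *m Z)) - s *: (S *m Z).
  have := congr1 (mulmx^~ p) (tpPZ TP) => /=.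
  rewrite -mulmxA -/Z -scalemxAl mulmxDl mul1mx -scalemxAl Dp scalerA.
  rewrite mulrN i_sq opprK scale1r.
  have -> : 2^-1 *: (p + p) = p by apply/matrixP => a b; rewrite !mxE; field.
  by move=> <-; rewrite mulmxBl -!scalemxAl mulmxBl mul1mx -scalemxAl.
clearbody Z.
(* [q] lies in the -i-eigenspace of [A], where [S A = i S] forces [S q = - S q]. *)
have Sq : S *m q = 0.
  have : i *: (S *m q) = - (i *: (S *m q)).
    by rewrite {1}scalemxAl -SA -mulmxA Aq -scalemxAr scaleNr.
  move/eqP; rewrite -addr_eq0 => /eqP H.
  have : (2 * i) *: (S *m q) = 0.
    by rewrite -[RHS]H; apply/matrixP => a b; rewrite !mxE; ring.
  move/eqP; rewrite scaler_eq0 mulf_eq0 (negPf n2) /=.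
  case/orP => [/eqP i0|/eqP //].
  by move/eqP: i_sq; rewrite i0 mul0r eq_sym oppr_eq0 oner_eq0.
have Sp : S *m p = (2 * t) *: (S *m Z).
  rewrite pE mulmxBr -[S *m (t *: _)]scalemxAr -[S *m (s *: _)]scalemxAr mulmxBr.
  rewrite -[S *m (i *: _)]scalemxAr. rewrite !mulmxA SA (tpSS TP) mul0mx.
  rewrite scaler0 subr0 -scalemxAl scalerA i_sq; move: (S *m Z) => w.
  by apply/matrixP => a b; rewrite !mxE; ring.
have XE : X = 2^-1 *: (p + q) by apply/matrixP => a b; rewrite !mxE; field.
have YE : Y = 2^-1 *: (p - q) by apply/matrixP => a b; rewrite !mxE; field.
split; last first.
  by rewrite XE -scalemxAr mulmxDr Sq addr0 Sp scalerA mulrA mulVf ?mul1r.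
(* Applying [1 + i A] removes the +i-part of [p] and doubles its component along [S Z]. *)
have Ap : p + i *: (A *m p) = - (2 * s) *: (S *m Z).
  rewrite {1 2}pE mulmxBr -!scalemxAr mulmxBr -!scalemxAr !mulmxA.
  rewrite (tpAA TP) (tpAS TP) mulNmx mul1mx -scalemxAl.
  move: (S *m Z) (A *m Z) => w v; apply/matrixP => a b; rewrite !mxE.

  by field: i2'.
have {}Ap : s *: (S *m Z) = - 2^-1 *: (p + i *: (A *m p)).
  by rewrite Ap scalerA; congr (_ *: _); field.
rewrite Ap YE XE -scalemxAr mulmxDr Aq; move: (A *m p) => w.
apply/matrixP => a b; rewrite !mxE.

by field: i2'.
Qed.

(** The converse holds for an arbitrary [Z]; this matters because the bracket of two sections comes
    with a [Z] of its own. *)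
Lemma eigen_of_param (X Y Z : 'cV[C]_m) :
  Y = - i *: (A *m X) - s *: (S *m Z) -> S *m X = t *: (S *m Z) ->
  D *m (X + Y) = - i *: (X + Y) /\ A *m (X - Y) = - i *: (X - Y).
Proof.
move=> YE SX;
have AS := tpAS TP; have AA := tpAA TP.
split; last first.
  rewrite YE mulmxBr mulmxBr -!scalemxAr !mulmxA AA AS mulNmx mul1mx -scalemxAl.
  move: (S *m Z) (A *m X) => w v; apply/matrixP => a b; rewrite !mxE.
  by ring: i2'.
have k0 := tpk TP.
(* Applying [Sc] to [S X = t S Z] recovers the +i-parts of [X] and [Z], as [k] is nonzero. *)
have XE : X - i *: (A *m X) = t *: (Z - i *: (A *m Z)).
  have ScS (V : 'cV[C]_m) : k *: (V - i *: (A *m V)) = Sc *m (S *m V).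
    by rewrite mulmxA (tpScS TP) -scalemxAl mulmxBl mul1mx -scalemxAl.
  apply: (scalerI k0); rewrite ScS SX -scalemxAr -ScS !scalerA mulrC //.
have -> : X + Y = (t *: (1%:M - i *: A) - s *: S) *m Z.
  by rewrite YE addrA scaleNr XE mulmxBl -!scalemxAl mulmxBl mul1mx -scalemxAl.
by rewrite mulmxA (tpDP TP) -scalemxAl.
Qed.

(** [e] will be 1 or -1: exchanging the two parameters reverses the sign of [t], and [e = -1]
    compensates for it. *)
Definition Phi (e : C) :=
  expo ((e * i) *: WA) (psi n WS (e * t) s).

Lemma Phi_set0 e : Phi e set0 = (e * t) ^+ n.
Proof.
rewrite /Phi expo_set0 ?psi_set0 //; first exact: skewB.
by rewrite /skew linearZ /= skewA scalerN.
Qed.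

(** Off the diagonal [Phi] is the spinor of the graph of a 2-form: [e i A] from the exponential and
    [s S / (e t)] from [psi] combine into one multiple of the numerator because [e * e = 1]. *)
Lemma Phi_contr e X : e * e = 1 -> t != 0 ->
  interior X (Phi e) = ext ((e / t) *: (G *m ((s *: S + (i * t) *: A) *m X))) (Phi e).
Proof.
move=> e1 t0; have e0 : e != 0.
  by apply: contra_eq_neq e1 => ->; rewrite mul0r eq_sym oner_eq0.
have sk : skew ((e * i) *: WA) by rewrite /skew linearZ /= skewA scalerN.
rewrite /Phi interior_expo //.
have -> : interior X (psi n WS (e * t) s) =
    ext ((s / (e * t)) *: (WS^T *m X)) (psi n WS (e * t) s).
  apply: (scalerI (mulf_neq0 e0 t0)); rewrite psi_contr; last by case: top_power.
    by rewrite extZl scalerA [_ * (s / _)]mulrC divfK // mulf_neq0.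
  exact: skewB.
rewrite -ext_expo // -extDl; congr (ext _ _).
rewrite linearZ /= !trE -scalemxAl mulmxA mulmxDr -!scalemxAr.
rewrite mulmxDl scalerDr -!scalemxAl !scalerA; congr (_ *: _ + _ *: _).
  by field: e1; apply/andP.
by field.
Qed.

(** The exponential factor acts trivially by [tw_topA], so that [e] and [A] disappear. *)
Lemma Phi_t0 e : t = 0 -> Phi e = (s ^+ n / n`!%:R) *: iter n (tw WS) one.
Proof.
move=> t0; rewrite /Phi t0 mulr0 psi_t0 linearZ /= expo_id //.
by rewrite form2Z wedgeZl tw_topA scaler0.
Qed.

Lemma Phi_neq0 : Phi 1 != 0.
Proof.
have [t0|t0] := eqVneq t 0.
  rewrite Phi_t0 // scaler_eq0 mulf_eq0 invr_eq0 pnatr_eq0 -leqn0 leqNgt fact_gt0 /= orbF.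
  by rewrite expf_eq0 (negPf (tps TP t0)) andbF; case: top_power.
apply/eqP => /ffunP /(_ set0); rewrite Phi_set0 ffunE mul1r => /eqP.
by rewrite expf_eq0 (negPf t0) andbF.
Qed.

Lemma clifford_Phi (u : 'cV[C]_(m + m)) :
  clifford u (Phi 1) = 0 <-> bihermitian G A D *m u = i *: u.
Proof.
have AA := tpAA TP; have DD := tpDD TP.
have kill v : bihermitian G A D *m v = i *: v -> clifford v (Phi 1) = 0.
  have -> : (bihermitian G A D *m v = i *: v) <-> _ :=
    bihermitian_eigen n2 Gunit AA DD (tpAT TP) (tpDT TP) v i_sq.
  move=> [Dp Aq]; have [YE SX] := eigen_param Dp Aq.
  set X := usubmx v in Dp Aq YE SX *; set Z := Zm *m _ in YE SX.
  rewrite /Phi clifford_expo; last by rewrite /skew linearZ /= skewA scalerN.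
  (* The B-field transform by [i omega_A] cancels the summand [- i A X] of [Y], leaving only
     [- s S Z] in the covector part. *)
  rewrite -/X; have -> : dsubmx v + ((1 * i) *: WA)^T *m X = - s *: (WS^T *m Z).
    rewrite mul1r linearZ /= !trE -[dsubmx v](mulKVmx Gunit) YE -scalemxAl -!mulmxA.
    rewrite mulmxBr -!scalemxAr; move: (G *m _) (G *m _) => w1 w2.
    by apply/matrixP => a b; rewrite !mxE; ring.
  rewrite /clifford col_mxKu col_mxKd !mul1r.
  (* [X - t Z] lies in the kernel of [S], hence kills [psi]; the contraction with [t Z] is
     [psi_contr]. *)
  have -> : X = t *: Z + (X - t *: Z) by rewrite addrC subrK.
  rewrite interiorDl interiorZl (@psi_ker _ _ _ _ skewB (X - t *: Z)); last first.
    by rewrite trE -mulmxA mulmxBr -scalemxAr SX subrr mulmx0.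
  rewrite psi_contr; [|exact: skewB|by case: top_power].
  by rewrite addr0 extZl scaleNr subrr linear0.
split; last exact: kill.
move=> uPhi; apply: bihermitian_max_isotropic => //; try by case: TP; try exact: i_sq.
move=> v /kill vPhi; have := clifford_anti u v (Phi 1).
have cl0 w : clifford w (0 : form R m) = 0 by rewrite /clifford !linear0 addr0.
rewrite uPhi vPhi !cl0 addr0 => /esym/eqP; rewrite scaler_eq0 (negPf Phi_neq0) orbF.
by move/eqP.
Qed.

End HyperkahlerPoint.

Section PhiFunctions.
Context {R : realType} {n : nat}.
Notation C := R[i].
Notation m := (4 * n)%N.
Notation one := (@form_one R m).
Notation i := ('i)%C.
Variables (G : 'M[C]_m).
Hypotheses (Gsym : G^T = G) (Gunit : G \in unitmx).

Lemma graph_spinor_ext (W : 'M[C]_m) (F F' : form R m) :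
  (forall X, interior X F = ext (W^T *m X) F) ->
  (forall X, interior X F' = ext (W^T *m X) F') -> F set0 = F' set0 -> F = F'.
Proof.
move=> HF HF' F0; apply/eqP; rewrite -subr_eq0; apply/eqP.
apply: (@graph_spinor_unique _ _ W) => [X|]; last by rewrite !ffunE F0 subrr.
by rewrite !linearB /= HF HF'.
Qed.

Lemma iter_twZ (c : C) (W : 'M[C]_m) k : iter k (tw (c *: W)) one = c ^+ k *: iter k (tw W) one.
Proof.
elim: k => [|k IH] /=; first by rewrite expr0 scale1r.
by rewrite IH form2Z wedgeZl linearZ /= scalerA exprS.
Qed.

(** For [t != 0] both sides are spinors of the same graph with the same coefficient [t^n] in degree
    zero. For [t = 0] both are multiples of the n-th power of [S], and the factors agree because
    [s' * s = 1]. *)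
Lemma Phi_sym (A S Sc D Z A' S' Sc' D' Z' : 'M[C]_m) (k s t k' s' t' : C) :
  twistor_pair G A S Sc D Z k s t -> twistor_pair G A' S' Sc' D' Z' k' s' t' ->
  t' = - t -> s *: S + (i * t) *: A = s' *: S' + (i * t') *: A' ->
  (t = 0 -> S' = s ^+ 2 *: S /\ s' * s = 1) ->
  Phi G A S s t 1 = Phi G A' S' s' t' (-1).
Proof.
move=> TP TP' tN SA tS; have [t0|t0] := eqVneq t 0.
  have t0' : t' = 0 by rewrite tN t0 oppr0.
  have [SE ss] := tS t0.
  rewrite (Phi_t0 Gsym Gunit TP _ t0) (Phi_t0 Gsym Gunit TP' _ t0') SE.
  rewrite linearZ /= -scalemxAl iter_twZ scalerA -exprM [(2 * n)%N]mulnC exprM.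
  have e : s' ^+ n * s ^+ n = 1 by rewrite -exprMn ss expr1n.
  congr (_ *: _); rewrite [s ^+ n ^+ 2]expr2.
  transitivity (s' ^+ n * s ^+ n * (s ^+ n / n`!%:R)); first by rewrite e mul1r.
  by rewrite [RHS]mulrA -[in RHS]mulrA mulrAC -!mulrA; congr (_ * _); rewrite mulrCA.
have t0' : t' != 0 by rewrite tN oppr_eq0.
have WE X : (t^-1 *: ((s *: S + (i * t) *: A)^T *m G))^T *m X =
    t^-1 *: (G *m ((s *: S + (i * t) *: A) *m X)).
  by rewrite linearZ /= trE // -scalemxAl -mulmxA.
apply: (graph_spinor_ext (W := t^-1 *: ((s *: S + (i * t) *: A)^T *m G))) => [X|X|].
- by rewrite WE (Phi_contr Gsym Gunit TP X (mulr1 1) t0) mul1r.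
- have e1 : -1 * -1 = 1 :> C by rewrite mulrNN mulr1.
  by rewrite WE SA (Phi_contr Gsym Gunit TP' X e1 t0') tN invrN mulrNN mul1r.
have h1 := Phi_set0 Gsym TP 1; have h2 := Phi_set0 Gsym TP' (-1).
have h3 : 1 * t = -1 * t' by rewrite tN mulrNN.
exact: etrans h1 (etrans (congr1 (fun z => z ^+ n) h3) (esym h2)).
Qed.

(** With [A] and [S] fixed, [s] and [t] are linear in the moving point, so each product of [t^(n-k)]
    and [s^k] is homogeneous of degree [n]. *)
Lemma Phi_hpoly (A S : 'M[C]_m) (e x y z w : C) :
  hpoly n (fun a0 a1 => Phi G A S (x * a0 + y * a1) (z * a0 + w * a1) e).
Proof.
have [c cE] : hpoly n (fun a0 a1 => psi n (S^T *m G) (e * (z * a0 + w * a1)) (x * a0 + y * a1)).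
  rewrite /psi; apply: hpoly_sum => k; move: (iter _ _ _) => v.
  have := hpolyZ (k`!%:R^-1 * e ^+ (n - k)) (hpolyX (n - k) z w (hpolyX k x y (hpoly0 v))).
  rewrite addn0 subnK; last by rewrite -ltnS.
  apply: hpoly_ext => a0 a1; rewrite !scalerA; congr (_ *: _).
  rewrite exprMn; move: (_ ^+ (n - k)) (_ ^+ (n - k)) (_ ^+ k) (_^-1) => p q r u.
  by rewrite [RHS]mulrC !mulrA.
exists (fun j => expo ((e * i) *: (A^T *m G)) (c j)) => a0 a1.
rewrite /Phi cE linear_sum; apply: eq_bigr => j _.
by rewrite linearZ.
Qed.

End PhiFunctions.

(** * Specialization to two points of the twistor sphere *)

Section Twistor.
Context {R : realType} {n : nat}.
Notation C := R[i].
Notation m := (4 * n)%N.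
Variables (G I J K : 'M[C]_m).
Hypothesis HQ : quaternionic I J K.
Hypotheses (Gsym : G^T = G) (Gunit : G \in unitmx).
Hypotheses (IG : I^T *m G = - (G *m I)) (JG : J^T *m G = - (G *m J))
  (KG : K^T *m G = - (G *m K)).

Notation i := ('i)%C.
Notation eA := (endoA I J K i).
Notation eB := (endoB I J K i).
Notation eBc := (endoBc I J K i).

Let i2 : i * i = -1 :> C := i_sq.
Let n2 : (2 : C) != 0. Proof. by rewrite pnatr_eq0. Qed.
Let n4 : (4 : C) != 0. Proof. by rewrite pnatr_eq0. Qed.

Lemma quat_imagT x y z : (quat I J K 0 x y z)^T *m G = - (G *m quat I J K 0 x y z).
Proof.
rewrite /quat raddf0 add0r !linearD /= !linearZ /= !mulmxDl ?mulmxDr.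
by rewrite -!scalemxAl IG JG KG.
Qed.

(** The right factor found in [proj_section], named so that its smooth dependence on the point of
    [M] can be proved. *)
Definition Zparam (a0 a1 d0 d1 b0 b1 c0 c1 : C) :=
  let N := b0 * c0 + b1 * c1 in let M := a0 * d0 + a1 * d1 in
  (i * (c1 * d0 - c0 * d1) / N / (4 * M)) *: (1%:M - i *: eA b0 b1 c0 c1)
        + ((b0 * d0 + b1 * d1) / N / (4 * M * N)) *: eBc c0 c1.

Lemma twistorP a0 a1 d0 d1 b0 b1 c0 c1 :
  a0 * d0 + a1 * d1 != 0 -> b0 * c0 + b1 * c1 != 0 ->
  twistor_pair G (eA b0 b1 c0 c1) (eB b0 b1 b0 b1) (eBc c0 c1)
    (eA a0 a1 d0 d1) (Zparam a0 a1 d0 d1 b0 b1 c0 c1)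
    (-2 * (b0 * c0 + b1 * c1) ^+ 2) (sparam a0 a1 b0 b1 c0 c1) (tparam i a0 a1 b0 b1).
Proof.
move=> M0 N0; split.
- exact: (endoA_sq HQ i2 N0).
- exact: (endoA_sq HQ i2 M0).
- exact: quat_imagT.
- exact: quat_imagT.
- exact: quat_imagT.
- exact: (endoA_endoB HQ i2 N0).
- exact: (endoB_endoA HQ i2 N0).
- exact: (endoB_sq HQ i2).
- exact: (endoB_endoBc HQ i2 N0).
- exact: (endoBc_endoB HQ i2 N0).
- by rewrite mulf_neq0 ?oppr_eq0 // expf_neq0.
- exact: (endoA_tr HQ).
- exact: (endoA_proj HQ i2 N0 M0).
- exact: (proj_section HQ i2 N0 M0).
(* [s] and [t] are, up to nonzero factors, the coordinates of [a] in a basis; if both vanished then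
   [a = 0], which [M0] excludes. *)
move=> /eqP; rewrite mulf_eq0; case/orP => [/eqP i0|].
  by move/eqP: i2; rewrite i0 mul0r eq_sym oppr_eq0 oner_eq0.
rewrite subr_eq0 => /eqP ab; apply: contraNneq M0 => /eqP.
rewrite mulf_eq0 invr_eq0 (negPf N0) orbF => /eqP ac.
have a00 : a0 = 0.
  apply: (mulIf N0); rewrite mul0r.
  transitivity (b0 * (a0 * c0 + a1 * c1) - c1 * (a1 * b0 - a0 * b1)); first by ring.
  by rewrite ac ab; ring.
have a10 : a1 = 0.
  apply: (mulIf N0); rewrite mul0r.
  transitivity (b1 * (a0 * c0 + a1 * c1) + c0 * (a1 * b0 - a0 * b1)); first by ring.
  by rewrite ac ab; ring.
by rewrite a00 a10 !mul0r addr0.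
Qed.

Definition PhiH (e a0 a1 b0 b1 c0 c1 : C) : form R m :=
  Phi G (eA b0 b1 c0 c1) (eB b0 b1 b0 b1) (sparam a0 a1 b0 b1 c0 c1)
    (tparam i a0 a1 b0 b1) e.

Lemma i_neq0 : i != 0 :> C.
Proof. by apply: contra_eq_neq i2 => ->; rewrite mul0r eq_sym oppr_eq0 oner_eq0. Qed.

(** The conjugate [c] of [b] occurs on the left only, the conjugate [d] of [a] on the right only.
    This is the source of polynomiality in [b]. *)
Lemma PhiH_sym a0 a1 d0 d1 b0 b1 c0 c1 :
  a0 * d0 + a1 * d1 != 0 -> b0 * c0 + b1 * c1 != 0 ->
  PhiH 1 a0 a1 b0 b1 c0 c1 = PhiH (-1) b0 b1 a0 a1 d0 d1.
Proof.
move=> M0 N0; apply: (Phi_sym Gsym Gunit (twistorP M0 N0) (twistorP N0 M0)).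
- exact: tparamC.
- rewrite -(endoB_decomp I J K i2 N0) -(endoB_decomp I J K i2 M0); exact: endoB_sym.
move=> /eqP; rewrite mulf_eq0 (negPf i_neq0) subr_eq0 => /eqP ab.
have [a0E a1E] := sparam_parallel N0 ab.
by split; [rewrite -endoB_scale -a0E -a1E|exact: sparam_inv].
Qed.

Lemma PhiH_hpoly e b0 b1 c0 c1 : hpoly n (fun a0 a1 => PhiH e a0 a1 b0 b1 c0 c1).
Proof.
apply: hpoly_ext (Phi_hpoly G (eA b0 b1 c0 c1) (eB b0 b1 b0 b1) e
  (c0 / (b0 * c0 + b1 * c1)) (c1 / (b0 * c0 + b1 * c1)) (- (i * b1)) (i * b0)) => a0 a1.
by rewrite -sparam_lin -tparam_lin.
Qed.

End Twistor.

(** * Interpolation in the two parameters *)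

Section Interpolation.
Context {R : realType}.
Notation C := R[i].

(** [h0] and [h1] are homogeneous coordinates, normalized so that [mono] becomes a monomial in
    them. *)
Definition h0 (a : CP1 R) : C := if a is Some _ then 1 else 0.
Definition h1 (a : CP1 R) : C := if a is Some z then z else 1.

Lemma monoE d a j : (j <= d)%N -> mono d a j = h1 a ^+ j * h0 a ^+ (d - j).
Proof.
case: a => [z|] jd /=; first by rewrite expr1n mulr1.
by rewrite expr1n mul1r expr0n subn_eq0 eqn_leq jd.
Qed.

Lemma h_norm (a : CP1 R) : h0 a * (h0 a)^*%C + h1 a * (h1 a)^*%C != 0.
Proof.
case: a => [[x y]|]; rewrite eq_complex /= negb_and; apply/orP; left.
  by rewrite gt_eqF //; have := sqr_ge0 x; have := sqr_ge0 y; rewrite !expr2; lra.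
by apply/eqP; lra.
Qed.

(** The inverse Vandermonde matrix recovers coefficients from the values at [o], ..., [o + n]. It is
    the same for all polynomials and all [V], and the offset allows disjoint sets of nodes. *)
Lemma interpolation (n o : nat) : exists M : 'M[C]_n.+1,
  forall (V : lmodType C) (c : 'I_n.+1 -> V) j,
  c j = \sum_s M j s *: \sum_(l < n.+1) ((o + s)%:R ^+ l) *: c l.
Proof.
pose a : 'rV[C]_n.+1 := \row_s (o + s)%:R.
have Vu : Vandermonde n.+1 a \in unitmx.
  rewrite unitmxE det_Vandermonde unitfE prodf_seq_neq0; apply/allP => s _ /=.
  rewrite prodf_seq_neq0; apply/allP => s' _ /=; apply/implyP => ss'.
  by rewrite !mxE subr_eq0 eqr_nat eqn_add2l neq_ltn ss' orbT.
exists (invmx (Vandermonde n.+1 a))^T => V c j.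
under eq_bigr do rewrite scaler_sumr.
rewrite exchange_big /= (bigD1 j) //= [X in _ + X]big1 ?addr0 => [|l lj].
  under eq_bigr do rewrite scalerA; rewrite -scaler_suml.
  have /matrixP /(_ j j) := mulmxV Vu; rewrite !mxE eqxx /= => VV.
  rewrite -[LHS]scale1r; congr (_ *: _); rewrite -[LHS]VV; apply: eq_bigr => s _.
  by rewrite !mxE mulrC.
under eq_bigr do rewrite scalerA; rewrite -scaler_suml.
have /matrixP /(_ l j) := mulmxV Vu; rewrite !mxE (negPf lj) /= => VV.
rewrite (_ : \sum_ _ _ = 0) ?scale0r // -[RHS]VV; apply: eq_bigr => s _.
by rewrite !mxE mulrC.
Qed.

(** For each [b] the coefficients in [a] are fixed linear combinations of the values at
    [a = 0, ..., n], and these values are polynomial in [b]. *)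
Lemma bipolynomial (V : lmodType C) n (H : CP1 R -> CP1 R -> V) :
  (forall b, exists c : 'I_n.+1 -> V, forall a, H a b = \sum_(j < n.+1) mono n a j *: c j) ->
  (forall a, exists c : 'I_n.+1 -> V, forall b, H a b = \sum_(j < n.+1) mono n b j *: c j) ->
  exists c : 'I_n.+1 -> 'I_n.+1 -> V, forall a b,
    H a b = \sum_(j < n.+1) \sum_(k < n.+1) (mono n a j * mono n b k) *: c j k.
Proof.
move=> /boolp.choice [c cE] /boolp.choice [c' cE'].
have [M ME] := interpolation n 0.
exists (fun j k => \sum_s M j s *: c' (Some s%:R) k) => a b.
rewrite cE; apply: eq_bigr => j _; under eq_bigr do rewrite -scalerA; rewrite -scaler_sumr.
congr (_ *: _); rewrite (ME _ (c b) j).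
under [RHS]eq_bigr do rewrite scaler_sumr.
rewrite [RHS]exchange_big /=; apply: eq_bigr => s _.
have -> : \sum_(l < n.+1) (0 + s)%:R ^+ l *: c b l = H (Some s%:R) b by rewrite cE.
rewrite cE' scaler_sumr; apply: eq_bigr => k _.
by rewrite !scalerA mulrC.
Qed.

(** The nodes [0, ..., n] for the first variable and [n + 1, ..., 2 n + 1] for the second are
    disjoint, so the excluded diagonal is never met. *)
Lemma bipolynomial_unique (V : lmodType C) n (c c' : 'I_n.+1 -> 'I_n.+1 -> V) :
  (forall al be : C, al != be ->
    \sum_(j < n.+1) \sum_(k < n.+1) (al ^+ j * be ^+ k) *: c j k =
    \sum_(j < n.+1) \sum_(k < n.+1) (al ^+ j * be ^+ k) *: c' j k) -> forall j k, c j k = c' j k.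
Proof.
move=> cc' j k; have [M ME] := interpolation n 0; have [M' ME'] := interpolation n n.+1.
have E (d : 'I_n.+1 -> 'I_n.+1 -> V) : d j k = \sum_s M j s *: \sum_t M' k t *:
    \sum_(p < n.+1) \sum_(q < n.+1) ((0 + s)%:R ^+ p * (n.+1 + t)%:R ^+ q) *: d p q.
  rewrite (ME _ (fun p => d p k) j); apply: eq_bigr => s _; congr (_ *: _).
  under eq_bigr => p _ do rewrite (ME' _ (d p) k) scaler_sumr.
  rewrite exchange_big /=; apply: eq_bigr => t _.
  under eq_bigr do rewrite scalerA mulrC -scalerA; rewrite -scaler_sumr; congr (_ *: _).
  by apply: eq_bigr => p _; rewrite scaler_sumr; apply: eq_bigr => q _; rewrite scalerA.
rewrite E [RHS]E; apply: eq_bigr => s _; congr (_ *: _); apply: eq_bigr => t _; congr (_ *: _).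
by apply: cc'; rewrite eqr_nat; have := ltn_ord s; lia.
Qed.

End Interpolation.

Local Open Scope classical_set_scope.
Local Open Scope ring_scope.

(** * Smoothness of functions, matrices and forms *)

Section Smooth.
Context {R : realType} {m : nat}.
Notation C := R[i].
Implicit Types (V U : set 'cV[R]_m) (f g : 'cV[R]_m -> R).

Lemma near_open V f g x : open V -> (forall y, V y -> f y = g y) -> V x ->
  \forall y \near x, f y = g y.
Proof.
by move=> oV fg Vx; apply: filterS (open_nbhs_nbhs (conj oV Vx)) => y /fg.
Qed.

Lemma pd_eq V f g x a : open V -> (forall y, V y -> f y = g y) -> V x ->
  pd a f x = pd a g x.
Proof. by move=> oV fg Vx; apply: near_eq_derive; exact: near_open oV fg Vx. Qed.

Lemma Ck_eq k V f g : open V -> (forall y, V y -> f y = g y) -> Ck k V f -> Ck k V g.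
Proof.
move=> oV; elim: k f g => [|k IH] f g fg [cf df]; split.
- move=> x Vx; have := cf x Vx; rewrite /prop_for /continuous_at (fg _ Vx) => cfx.
  exact: cvg_trans (near_eq_cvg (near_open oV fg Vx)) cfx.
- by [].
- move=> x Vx; have := cf x Vx; rewrite /prop_for /continuous_at (fg _ Vx) => cfx.
  exact: cvg_trans (near_eq_cvg (near_open oV fg Vx)) cfx.
move=> a; have [dfa Cfa] := df a; split.
  by move=> x Vx; apply: near_eq_derivable (dfa x Vx); exact: near_open oV fg Vx.
by apply: IH Cfa => y Vy; exact: pd_eq oV fg Vy.
Qed.

Lemma Ck_prev k V f : Ck k.+1 V f -> Ck k V f.
Proof.
elim: k f => [|k IH] f [cf df]; split => // a.
by have [dfa Cfa] := df a; split => //; apply: IH.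
Qed.

Lemma Ck_cst k V (c : R) : Ck k V (fun=> c).
Proof.
have cc x : {for x, continuous (fun _ : 'cV[R]_m => c)} by exact: cst_continuous.
elim: k c cc => [|k IH] c cc; split=> //= a.
split=> [x _|]; first exact: derivable_cst.
rewrite (_ : pd a _ = fun=> 0); first by apply: IH => x; exact: cst_continuous.
by apply/funext => x; exact: derive_cst.
Qed.

Lemma CkD k V f g : open V -> Ck k V f -> Ck k V g -> Ck k V (fun x => f x + g x).
Proof.
move=> oV; elim: k f g => [|k IH] f g [cf df] [cg dg]; split.
- by move=> x Vx; apply: continuousD; [exact: (cf x Vx)|exact: (cg x Vx)].
- by [].
- by move=> x Vx; apply: continuousD; [exact: (cf x Vx)|exact: (cg x Vx)].
move=> a; have [dfa Cfa] := df a; have [dga Cga] := dg a; split.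
  by move=> x Vx; apply: derivableD; [exact: dfa|exact: dga].
apply: Ck_eq oV _ (IH _ _ Cfa Cga) => x Vx.
by rewrite /pd -deriveD //; [exact: dfa|exact: dga].
Qed.

Lemma CkM k V f g : open V -> Ck k V f -> Ck k V g -> Ck k V (fun x => f x * g x).
Proof.
move=> oV; elim: k f g => [|k IH] f g Cf Cg; have [cf df] := Cf; have [cg dg] := Cg; split.
- by move=> x Vx; apply: continuousM; [exact: (cf x Vx)|exact: (cg x Vx)].
- by [].
- by move=> x Vx; apply: continuousM; [exact: (cf x Vx)|exact: (cg x Vx)].
move=> a; have [dfa Cfa] := df a; have [dga Cga] := dg a; split.
  by move=> x Vx; apply: derivableM; [exact: dfa|exact: dga].
apply: Ck_eq oV _ (CkD oV (IH _ _ (Ck_prev Cf) Cga) (IH _ _ (Ck_prev Cg) Cfa)) => x Vx.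
have := @deriveM _ _ f g x (delta_mx a 0) (dfa x Vx) (dga x Vx).
by rewrite /pd => ->.
Qed.

Lemma CkV k V f : open V -> (forall x, V x -> f x != 0) -> Ck k V f ->
  Ck k V (fun x => (f x)^-1).
Proof.
move=> oV f0; elim: k => [|k IH] Cf; have [cf df] := Cf; split.
- by move=> x Vx; apply: continuousV; [exact: f0|exact: (cf x Vx)].
- by [].
- by move=> x Vx; apply: continuousV; [exact: f0|exact: (cf x Vx)].
move=> a; have [dfa Cfa] := df a; split.
  by move=> x Vx; apply: derivableV; [exact: f0|exact: dfa].
have IHf := IH (Ck_prev Cf).
apply: Ck_eq oV _ (CkM oV (Ck_cst k V (-1)) (CkM oV (CkM oV IHf IHf) Cfa)) => x Vx.
rewrite /pd deriveV //; [|exact: f0|exact: dfa].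
by rewrite mulN1r expr2 invfM scaleNr.
Qed.

Lemma smooth_eq V f g : open V -> (forall y, V y -> f y = g y) -> smooth V f -> smooth V g.
Proof. by move=> oV fg sf k; exact: Ck_eq oV fg (sf k). Qed.

Lemma smooth_cst V (c : R) : smooth V (fun=> c).
Proof. by move=> k; exact: Ck_cst. Qed.

Lemma smoothD V f g : open V -> smooth V f -> smooth V g -> smooth V (fun x => f x + g x).
Proof. by move=> oV sf sg k; exact: CkD. Qed.

Lemma smoothM V f g : open V -> smooth V f -> smooth V g -> smooth V (fun x => f x * g x).
Proof. by move=> oV sf sg k; exact: CkM. Qed.

Lemma smoothV V f : open V -> (forall x, V x -> f x != 0) -> smooth V f ->
  smooth V (fun x => (f x)^-1).
Proof. by move=> oV f0 sf k; exact: CkV. Qed.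

Lemma smooth_sum (I : Type) (r : seq I) (P : pred I) V (F : I -> 'cV[R]_m -> R) :
  open V -> (forall i, smooth V (F i)) -> smooth V (fun x => \sum_(i <- r | P i) F i x).
Proof.
move=> oV sF; elim: r => [|i r IH].
  by apply: smooth_eq oV _ (smooth_cst V 0) => y _; rewrite big_nil.
case Pi: (P i).
  by apply: smooth_eq oV _ (smoothD oV (sF i) IH) => y _; rewrite big_cons Pi.
by apply: smooth_eq oV _ IH => y _; rewrite big_cons Pi.
Qed.

Lemma smooth_prod (I : Type) (r : seq I) (P : pred I) V (F : I -> 'cV[R]_m -> R) :
  open V -> (forall i, smooth V (F i)) -> smooth V (fun x => \prod_(i <- r | P i) F i x).
Proof.
move=> oV sF; elim: r => [|i r IH].
  by apply: smooth_eq oV _ (smooth_cst V 1) => y _; rewrite big_nil.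
case Pi: (P i).
  by apply: smooth_eq oV _ (smoothM oV (sF i) IH) => y _; rewrite big_cons Pi.
by apply: smooth_eq oV _ IH => y _; rewrite big_cons Pi.
Qed.

Section Matrices.
Variables (V : set 'cV[R]_m).
Hypothesis oV : open V.

Lemma smooth_mx_eq p q (A B : 'cV[R]_m -> 'M[R]_(p, q)) :
  (forall x, V x -> A x = B x) -> smooth_mx V A -> smooth_mx V B.
Proof. by move=> AB sA i j; apply: smooth_eq oV _ (sA i j) => y Vy; rewrite AB. Qed.

Lemma smooth_mxD p q (A B : 'cV[R]_m -> 'M[R]_(p, q)) :
  smooth_mx V A -> smooth_mx V B -> smooth_mx V (fun x => A x + B x).
Proof.
by move=> sA sB i j; apply: smooth_eq oV _ (smoothD oV (sA i j) (sB i j)) => y _; rewrite mxE.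
Qed.

Lemma smooth_mxZ p q k (A : 'cV[R]_m -> 'M[R]_(p, q)) :
  smooth_mx V A -> smooth_mx V (fun x => k *: A x).
Proof.
move=> sA i j.
by apply: smooth_eq oV _ (smoothM oV (smooth_cst V k) (sA i j)) => y _; rewrite mxE.
Qed.

Lemma smooth_mxN p q (A : 'cV[R]_m -> 'M[R]_(p, q)) :
  smooth_mx V A -> smooth_mx V (fun x => - A x).
Proof. by move=> /(smooth_mxZ (-1)); apply: smooth_mx_eq => y _; rewrite scaleN1r. Qed.

Lemma smooth_mxM p q r (A : 'cV[R]_m -> 'M[R]_(p, q)) (B : 'cV[R]_m -> 'M[R]_(q, r)) :
  smooth_mx V A -> smooth_mx V B -> smooth_mx V (fun x => A x *m B x).
Proof.
move=> sA sB i j; apply: smooth_eq oV _ (smooth_sum (index_enum 'I_q) xpredT oV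
   (fun k => smoothM oV (sA i k) (sB k j))) => y _.
by rewrite mxE.
Qed.

Lemma smooth_mxT p q (A : 'cV[R]_m -> 'M[R]_(p, q)) :
  smooth_mx V A -> smooth_mx V (fun x => (A x)^T).
Proof. by move=> sA i j; apply: smooth_eq oV _ (sA j i) => y _; rewrite mxE. Qed.

Lemma smooth_det p (A : 'cV[R]_m -> 'M[R]_p) :
  smooth_mx V A -> smooth V (fun x => \det (A x)).
Proof.
move=> sA; apply: smooth_sum => // s; apply: smoothM => //; first exact: smooth_cst.
by apply: smooth_prod => // k; exact: sA.
Qed.

Lemma smooth_inv p (A : 'cV[R]_m -> 'M[R]_p) :
  (forall x, V x -> A x \in unitmx) -> smooth_mx V A -> smooth_mx V (fun x => invmx (A x)).
Proof.
move=> uA sA; have sdet : smooth V (fun x => (\det (A x))^-1).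
  by apply: smoothV (smooth_det sA) => // x /uA; rewrite unitmxE unitfE.
move=> i j; have scof : smooth V (fun x => cofactor (A x) j i).
  apply: smoothM => //; first exact: smooth_cst.
  apply: smooth_det => k l; apply: smooth_eq oV _ (sA (lift j k) (lift i l)) => y _.
  by rewrite !mxE.
by apply: smooth_eq oV _ (smoothM oV sdet scof) => y Vy; rewrite /invmx uA // !mxE.
Qed.

Lemma smooth_block p (A B D E : 'cV[R]_m -> 'M[R]_p) :
  smooth_mx V A -> smooth_mx V B -> smooth_mx V D -> smooth_mx V E ->
  smooth_mx V (fun x => block_mx (A x) (B x) (D x) (E x)).
Proof.
move=> sA sB sD sE i j; have split_eq := splitP.
case: (splitP i) => [i'|i'] ei; case: (splitP j) => [j'|j'] ej.
- have -> : i = lshift p i' by apply: val_inj.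
  have -> : j = lshift p j' by apply: val_inj.
  by apply: smooth_eq oV _ (sA i' j') => y _; rewrite block_mxEul.
- have -> : i = lshift p i' by apply: val_inj.
  have -> : j = rshift p j' by apply: val_inj.
  by apply: smooth_eq oV _ (sB i' j') => y _; rewrite block_mxEur.
- have -> : i = rshift p i' by apply: val_inj.
  have -> : j = lshift p j' by apply: val_inj.
  by apply: smooth_eq oV _ (sD i' j') => y _; rewrite block_mxEdl.
- have -> : i = rshift p i' by apply: val_inj.
  have -> : j = rshift p j' by apply: val_inj.
  by apply: smooth_eq oV _ (sE i' j') => y _; rewrite block_mxEdr.
Qed.

End Matrices.

Section ComplexValued.
Implicit Types (h l : 'cV[R]_m -> C).

Lemma ReD (x y : C) : complex.Re (x + y) = complex.Re x + complex.Re y.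
Proof. by case: x; case: y. Qed.
Lemma ImD (x y : C) : complex.Im (x + y) = complex.Im x + complex.Im y.
Proof. by case: x; case: y. Qed.
Lemma ReM (x y : C) : complex.Re (x * y) =
  complex.Re x * complex.Re y + -1 * (complex.Im x * complex.Im y).
Proof. by case: x => a b; case: y => c d; rewrite mulN1r. Qed.
Lemma ImM (x y : C) : complex.Im (x * y) =
  complex.Re x * complex.Im y + complex.Im x * complex.Re y.
Proof. by case: x => a b; case: y => c d. Qed.

Section OnOpen.
Variables (V : set 'cV[R]_m).
Hypothesis oV : open V.

Lemma smoothC_eq h l : (forall x, V x -> h x = l x) -> smoothC V h -> smoothC V l.
Proof. by move=> hk [sr si]; split; [apply: smooth_eq oV _ sr|apply: smooth_eq oV _ si] => y /hk ->. Qed.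

Lemma smoothC_cst (c : C) : smoothC V (fun=> c).
Proof. by split; exact: smooth_cst. Qed.

Lemma smoothCD h l : smoothC V h -> smoothC V l -> smoothC V (fun x => h x + l x).
Proof.
move=> [hr hi] [kr ki]; split.
  by apply: smooth_eq oV _ (smoothD oV hr kr) => y _; rewrite ReD.
by apply: smooth_eq oV _ (smoothD oV hi ki) => y _; rewrite ImD.
Qed.

Lemma smoothCM h l : smoothC V h -> smoothC V l -> smoothC V (fun x => h x * l x).
Proof.
move=> [hr hi] [kr ki]; split.
  apply: smooth_eq oV _ (smoothD oV (smoothM oV hr kr)
     (smoothM oV (smooth_cst V (-1)) (smoothM oV hi ki))) => y _; by rewrite ReM.
by apply: smooth_eq oV _ (smoothD oV (smoothM oV hr ki) (smoothM oV hi kr)) => y _; rewrite ImM.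
Qed.

Lemma smoothC_sum (I : Type) (r : seq I) (P : pred I) (F : I -> 'cV[R]_m -> C) :
  (forall i, smoothC V (F i)) -> smoothC V (fun x => \sum_(i <- r | P i) F i x).
Proof.
move=> sF; elim: r => [|i r IH].
  by apply: smoothC_eq (smoothC_cst 0) => y _; rewrite big_nil.
case Pi: (P i).
  by apply: smoothC_eq (smoothCD (sF i) IH) => y _; rewrite big_cons Pi.
by apply: smoothC_eq IH => y _; rewrite big_cons Pi.
Qed.

Lemma smoothC_mx_eq p q (A B : 'cV[R]_m -> 'M[C]_(p, q)) :
  (forall x, V x -> A x = B x) -> smoothC_mx V A -> smoothC_mx V B.
Proof. by move=> AB sA i j; apply: smoothC_eq (sA i j) => y Vy; rewrite AB. Qed.

Lemma smoothC_mxD p q (A B : 'cV[R]_m -> 'M[C]_(p, q)) :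
  smoothC_mx V A -> smoothC_mx V B -> smoothC_mx V (fun x => A x + B x).
Proof.
by move=> sA sB i j; apply: smoothC_eq (smoothCD (sA i j) (sB i j)) => y _; rewrite mxE.
Qed.

Lemma smoothC_mxZ p q (k : C) (A : 'cV[R]_m -> 'M[C]_(p, q)) :
  smoothC_mx V A -> smoothC_mx V (fun x => k *: A x).
Proof.
move=> sA i j.
by apply: smoothC_eq (smoothCM (smoothC_cst k) (sA i j)) => y _; rewrite mxE.
Qed.

Lemma smoothC_mxM p q r (A : 'cV[R]_m -> 'M[C]_(p, q)) (B : 'cV[R]_m -> 'M[C]_(q, r)) :
  smoothC_mx V A -> smoothC_mx V B -> smoothC_mx V (fun x => A x *m B x).
Proof.
move=> sA sB i j; apply: (@smoothC_eq (fun x => \sum_d A x i d * B x d j)).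
  by move=> y _; rewrite mxE.
by apply: smoothC_sum => d; exact: smoothCM.
Qed.

Lemma smoothC_mxT p q (A : 'cV[R]_m -> 'M[C]_(p, q)) :
  smoothC_mx V A -> smoothC_mx V (fun x => (A x)^T).
Proof. by move=> sA i j; apply: smoothC_eq (sA j i) => y _; rewrite mxE. Qed.

Lemma smoothC_toC p q (A : 'cV[R]_m -> 'M[R]_(p, q)) :
  smooth_mx V A -> smoothC_mx V (fun x => toC (A x)).
Proof.
move=> sA i j; split; first by apply: smooth_eq oV _ (sA i j) => y _; rewrite mxE.
by apply: smooth_eq oV _ (smooth_cst V 0) => y _; rewrite mxE.
Qed.

Definition smooth_form (phi : 'cV[R]_m -> form R m) :=
  forall S, smoothC V (fun x => phi x S).

Lemma smooth_formZ (k : C) phi : smooth_form phi -> smooth_form (fun x => k *: phi x).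
Proof.
by move=> sphi S; apply: smoothC_eq (smoothCM (smoothC_cst k) (sphi S)) => y _; rewrite ffunE.
Qed.

Lemma smooth_form_sum (I : finType) (phi : I -> 'cV[R]_m -> form R m) :
  (forall i, smooth_form (phi i)) -> smooth_form (fun x => \sum_i phi i x).
Proof.
move=> sphi S; apply: smoothC_eq (smoothC_sum (index_enum I) xpredT (fun i => sphi i S)) => y _.
by rewrite sum_ffunE.
Qed.

Lemma smooth_wedge phi psi : smooth_form phi -> smooth_form psi ->
  smooth_form (fun x => wedge (phi x) (psi x)).
Proof.
move=> sphi spsi U; pose F S x : C := (-1) ^+ inversions S (U :\: S)%SET *
  (phi x S * psi x (U :\: S)%SET).
have sF S : smoothC V (F S).
  by apply: smoothCM; [exact: smoothC_cst|apply: smoothCM; [exact: sphi|exact: spsi]].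
have sE : smoothC V (fun x => \sum_(S : {set 'I_m} | S \subset U) F S x) by exact: smoothC_sum.
have FE y : V y -> \sum_(S : {set 'I_m} | S \subset U) F S y = wedge (phi y) (psi y) U.
  by rewrite ffunE.
exact: smoothC_eq FE sE.
Qed.

Lemma smooth_form2 (W : 'cV[R]_m -> 'M[C]_m) :
  smoothC_mx V W -> smooth_form (fun x => form2 (W x)).
Proof.
move=> sW S; apply: (@smoothC_eq (fun x => \sum_(a < m)
    \sum_(b < m | (a < b)%N && (S == [set a; b]%SET)) W x a b)).
  by move=> y _; rewrite ffunE.
by apply: smoothC_sum => a; apply: smoothC_sum => b; exact: sW.
Qed.

Lemma smooth_iter_wedge phi psi (d : nat) : smooth_form phi -> smooth_form psi ->
  smooth_form (fun x => iter d (wedge (phi x)) (psi x)).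
Proof. by move=> sphi spsi; elim: d => //= d IH; exact: smooth_wedge. Qed.

End OnOpen.

Definition diffC h x := forall a,
  derivable (fun y => complex.Re (h y)) x (delta_mx a 0) /\
  derivable (fun y => complex.Im (h y)) x (delta_mx a 0).

Lemma smoothC_diffC V h x : smoothC V h -> V x -> diffC h x.
Proof.
move=> [hr hi] Vx a; split.
  by have [_ /(_ a) [d _]] := hr 1%N; exact: d.
by have [_ /(_ a) [d _]] := hi 1%N; exact: d.
Qed.

Lemma pdC_eq V h l x a : open V -> (forall y, V y -> h y = l y) -> V x ->
  pdC a h x = pdC a l x.
Proof.
move=> oV hk Vx; congr (_ +i* _)%C; apply: pd_eq oV _ Vx => y /hk -> //.
Qed.

Lemma diffC_cst c x : diffC (fun=> c) x.
Proof. by move=> a; split; exact: derivable_cst. Qed.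

Lemma derivD f g x v : derivable f x v -> derivable g x v ->
  derivable (fun y => f y + g y) x v.
Proof. by move=> df dg; apply: derivableD; [exact: df|exact: dg]. Qed.

Lemma derivM f g x v : derivable f x v -> derivable g x v ->
  derivable (fun y => f y * g y) x v.
Proof. by move=> df dg; apply: derivableM; [exact: df|exact: dg]. Qed.

Lemma pdD f g x a : derivable f x (delta_mx a 0) -> derivable g x (delta_mx a 0) ->
  pd a (fun y => f y + g y) x = pd a f x + pd a g x.
Proof. by move=> df dg; exact: (deriveD df dg). Qed.

Lemma pdM f g x a : derivable f x (delta_mx a 0) -> derivable g x (delta_mx a 0) ->
  pd a (fun y => f y * g y) x = f x * pd a g x + g x * pd a f x.
Proof. by move=> df dg; have := @deriveM _ _ f g x (delta_mx a 0) df dg. Qed.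

Lemma diffCD h l x : diffC h x -> diffC l x -> diffC (fun y => h y + l y) x.
Proof.
move=> dh dl a; have [hr hi] := dh a; have [lr li] := dl a.
have -> : (fun y => complex.Re (h y + l y)) = (fun y => complex.Re (h y) + complex.Re (l y)).
  by apply/funext => y; rewrite ReD.
have -> : (fun y => complex.Im (h y + l y)) = (fun y => complex.Im (h y) + complex.Im (l y)).
  by apply/funext => y; rewrite ImD.
by split; [exact: (derivD hr lr)|exact: (derivD hi li)].
Qed.

Lemma pdCD h l x a : diffC h x -> diffC l x ->
  pdC a (fun y => h y + l y) x = pdC a h x + pdC a l x.
Proof.
move=> dh dl; have [hr hi] := dh a; have [lr li] := dl a; rewrite /pdC.
have -> : (fun y => complex.Re (h y + l y)) = (fun y => complex.Re (h y) + complex.Re (l y)).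
  by apply/funext => y; rewrite ReD.
have -> : (fun y => complex.Im (h y + l y)) = (fun y => complex.Im (h y) + complex.Im (l y)).
  by apply/funext => y; rewrite ImD.
by rewrite (pdD hr lr) (pdD hi li).
Qed.

Lemma diffCM h l x : diffC h x -> diffC l x -> diffC (fun y => h y * l y) x.
Proof.
move=> dh dl a; have [hr hi] := dh a; have [lr li] := dl a.
under eq_fun do rewrite ReM; under [X in _ /\ derivable X _ _]eq_fun do rewrite ImM.
have c1 : derivable (fun=> -1 : R) x (delta_mx a 0) by exact: derivable_cst.
split; last exact: (derivD (derivM hr li) (derivM hi lr)).
exact: (derivD (derivM hr lr) (derivM c1 (derivM hi li))).
Qed.

Lemma pdCM h l x a : diffC h x -> diffC l x ->
  pdC a (fun y => h y * l y) x = h x * pdC a l x + l x * pdC a h x.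
Proof.
move=> dh dl; have [hr hi] := dh a; have [lr li] := dl a; rewrite /pdC.
under eq_fun do rewrite ReM; under [X in (_ +i* pd a X x)%C]eq_fun do rewrite ImM.
have c1 : derivable (fun=> -1 : R) x (delta_mx a 0) by exact: derivable_cst.
rewrite (pdD (derivM hr lr) (derivM c1 (derivM hi li))) (pdD (derivM hr li) (derivM hi lr)).
rewrite (pdM c1 (derivM hi li)) (pdM hr lr) (pdM hi li) (pdM hr li) (pdM hi lr).
have -> : pd a (fun=> -1 : R) x = 0 by exact: derive_cst.
move: (pd a _ x) (pd a _ x) (pd a _ x) (pd a _ x) => r1 r2 r3 r4.
case: (h x) => p q; case: (l x) => r s /=.
by apply/eqP; rewrite eq_complex /=; apply/andP; split; apply/eqP; ring.
Qed.

Lemma pdC_cst (c : C) (x : 'cV[R]_m) a : pdC a (fun=> c) x = 0.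
Proof. by rewrite /pdC /pd !derive_cst. Qed.

Lemma diffC_sum (I : Type) (r : seq I) (F : I -> 'cV[R]_m -> C) x :
  (forall i, diffC (F i) x) -> diffC (fun y => \sum_(i <- r) F i y) x.
Proof.
move=> dF; elim: r => [|i r IH].
  by rewrite (_ : (fun y => _) = fun=> 0); [exact: diffC_cst|apply/funext => y; rewrite big_nil].
rewrite (_ : (fun y => _) = fun y => F i y + \sum_(j <- r) F j y); first exact: diffCD.
by apply/funext => y; rewrite big_cons.
Qed.

Lemma pdC_sum (I : Type) (r : seq I) (F : I -> 'cV[R]_m -> C) x a :
  (forall i, diffC (F i) x) ->
  pdC a (fun y => \sum_(i <- r) F i y) x = \sum_(i <- r) pdC a (F i) x.
Proof.
move=> dF; elim: r => [|i r IH].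
  rewrite big_nil (_ : (fun y => _) = fun=> 0) ?pdC_cst //.
  by apply/funext => y; rewrite big_nil.
rewrite big_cons -IH -pdCD //; last exact: diffC_sum.
by congr pdC; apply/funext => y; rewrite big_cons.
Qed.

End ComplexValued.
End Smooth.

(** * Cartan calculus for complex vector fields and closed 2-forms *)

Section Cartan.
Context {R : realType} {m : nat}.
Notation C := R[i].
Implicit Types (X Y Z xi eta : 'cV[R]_m -> 'cV[C]_m) (S W : 'cV[R]_m -> 'M[C]_m).

Definition diff_cv X x := forall a, diffC (fun y => X y a 0) x.
Definition diff_mx S x := forall a b, diffC (fun y => S y a b) x.

Lemma pdC_lin (k l : C) (f g : 'cV[R]_m -> C) x a : diffC f x -> diffC g x ->
  pdC a (fun y => k * f y + l * g y) x = k * pdC a f x + l * pdC a g x.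
Proof.
move=> df dg; have dk := diffC_cst k x; have dl := diffC_cst l x.
rewrite (pdCD a (diffCM dk df) (diffCM dl dg)) (pdCM a dk df) (pdCM a dl dg).
by rewrite !pdC_cst !mulr0 !addr0.
Qed.

Lemma diffC_lin (k l : C) (f g : 'cV[R]_m -> C) x : diffC f x -> diffC g x ->
  diffC (fun y => k * f y + l * g y) x.
Proof.
move=> df dg; have dk := diffC_cst k x; have dl := diffC_cst l x.
exact: (diffCD (diffCM dk df) (diffCM dl dg)).
Qed.

Lemma cv_lin_entry k l X Y a :
  (fun y => (k *: X y + l *: Y y) a 0) = (fun y => k * X y a 0 + l * Y y a 0).
Proof. by apply/funext => y; rewrite !mxE. Qed.

Lemma diff_cv_lin k l X Y x : diff_cv X x -> diff_cv Y x ->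
  diff_cv (fun y => k *: X y + l *: Y y) x.
Proof. by move=> dX dY a; rewrite cv_lin_entry; exact: diffC_lin. Qed.

Lemma diff_cv_mul S X x : diff_mx S x -> diff_cv X x -> diff_cv (fun y => S y *m X y) x.
Proof.
move=> dS dX a; rewrite (_ : (fun y => _) = fun y => \sum_b S y a b * X y b 0).
  by apply: diffC_sum => b; exact: diffCM.
by apply/funext => y; rewrite mxE.
Qed.

Lemma lieC_linr k l X Y Z x : diff_cv Y x -> diff_cv Z x ->
  lieC X (fun y => k *: Y y + l *: Z y) x = k *: lieC X Y x + l *: lieC X Z x.
Proof.
move=> dY dZ; apply/matrixP => a b0; rewrite !mxE !mulr_sumr -big_split.
by apply: eq_bigr => b _; rewrite cv_lin_entry pdC_lin // !mxE /=; ring.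
Qed.

Lemma lieC_linl k l X Y Z x : diff_cv X x -> diff_cv Y x ->
  lieC (fun y => k *: X y + l *: Y y) Z x = k *: lieC X Z x + l *: lieC Y Z x.
Proof.
move=> dX dY; apply/matrixP => a b0; rewrite !mxE !mulr_sumr -big_split.
by apply: eq_bigr => b _; rewrite cv_lin_entry pdC_lin // !mxE /=; ring.
Qed.

Lemma lie_form_lin k l X xi eta x : diff_cv xi x -> diff_cv eta x ->
  lie_form X (fun y => k *: xi y + l *: eta y) x = k *: lie_form X xi x + l *: lie_form X eta x.
Proof.
move=> dxi deta; apply/matrixP => a b0; rewrite !mxE !mulr_sumr -big_split.
by apply: eq_bigr => b _; rewrite cv_lin_entry pdC_lin // !mxE /=; ring.
Qed.

Lemma contr_d_linr k l Y xi eta x : diff_cv xi x -> diff_cv eta x ->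
  contr_d Y (fun y => k *: xi y + l *: eta y) x = k *: contr_d Y xi x + l *: contr_d Y eta x.
Proof.
move=> dxi deta; apply/matrixP => a b0; rewrite !mxE !mulr_sumr -big_split.
by apply: eq_bigr => b _; rewrite !cv_lin_entry !pdC_lin //=; ring.
Qed.

Lemma contr_d_linl k l X Y xi x :
  contr_d (fun y => k *: X y + l *: Y y) xi x = k *: contr_d X xi x + l *: contr_d Y xi x.
Proof.
apply/matrixP => a b0; rewrite !mxE !mulr_sumr -big_split.
by apply: eq_bigr => b _; rewrite !mxE /=; ring.
Qed.

Section OnOpen.
Variables (U : set 'cV[R]_m).
Hypothesis oU : open U.

Lemma lie_form_eq X xi eta x : (forall y, U y -> xi y = eta y) -> U x ->
  lie_form X xi x = lie_form X eta x.
Proof.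
move=> xe Ux; apply/matrixP => a b0; rewrite !mxE; apply: eq_bigr => b _.
rewrite xe //; congr (_ * _ + _); apply: pdC_eq oU _ Ux => y Uy; by rewrite xe.
Qed.

Lemma contr_d_eq Y xi eta x : (forall y, U y -> xi y = eta y) -> U x ->
  contr_d Y xi x = contr_d Y eta x.
Proof.
move=> xe Ux; apply/matrixP => a b0; rewrite !mxE; apply: eq_bigr => b _.
by congr (_ * (_ - _)); apply: pdC_eq oU _ Ux => y Uy; rewrite xe.
Qed.

Lemma lie_form0 X x : lie_form X (fun=> 0) x = 0.
Proof.
apply/matrixP => a b0; rewrite !mxE big1 // => b _; rewrite mxE mul0r addr0.
by rewrite pdC_cst mulr0.
Qed.

Lemma contr_d0 X x : contr_d X (fun=> 0) x = 0.
Proof.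
apply/matrixP => a b0; rewrite !mxE big1 // => b _.
by rewrite !pdC_cst subrr mulr0.
Qed.

(* d W = 0 for the 2-form W with W^T = S. *)
Definition closedC S x := forall a b c,
  pdC b (fun y => S y a c) x - pdC c (fun y => S y a b) x + pdC a (fun y => S y c b) x = 0.

(* Cartan's formula L_X W = iota_X d W + d iota_X W, applied to Z *)
Lemma lie_form_closed S X Z x : diff_mx S x -> (S x)^T = - S x -> closedC S x ->
  diff_cv X x -> diff_cv Z x ->
  lie_form X (fun y => S y *m Z y) x =
  S x *m lieC X Z x + contr_d Z (fun y => S y *m X y) x.
Proof.
move=> dS skS cS dX dZ; apply/matrixP => a b0; rewrite (ord1 b0) !mxE.
have dSV V b : diff_cv V x -> forall d,
    pdC d (fun y => (S y *m V y) b 0) x =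
    \sum_c (S x b c * pdC d (fun y => V y c 0) x + V x c 0 * pdC d (fun y => S y b c) x).
  move=> dV d; rewrite (_ : (fun y => _) = fun y => \sum_c S y b c * V y c 0).
    by rewrite pdC_sum => [|c]; [apply: eq_bigr => c _; rewrite pdCM|exact: diffCM].
  by apply/funext => y; rewrite mxE.
have sk b c : S x b c = - S x c b.
  by have /matrixP /(_ c b) := skS; rewrite !mxE.
(* The terms left after differentiating products. [T2], [T3] and [T4] contain derivatives of vector
   fields and cancel by relabelling and skewness; what remains, [T1 = T5 - T6], is closedness of
   [S]. *)
pose T1 := \sum_b \sum_c (X x b 0 * Z x c 0 * pdC b (fun y => S y a c) x).
pose T2 := \sum_b \sum_c (X x b 0 * S x a c * pdC b (fun y => Z y c 0) x).
pose T3 := \sum_b \sum_c (S x b c * Z x c 0 * pdC a (fun y => X y b 0) x).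
pose T4 := \sum_b \sum_c (S x a c * Z x b 0 * pdC b (fun y => X y c 0) x).
pose T5 := \sum_b \sum_c (Z x c 0 * X x b 0 * pdC c (fun y => S y a b) x).
pose T6 := \sum_b \sum_c (Z x c 0 * X x b 0 * pdC a (fun y => S y c b) x).
have -> : \sum_b (X x b 0 * pdC b (fun y => (S y *m Z y) a 0) x +
       (S x *m Z x) b 0 * pdC a (fun y => X y b 0) x) = T1 + T2 + T3.
  rewrite /T1 /T2 /T3 -!big_split; apply: eq_bigr => b _ /=.
  rewrite dSV // mxE mulr_sumr mulr_suml -!big_split; apply: eq_bigr => c _ /=.
  by ring.
have -> : \sum_j S x a j * lieC X Z x j 0 = T2 - T4.
  rewrite /T2 /T4 [X in X - _]exchange_big [X in _ - X]exchange_big -sumrB.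
  apply: eq_bigr => c _; rewrite mxE mulr_sumr -sumrB; apply: eq_bigr => b _.
  by ring.
have -> : \sum_b Z x b 0 * (pdC b (fun y => (S y *m X y) a 0) x -
      pdC a (fun y => (S y *m X y) b 0) x) = T4 + T5 - T6 + T3.
  have -> : T5 = \sum_b \sum_c (Z x b 0 * X x c 0 * pdC b (fun y => S y a c) x).
    by rewrite /T5 exchange_big.
  have -> : T6 = \sum_b \sum_c (Z x b 0 * X x c 0 * pdC a (fun y => S y b c) x).
    by rewrite /T6 exchange_big.
  have -> : T3 = - \sum_b \sum_c (Z x b 0 * S x b c * pdC a (fun y => X y c 0) x).
    rewrite /T3 exchange_big -sumrN; apply: eq_bigr => b _; rewrite -sumrN.
    by apply: eq_bigr => c _; rewrite [S x c b]sk; ring.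
  rewrite /T4 -sumrN -sumrN -!big_split; apply: eq_bigr => b _ /=.
  rewrite !dSV // mulrBr !mulr_sumr -!sumrN -!big_split; apply: eq_bigr => c _ /=.
  by ring.
suff -> : T1 = T5 - T6 by ring.
rewrite /T1 /T5 /T6 -sumrB; apply: eq_bigr => b _; rewrite -sumrB; apply: eq_bigr => c _.
have /eqP := cS a b c; rewrite addr_eq0 subr_eq => /eqP ->; ring.
Qed.

(** The graph of a closed 2-form is involutive. Writing [S X = t S Z] rather than [Z = X / t] keeps
    the argument valid at [t = 0], where [X] is confined to the kernel of [S]. *)
Lemma courant_graph (S W : 'cV[R]_m -> 'M[C]_m) X Y Z Z' xi eta (t s w : C) :
  (forall x, U x -> diff_mx S x /\ diff_mx W x) ->
  (forall x, U x -> (S x)^T = - S x /\ (W x)^T = - W x) ->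
  (forall x, U x -> closedC S x /\ closedC W x) ->
  (forall x, U x -> [/\ diff_cv X x, diff_cv Y x, diff_cv Z x & diff_cv Z' x]) ->
  (forall x, U x -> S x *m X x = t *: (S x *m Z x)) ->
  (forall x, U x -> S x *m Y x = t *: (S x *m Z' x)) ->
  (forall x, U x -> xi x = w *: (W x *m X x) + s *: (S x *m Z x)) ->
  (forall x, U x -> eta x = w *: (W x *m Y x) + s *: (S x *m Z' x)) ->
  forall x, U x -> exists Z'' : 'cV[C]_m,
    S x *m lieC X Y x = t *: (S x *m Z'') /\
    lie_form X eta x - contr_d Y xi x = w *: (W x *m lieC X Y x) + s *: (S x *m Z'').
Proof.
move=> dSW skSW cSW dXYZ SX SY xiE etaE x Ux.
have [dS dW] := dSW _ Ux; have [skS skW] := skSW _ Ux; have [cS cW] := cSW _ Ux.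
have [dX dY dZ dZ'] := dXYZ _ Ux.
(* [V] and [X'] measure how far [t Z'] and [t Z] are from [Y] and [X]; they lie in the kernel of
   [S]. *)
pose V y := t *: Z' y + (-1) *: Y y; pose X' y := 1 *: X y + (- t) *: Z y.
have dV : diff_cv V x by exact: diff_cv_lin.
have dX' : diff_cv X' x by exact: diff_cv_lin.
have SV y : U y -> S y *m V y = 0.
  by move=> Uy; rewrite /V mulmxDr -!scalemxAr SY // scaleN1r subrr.
have SX' y : U y -> S y *m X' y = 0.
  by move=> Uy; rewrite /X' mulmxDr -!scalemxAr SX // scale1r scaleNr subrr.
(* This identity and the next are Cartan's formula for the vanishing 1-form [S V]; the next one says
   that the kernel of a closed 2-form is involutive. *)
have iV : contr_d V (fun y => S y *m Z y) x = - (S x *m lieC Z V x).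
  have := lie_form_closed dS skS cS dZ dV.
  by rewrite (lie_form_eq _ SV Ux) lie_form0 => /esym/eqP; rewrite addrC addr_eq0 => /eqP.
have kV : S x *m lieC X' V x = 0.
  have := lie_form_closed dS skS cS dX' dV.
  by rewrite (lie_form_eq _ SV Ux) lie_form0 (contr_d_eq _ SX' Ux) contr_d0 addr0.
(* Expanding [S [X - t Z, t Z' - Y] = 0] and solving for [S [X, Y]] yields [t S] applied to this
   witness. *)
exists (lieC X Z' x - lieC Z V x); split.
  move: kV; rewrite /X' lieC_linl // !mulmxDr -!scalemxAr scale1r.
  rewrite {1}/V lieC_linr // mulmxDr -!scalemxAr.
  rewrite mulmxN; move: (S x *m _) (S x *m _) (S x *m _) => m1 m2 m3 kV.
  rewrite -[LHS]addr0 -kV; apply/matrixP => a b; rewrite !mxE; ring.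
have dWX : diff_cv (fun y => W y *m X y) x by exact: diff_cv_mul.
have dWY : diff_cv (fun y => W y *m Y y) x by exact: diff_cv_mul.
have dSZ : diff_cv (fun y => S y *m Z y) x by exact: diff_cv_mul.
have dSZ' : diff_cv (fun y => S y *m Z' y) x by exact: diff_cv_mul.
rewrite (lie_form_eq _ etaE Ux) (contr_d_eq _ xiE Ux) lie_form_lin // contr_d_linr //.
rewrite (lie_form_closed dW skW cW dX dY) (lie_form_closed dS skS cS dX dZ').
have SXE y : U y -> S y *m X y = t *: (S y *m Z y) + 0 *: (S y *m Z y).
  by move=> Uy; rewrite SX // scale0r addr0.
rewrite (contr_d_eq _ SXE Ux) contr_d_linr // scale0r addr0.
have := iV; rewrite contr_d_linl scaleN1r => /eqP; rewrite subr_eq => /eqP ->.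
rewrite mulmxBr; move: (W x *m _) (S x *m _) (S x *m _) (contr_d _ _ _) (contr_d _ _ _) => m1 m2 m3 m4 m5.
by apply/matrixP => a b; rewrite !mxE; ring.
Qed.

End OnOpen.
End Cartan.

(** * From real to complex matrices *)

Section Complexification.
Context {R : realType}.
Notation C := R[i].

Lemma toCM p q r (A : 'M[R]_(p, q)) (B : 'M[R]_(q, r)) : toC (A *m B) = toC A *m toC B.
Proof. exact: map_mxM. Qed.
Lemma toCD p q (A B : 'M[R]_(p, q)) : toC (A + B) = toC A + toC B.
Proof. exact: map_mxD. Qed.
Lemma toCN p q (A : 'M[R]_(p, q)) : toC (- A) = - toC A.
Proof. exact: map_mxN. Qed.
Lemma toCZ p q k (A : 'M[R]_(p, q)) : toC (k *: A) = k%:C%C *: toC A.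
Proof. exact: map_mxZ. Qed.
Lemma toCT p q (A : 'M[R]_(p, q)) : toC A^T = (toC A)^T.
Proof. by rewrite /toC map_trmx. Qed.
Lemma toC1 p : toC (1%:M : 'M[R]_p) = 1%:M.
Proof. exact: map_mx1. Qed.
Lemma toC_inj p q : injective (@toC R p q).
Proof. by apply: map_mx_inj => x y []. Qed.

Lemma toC_bihermitian p (G A D : 'M[R]_p) :
  toC (bihermitian G A D) = bihermitian (toC G) (toC A) (toC D).
Proof.
rewrite /bihermitian toCZ; congr (_ *: _); first by rewrite fmorphV rmorph_nat.
rewrite /toC map_block_mx !map_mxD !map_mxN !map_mxD !map_mxN !map_invmx !map_mxM !map_trmx.
by [].
Qed.

(** The columns of [A + i] are +i-eigenvectors of [A], hence of [B]; the imaginary part of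
    [B (A + i) = i (A + i)] reads [B = A]. *)
Lemma eigen_i_inj p (A B : 'M[R]_(p + p)) : A *m A = - 1%:M ->
  (forall u, eigen_i A u -> eigen_i B u) -> A = B.
Proof.
move=> AA AB; apply/matrixP => a b.
have : eigen_i A ((toC A + ('i)%C *: 1%:M) *m delta_mx b 0).
  rewrite /eigen_i /= mulmxA mulmxDr -toCM AA toCN toC1 -scalemxAr mulmx1.
  rewrite scalemxAl; congr (_ *m _); rewrite scalerDr scalerA -expr2 sqr_i scaleN1r.
  by rewrite addrC.
move=> /AB; rewrite /eigen_i /= mulmxA scalemxAl -!colE.
rewrite mulmxDr -toCM -scalemxAr mulmx1; move: (B *m A) => N /matrixP /(_ a 0).
rewrite !mxE => /(congr1 (@complex.Im R)).
rewrite !(ReD, ImD, ReM, ImM) /=; case: (a == b) => /=; lra.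
Qed.

End Complexification.

(** * [J_field] on the manifold: algebra, smoothness, change of charts *)

Section Hyperkahler.
Context {R : realType} {n : nat} (M : hyperkahler R n).
Notation C := R[i].
Notation m := (4 * n)%N.
Notation i0 := ('i)%C.
Notation Ie := (@I_eta R n M).

Lemma img_open (i : idx M) : open (img i).
Proof. exact: cod_open. Qed.

Lemma hg_sym (i : idx M) x : img i x -> (hg M i x)^T = hg M i x.
Proof. by have [_ _ H] := hg_metric M => /H []. Qed.

Lemma hg_unit (i : idx M) x : img i x -> hg M i x \in unitmx.
Proof.
move=> /[dup] ix; have [_ _ H] := hg_metric M => /H [_ pos].
rewrite unitmxE unitfE; apply/negP => /det0P [v v0 vg].
have := pos v^T; rewrite trmx_eq0 trmxK vg mul0mx mxE ltxx => /(_ v0).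
by [].
Qed.

Lemma kahler_skew (A : field M m m) : kahler (hg M) A -> forall i x, img i x ->
  (A i x)^T *m hg M i x = - (hg M i x *m A i x).
Proof.
move=> [_ AA _ Ag _] i x ix; rewrite -{2}(Ag i x ix) -[in RHS]mulmxA AA //.
by rewrite mulmxN mulmx1 opprK.
Qed.

Section Point.
Variables (i : idx M) (x : 'cV[R]_m).
Hypothesis ix : img i x.
Notation G := (toC (hg M i x)).
Notation I := (toC (hI M i x)).
Notation J := (toC (hJ M i x)).
Notation K := (toC (hK M i x)).

Lemma hQ : quaternionic I J K.
Proof.
split; rewrite -?toC1 -?toCN -toCM; congr toC.
- by case: (hI_kahler M) => _ ->.
- by case: (hJ_kahler M) => _ ->.
- by case: (hK_kahler M) => _ ->.
- exact: hIJ. - exact: hJI. - exact: hJK. - exact: hKJ. - exact: hKI. exact: hIK.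
Qed.

Lemma GC_sym : G^T = G.
Proof. by rewrite -toCT hg_sym. Qed.

Lemma GC_unit : G \in unitmx.
Proof. by rewrite /toC map_unitmx hg_unit. Qed.

Lemma IGC : I^T *m G = - (G *m I).
Proof. by rewrite -toCT -!toCM -toCN (kahler_skew (hI_kahler M)). Qed.
Lemma JGC : J^T *m G = - (G *m J).
Proof. by rewrite -toCT -!toCM -toCN (kahler_skew (hJ_kahler M)). Qed.
Lemma KGC : K^T *m G = - (G *m K).
Proof. by rewrite -toCT -!toCM -toCN (kahler_skew (hK_kahler M)). Qed.

End Point.

Notation eA i x a := (endoA (toC (hI M i x)) (toC (hJ M i x)) (toC (hK M i x)) i0
  (h0 a) (h1 a) (h0 a)^*%C (h1 a)^*%C).
Notation eS i x a := (endoB (toC (hI M i x)) (toC (hJ M i x)) (toC (hK M i x)) i0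
  (h0 a) (h1 a) (h0 a) (h1 a)).
Notation eZ i x a b := (Zparam (toC (hI M i x)) (toC (hJ M i x)) (toC (hK M i x))
  (h0 a) (h1 a) (h0 a)^*%C (h1 a)^*%C (h0 b) (h1 b) (h0 b)^*%C (h1 b)^*%C).
Notation sP a b := (sparam (h0 a) (h1 a) (h0 b) (h1 b) (h0 b)^*%C (h1 b)^*%C).
Notation tP a b := (tparam i0 (h0 a) (h1 a) (h0 b) (h1 b)).

Lemma toC_I_eta (a : CP1 R) (i : idx M) x : toC (Ie a i x) = eA i x a.
Proof.
rewrite /endoA /quat raddf0 add0r; case: a => [[u v]|]; rewrite /h0 /h1 ?conjc0 ?conjc1.
  rewrite /I_eta !toCD !toCZ !mul1r /=.
  have E : 1 + (u +i* v)%C * (u -i* v)%C = (1 + (u ^+ 2 + v ^+ 2))%:C%C.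
    by apply/eqP; rewrite eq_complex /=; apply/andP; split; apply/eqP; ring.
  rewrite mulr1 E; set D := (1 + _)%:C%C.
  have frac (p : R) (q : C) : p%:C%C = q -> (p / (1 + (u ^+ 2 + v ^+ 2)))%:C%C = q / D.
    by move=> <-; rewrite fmorph_div.
  rewrite (frac _ (1 - (u +i* v)%C * (u -i* v)%C)); last first.
    by apply/eqP; rewrite eq_complex /=; apply/andP; split; apply/eqP; ring.
  rewrite (frac _ ((u +i* v)%C + (u -i* v)%C)); last first.
    by apply/eqP; rewrite eq_complex /=; apply/andP; split; apply/eqP; ring.
  rewrite (frac _ (- i0 * ((u +i* v)%C - (u -i* v)%C))) //.
  by apply/eqP; rewrite eq_complex /=; apply/andP; split; apply/eqP; ring.
rewrite [Ie _ _ _]/(- hI M i x) toCN !mul0r !mul1r ?mulr0 !sub0r !add0r oppr0 mulr0.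
by rewrite !divr1 scaleN1r !scale0r !addr0.
Qed.

Lemma I_eta_sq a (i : idx M) x : img i x -> Ie a i x *m Ie a i x = - 1%:M.
Proof.
move=> ix; apply: toC_inj; rewrite toCM toC_I_eta toCN toC1.
exact: (endoA_sq (hQ ix) i_sq (h_norm a)).
Qed.

Lemma I_eta_skew a (i : idx M) x : img i x ->
  (Ie a i x)^T *m hg M i x = - (hg M i x *m Ie a i x).
Proof.
move=> ix; apply: toC_inj; rewrite toCN !toCM toCT toC_I_eta.
exact: (quat_imagT (IGC ix) (JGC ix) (KGC ix)).
Qed.

Lemma J_fieldE a b (i : idx M) x : img i x ->
  J_field M a b i x = bihermitian (hg M i x) (Ie a i x) (Ie b i x).
Proof.
by move=> ix; rewrite /J_field /bihermitian /kmap /kform !trmx_mul !trmxK hg_sym.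
Qed.

(** The base point is the first parameter, so [A = I_a] and [D = I_b], whereas the spinor built from
    these data has its parameters in the opposite order. *)
Lemma tp (a b : CP1 R) i x : img i x ->
  twistor_pair (toC (hg M i x)) (eA i x a) (eS i x a)
   (endoBc (toC (hI M i x)) (toC (hJ M i x)) (toC (hK M i x)) i0 (h0 a)^*%C (h1 a)^*%C)
   (eA i x b) (eZ i x b a) (-2 * (h0 a * (h0 a)^*%C + h1 a * (h1 a)^*%C) ^+ 2)
   (sP b a) (tP b a).
Proof.
move=> ix; apply: (twistorP (hQ ix) (IGC ix) (JGC ix) (KGC ix) (h_norm b) (h_norm a)).
Qed.

Lemma eigen_J a b i x u : img i x ->
  eigen_i (J_field M a b i x) u <->
  bihermitian (toC (hg M i x)) (eA i x a) (eA i x b) *m u = i0 *: u.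
Proof. by move=> ix; rewrite /eigen_i /= J_fieldE // toC_bihermitian !toC_I_eta. Qed.

Lemma J_field_sq a b i x : img i x -> J_field M a b i x *m J_field M a b i x = - 1%:M.
Proof.
move=> ix; rewrite J_fieldE // bihermitian_sq ?hg_unit //; try exact: I_eta_sq; exact: I_eta_skew.
Qed.

Lemma J_field_orth a b i x u v : img i x ->
  pairing (J_field M a b i x *m u) (J_field M a b i x *m v) = pairing u v.
Proof.
move=> ix; rewrite -[LHS]/(2^-1 * natpair _ _) -[RHS]/(2^-1 * natpair _ _); congr (_ * _).
rewrite J_fieldE // bihermitian_natpair ?hg_sym ?hg_unit //; try exact: I_eta_sq; try exact: I_eta_skew.
rewrite mulmxA -J_fieldE // J_field_sq // mulNmx mul1mx.
rewrite -[- v]scaleN1r /natpair !linearZ /= -?scalemxAr -?scalemxAl !mxE; ring.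
Qed.

(** The coefficients are constant on [M], so smoothness and the transformation law pass from [I],
    [J], [K] to [I_eta]. *)
Lemma I_eta_lin a : exists p q r : R, forall (i : idx M) x,
  Ie a i x = p *: hI M i x + q *: hJ M i x + r *: hK M i x.
Proof.
case: a => [z|]; first by do 3!eexists.
by exists (-1), 0, 0 => i x; rewrite !scale0r !addr0 scaleN1r.
Qed.

Lemma J_field_smooth a b : smooth_field (J_field M a b).
Proof.
move=> i; have oV : open (img i) by exact: img_open.
have [_ sg _] := hg_metric M.
have [[_ sI] _ _ _ _] := hI_kahler M; have [[_ sJ] _ _ _ _] := hJ_kahler M.
have [[_ sK] _ _ _ _] := hK_kahler M.
have sE c : smooth_mx (img i) (Ie c i).
  have [p [q [r cE]]] := I_eta_lin c.
  apply: (@smooth_mx_eq _ _ _ oV _ _ _ _ (fun x _ => esym (cE i x))).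
  by apply: smooth_mxD => //; [apply: smooth_mxD => //|]; apply: smooth_mxZ.
have sw c : smooth_mx (img i) (kmap (hg M) (Ie c) i).
  by apply: smooth_mxT => //; apply: smooth_mxM => //; apply: smooth_mxT.
have uw c x : img i x -> kmap (hg M) (Ie c) i x \in unitmx.
  move=> ix; rewrite /kmap /kform trmx_mul trmxK hg_sym // unitmx_mul hg_unit //=.
  have /mulmx1_unit [] : Ie c i x *m - Ie c i x = 1%:M.
    by rewrite mulmxN I_eta_sq // opprK.
  by [].
have siw c : smooth_mx (img i) (fun x => invmx (kmap (hg M) (Ie c) i x)).
  by apply: smooth_inv => //; exact: uw.
apply: smooth_mxZ => //; apply: smooth_block => //.
- by apply: smooth_mxN => //; apply: smooth_mxD.
- by apply: smooth_mxN => //; apply: smooth_mxD => //; apply: smooth_mxN.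
- by apply: smooth_mxD => //; apply: smooth_mxN.
by apply: smooth_mxD => //; apply: smooth_mxT.
Qed.

Lemma trans_img (i j : idx M) (x : 'cV[R]_m) : overlap (atlas i) (atlas j) x -> img i x /\ img j (trans i j x).
Proof. by move=> [ix dx]; split => //; apply: fwd_cod. Qed.

(* The Jacobians are invertible because they are isometries for g. *)
Lemma jac_unit (i j : idx M) x : overlap (atlas i) (atlas j) x -> jac i j x \in unitmx.
Proof.
move=> ij; have [ix _] := trans_img ij; have [bg _ _] := hg_metric M.
have := hg_unit ix; rewrite (bg i j x ij) !unitmx_mul.
by case/andP => /andP [].
Qed.

Lemma J_field_gendo a b : gendo_field (J_field M a b).
Proof.
move=> i j x ij; have [ix jx] := trans_img ij; have Pu := jac_unit ij.
have [bg _ _] := hg_metric M; have gij := bg i j x ij.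
have [[eI _] _ _ _ _] := hI_kahler M; have [[eJ _] _ _ _ _] := hJ_kahler M.
have [[eK _] _ _ _ _] := hK_kahler M.
set P := jac i j x in Pu gij *.
have eE c : P *m Ie c i x = Ie c j (trans i j x) *m P.
  have [p [q [r cE]]] := I_eta_lin c; rewrite !cE !mulmxDr !mulmxDl -!scalemxAr -!scalemxAl.
  by rewrite eI // eJ // eK.
rewrite !J_fieldE // /gjac -/P /bihermitian -scalemxAr -scalemxAl; congr (_ *: _).
rewrite !mulmx_block !(mul0mx, mulmx0, addr0, add0r).
set g := hg M i x in gij *; set g' := hg M j _ in gij *.
have gw c : (invmx P)^T *m (g *m Ie c i x) = g' *m Ie c j (trans i j x) *m P.
  have PT : (invmx P)^T *m P^T = 1%:M by rewrite -trmx_mul mulmxV // trmx1.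
  by rewrite gij -!mulmxA eE [LHS]mulmxA PT mul1mx !mulmxA.
(* With the inverses rewritten by [invmx_kmap], this becomes the transformation law of the inverse
   metric. *)
have giw c : P *m invmx (g *m Ie c i x) =
    invmx (g' *m Ie c j (trans i j x)) *m (invmx P)^T.
  rewrite !invmx_kmap ?hg_unit ?I_eta_sq //.
  rewrite mulmxN mulNmx mulmxA eE -!mulmxA; congr (- (_ *m _)).
  rewrite -[LHS](mulKmx (hg_unit jx)); congr (_ *m _); rewrite -/g'.
  have PT : (invmx P)^T *m P^T = 1%:M by rewrite -trmx_mul mulmxV // trmx1.
  rewrite -[LHS]mul1mx -PT -[LHS]mulmxA.
  have -> : P^T *m (g' *m (P *m invmx g)) = 1%:M by rewrite !mulmxA -gij mulmxV // hg_unit.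
  by rewrite mulmx1.
congr block_mx.
- by rewrite mulmxN mulNmx mulmxDr mulmxDl !eE.
- by rewrite mulmxN mulNmx mulmxBr mulmxBl !giw.
- by rewrite mulmxBr mulmxBl !gw.
rewrite mulmxDr mulmxDl; congr (_ + _); rewrite -!trmx_mul; congr (_^T);
 apply: (canRL (mulKmx Pu)); rewrite mulmxA eE mulmxK //.
Qed.

End Hyperkahler.

Lemma mul_param (F : fieldType) p (G A S : 'M[F]_p) (X Z : 'cV[F]_p) (k s : F) :
  G *m (k *: (A *m X) - s *: (S *m Z)) = k *: (G *m A *m X) + - s *: (G *m S *m Z).
Proof. by rewrite mulmxBr -!scalemxAr !mulmxA scaleNr. Qed.

Lemma closed_lin (F : fieldType) (k l t1 t2 t3 s1 s2 s3 : F) :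
  k * t3 + l * s3 - (k * t2 + l * s2) + (k * t1 + l * s1) =
  k * (t3 - t2 + t1) + l * (s3 - s2 + s1).
Proof. by ring. Qed.

(** * Integrability of [J_field] *)

Section Involutive.
Context {R : realType} {n : nat} (M : hyperkahler R n).
Notation C := R[i].
Notation m := (4 * n)%N.
Notation i0 := ('i)%C.
Notation eA i x a := (endoA (toC (hI M i x)) (toC (hJ M i x)) (toC (hK M i x)) i0
  (h0 a) (h1 a) (h0 a)^*%C (h1 a)^*%C).
Notation eS i x a := (endoB (toC (hI M i x)) (toC (hJ M i x)) (toC (hK M i x)) i0
  (h0 a) (h1 a) (h0 a) (h1 a)).
Notation eZ i x a b := (Zparam (toC (hI M i x)) (toC (hJ M i x)) (toC (hK M i x))
  (h0 a) (h1 a) (h0 a)^*%C (h1 a)^*%C (h0 b) (h1 b) (h0 b)^*%C (h1 b)^*%C).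
Notation sP a b := (sparam (h0 a) (h1 a) (h0 b) (h1 b) (h0 b)^*%C (h1 b)^*%C).
Notation tP a b := (tparam i0 (h0 a) (h1 a) (h0 b) (h1 b)).

Section Chart.
Variable (i : idx M).
Let oV : open (img i). Proof. exact: img_open. Qed.

Lemma pdC_real (f : 'cV[R]_m -> R) x a : pdC a (fun y => (f y)%:C%C) x = (pd a f x)%:C%C.
Proof. by rewrite /pdC /= /pd derive_cst. Qed.

Notation gE A := (fun y => toC (hg M i y) *m toC (A i y)).

Lemma diff_gE (A : field M m m) x : kahler (hg M) A -> img i x -> diff_mx (gE A) x.
Proof.
move=> [[_ sA] _ _ _ _] ix; have [_ sg _] := hg_metric M.
have sGA : smoothC_mx (img i) (gE A).
  by apply: smoothC_mxM => //; apply: smoothC_toC.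
by move=> a b; exact: smoothC_diffC (sGA a b) ix.
Qed.

Lemma closed_gE (A : field M m m) x : kahler (hg M) A -> img i x -> closedC (gE A) x.
Proof.
move=> KA ix; have [_ _ _ _ cA] := KA.
pose W y := kform (hg M) A i y.
(* [closedC] is applied to [g A], the transpose of the array of components of the Kähler form. *)
have WE a b y : img i y -> (toC (hg M i y) *m toC (A i y)) a b = (W y b a)%:C%C.
  move=> iy; rewrite -toCM mxE /W /kform -[in LHS](trmxK (hg M i y *m A i y)).
  by rewrite trmx_mul hg_sym // mxE.
have WN a b y : img i y -> W y a b = - W y b a.
  move=> iy; have WT : (W y)^T = - W y.
    by rewrite /W /kform trmx_mul trmxK hg_sym // (kahler_skew KA) // opprK.
  by have /matrixP /(_ b a) := WT; rewrite [LHS]mxE [RHS]mxE.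
have dE a b c : pdC c (fun y => (toC (hg M i y) *m toC (A i y)) a b) x =
    (pd c (fun y => W y b a) x)%:C%C.
  by rewrite -pdC_real; apply: pdC_eq oV _ ix => y iy; rewrite WE.
have dN a b c : (pd c (fun y => W y b a) x)%:C%C = - (pd c (fun y => W y a b) x)%:C%C.
  rewrite -!dE -[RHS]mulN1r.
  have dS := diff_gE KA ix; have z := diffC_cst (0 : C) x.
  rewrite -[RHS]addr0 -[X in _ + X](mul0r (pdC c (fun=> (0 : C)) x)) -(pdC_lin (-1) 0 c (dS b a) z).
  apply: pdC_eq oV _ ix => y iy; rewrite mul0r addr0 mulN1r !WE // [W y b a]WN //.
  by rewrite rmorphN.
move=> a b c; rewrite !dE [(pd c _ _)%:C%C]dN opprK -!rmorphD /=.
have e : pd b (fun y => W y c a) x + pd c (fun y => W y a b) x + pd a (fun y => W y b c) x = 0.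
  by rewrite -[RHS](cA i x ix a b c) -[RHS]addrA addrC.
by rewrite e.
Qed.

Lemma diff_mx_lin k l (S T : 'cV[R]_m -> 'M[C]_m) x : diff_mx S x -> diff_mx T x ->
  diff_mx (fun y => k *: S y + l *: T y) x.
Proof.
move=> dS dT a b.
have -> : (fun y => (k *: S y + l *: T y) a b) = (fun y => k * S y a b + l * T y a b).
  by apply/funext => y; rewrite !mxE.
exact: diffC_lin.
Qed.

Lemma closedC_lin k l (S T : 'cV[R]_m -> 'M[C]_m) x : diff_mx S x -> diff_mx T x ->
  closedC S x -> closedC T x -> closedC (fun y => k *: S y + l *: T y) x.
Proof.
move=> dS dT cS cT a b c.
have E p q r : pdC r (fun y => (k *: S y + l *: T y) p q) x =
    k * pdC r (fun y => S y p q) x + l * pdC r (fun y => T y p q) x.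
  have -> : (fun y => (k *: S y + l *: T y) p q) = (fun y => k * S y p q + l * T y p q).
    by apply/funext => y; rewrite !mxE.
  exact: pdC_lin.
rewrite !E; have := cS a b c; have := cT a b c.
move: (pdC _ _ _) (pdC _ _ _) (pdC _ _ _) (pdC _ _ _) (pdC _ _ _) (pdC _ _ _).
move=> t1 t2 t3 s1 s2 s3 e1 e2.
transitivity (k * (t3 - t2 + t1) + l * (s3 - s2 + s1)); last by rewrite e1 e2 !mulr0 addr0.
exact: closed_lin.
Qed.

Notation Qf p q r := (fun y => toC (hg M i y) *m
  quat (toC (hI M i y)) (toC (hJ M i y)) (toC (hK M i y)) 0 p q r).

(** [S_b] and [omega_beta] are combinations of the three Kähler forms with coefficients constant on
    [M]. The factor [1] gives the sum the nested two-term shape of [diff_mx_lin] and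
    [closedC_lin]. *)
Lemma QfE p q r : Qf p q r = (fun y => 1 *: (p *: gE (hI M) y + q *: gE (hJ M) y)
   + r *: gE (hK M) y).
Proof.
apply/funext => y; rewrite /quat raddf0 add0r !mulmxDr scale1r.
by rewrite -!scalemxAr.
Qed.

Lemma Qf_diff p q r x : img i x -> diff_mx (Qf p q r) x.
Proof.
move=> ix; rewrite QfE; apply: diff_mx_lin; last exact: diff_gE (hK_kahler M) ix.
by apply: diff_mx_lin; [exact: diff_gE (hI_kahler M) ix|exact: diff_gE (hJ_kahler M) ix].
Qed.

Lemma Qf_closed p q r x : img i x -> closedC (Qf p q r) x.
Proof.
move=> ix; rewrite QfE.
have dI := diff_gE (hI_kahler M) ix; have dJ := diff_gE (hJ_kahler M) ix.
have dK := diff_gE (hK_kahler M) ix.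
apply: closedC_lin => //; [exact: diff_mx_lin| |exact: closed_gE (hK_kahler M) ix].
by apply: closedC_lin => //; [exact: closed_gE (hI_kahler M) ix|exact: closed_gE (hJ_kahler M) ix].
Qed.

Lemma Qf_skew p q r x : img i x -> (Qf p q r x)^T = - Qf p q r x.
Proof.
by move=> ix; rewrite trmx_mul GC_sym // (quat_imagT (IGC ix) (JGC ix) (KGC ix)).
Qed.

Lemma quat_smooth (p q r s : C) : smoothC_mx (img i)
  (fun y => quat (toC (hI M i y)) (toC (hJ M i y)) (toC (hK M i y)) p q r s).
Proof.
have sE (A : field M m m) : kahler (hg M) A -> smoothC_mx (img i) (fun y => toC (A i y)).
  by move=> [[_ sA] _ _ _ _]; exact: smoothC_toC.
apply: smoothC_mxD => //; last exact: smoothC_mxZ oV _ _ _ _ (sE _ (hK_kahler M)).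
apply: smoothC_mxD => //; last exact: smoothC_mxZ oV _ _ _ _ (sE _ (hJ_kahler M)).
apply: smoothC_mxD => //; last exact: smoothC_mxZ oV _ _ _ _ (sE _ (hI_kahler M)).
by move=> a b; exact: smoothC_cst.
Qed.

Lemma Zparam_smooth a b : smoothC_mx (img i) (fun y => eZ i y b a).
Proof.
apply: smoothC_mxD => //; apply: smoothC_mxZ => //; last exact: quat_smooth.
pose k : C := - i0.
apply: (@smoothC_mx_eq _ _ _ oV _ _ (fun y => 1%:M + k *: eA i y a)).
  by move=> y _; rewrite /k scaleNr.
apply: smoothC_mxD => //; first by move=> c d; exact: smoothC_cst.
by apply: smoothC_mxZ => //; exact: quat_smooth.
Qed.

Lemma invG_smooth : smoothC_mx (img i) (fun y => invmx (toC (hg M i y))).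
Proof.
have [_ sg _] := hg_metric M.
apply: (@smoothC_mx_eq _ _ _ oV _ _ (fun y => toC (invmx (hg M i y)))).
  by move=> y _; rewrite /toC map_invmx.
by apply: smoothC_toC => //; apply: smooth_inv => // x ix; exact: hg_unit.
Qed.

Lemma J_field_involutive a b : involutive_i (img i) (J_field M a b i).
Proof.
move=> U u v oU Ui su sv Lu Lv x Ux; have ix := Ui x Ux.
pose A y := eA i y a; pose S y := eS i y a; pose G y := toC (hg M i y).
(* [P w] is the field [Z] belonging to the section [w]; it is differentiable because [Zparam] and
   the inverse metric are smooth. *)
pose P (w : 'cV[R]_m -> 'cV[C]_(m + m)) y := eZ i y b a *m (usubmx (w y) + invmx (G y) *m dsubmx (w y)).
have param (w : 'cV[R]_m -> 'cV[C]_(m + m)) : (forall y, U y -> eigen_i (J_field M a b i y) (w y)) ->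
  (forall y, U y -> G y *m S y *m usubmx (w y) = tP b a *: (G y *m S y *m P w y)) /\
  (forall y, U y -> dsubmx (w y) = - i0 *: (G y *m A y *m usubmx (w y)) + - sP b a *: (G y *m S y *m P w y)).
  move=> Lw; suff H y : U y -> G y *m S y *m usubmx (w y) = tP b a *: (G y *m S y *m P w y) /\
     dsubmx (w y) = - i0 *: (G y *m A y *m usubmx (w y)) + - sP b a *: (G y *m S y *m P w y).
    by split=> y /H [].
  move=> Uy; have iy := Ui y Uy; have TP := tp a b iy.
  have n2 : (2 : C) != 0 by rewrite pnatr_eq0.
  have [eD eA'] := (bihermitian_eigen n2 (GC_unit iy) (tpAA TP) (tpDD TP) (tpAT TP) (tpDT TP)
    (w y) i_sq).1 ((eigen_J a b (w y) iy).1 (Lw y Uy)).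
  have [YE SX] := eigen_param TP eD eA'.
  split; first by rewrite -!mulmxA SX -scalemxAr.
  by rewrite -[LHS](mulKVmx (GC_unit iy)) YE; exact: mul_param.
have [SXu uE] := param u Lu; have [SXv vE] := param v Lv.
have diff_w (w : 'cV[R]_m -> 'cV[C]_(m + m)) y : smoothC_mx U w -> U y ->
    diff_cv (fun z => usubmx (w z)) y /\ diff_cv (P w) y.
  move=> sw Uy; have iy := Ui y Uy.
  have du : diff_cv (fun z => usubmx (w z)) y.
    move=> c; have -> : (fun z => usubmx (w z) c 0) = (fun z => w z (lshift m c) 0).
      by apply/funext => z; rewrite mxE.
    exact: smoothC_diffC (sw (lshift m c) 0) Uy.
  have dd : diff_cv (fun z => dsubmx (w z)) y.
    move=> c; have -> : (fun z => dsubmx (w z) c 0) = (fun z => w z (rshift m c) 0).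
      by apply/funext => z; rewrite mxE.
    exact: smoothC_diffC (sw (rshift m c) 0) Uy.
  split=> //; apply: diff_cv_mul => [c d|].
    exact: smoothC_diffC (Zparam_smooth a b c d) iy.
  have dGd : diff_cv (fun z => invmx (G z) *m dsubmx (w z)) y.
    by apply: diff_cv_mul => // c d; exact: smoothC_diffC (invG_smooth c d) iy.
  have -> : (fun z => usubmx (w z) + invmx (G z) *m dsubmx (w z)) =
      (fun z => 1 *: usubmx (w z) + 1 *: (invmx (G z) *m dsubmx (w z))).
    by apply/funext => z; rewrite !scale1r.
  exact: diff_cv_lin.
have [] := @courant_graph _ _ U oU (fun y => G y *m S y) (fun y => G y *m A y)
  (fun y => usubmx (u y)) (fun y => usubmx (v y)) (P u) (P v)
  (fun y => dsubmx (u y)) (fun y => dsubmx (v y)) (tP b a) (- sP b a) (- i0) _ _ _ _ SXu SXv uE vE x Ux.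
- by move=> y Uy; split; exact: Qf_diff (Ui y Uy).
- by move=> y Uy; split; exact: Qf_skew (Ui y Uy).
- by move=> y Uy; split; exact: Qf_closed (Ui y Uy).
- by move=> y Uy; have [] := diff_w u y su Uy; have [] := diff_w v y sv Uy; split.
move=> Z'' [SZ dE]; apply/(eigen_J a b _ ix).
have TP := tp a b ix; have n2 : (2 : C) != 0 by rewrite pnatr_eq0.
apply/(bihermitian_eigen n2 (GC_unit ix) (tpAA TP) (tpDD TP) (tpAT TP) (tpDT TP) _ i_sq).
rewrite /courant col_mxKu col_mxKd dE.
apply: (eigen_of_param TP (Z := Z'')).
  by rewrite -mul_param mulKmx // GC_unit.
apply: (can_inj (mulKmx (GC_unit ix))).
by rewrite -scalemxAr !mulmxA.
Qed.

End Chart.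

Lemma J_field_gcs a b : gcs (J_field M a b).
Proof.
split.
- by split; [exact: J_field_gendo|exact: J_field_smooth].
- by move=> i x ix u v; exact: J_field_orth.
- by move=> i x ix; exact: J_field_sq.
by move=> i; exact: J_field_involutive.
Qed.

End Involutive.

Lemma twisted_coef (F : fieldType) (i al be s t u : F) :
  t + i * u - (al + be) * s - al * be * (t - i * u) =
  - (al * 1 + 1 * be) * s + (1 * 1 - al * be) * t + i * (1 * 1 + al * be) * u.
Proof. by ring. Qed.

(** * Identification of the families *)

Section Families.
Context {R : realType} {n : nat} (M : hyperkahler R n).
Notation C := R[i].
Notation m := (4 * n)%N.
Notation one := (@form_one R m).
Notation i0 := ('i)%C.
Notation tP a b := (tparam i0 (h0 a) (h1 a) (h0 b) (h1 b)).

Definition PhiM (a b : CP1 R) (i : idx M) x : form R m :=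
  PhiH (toC (hg M i x)) (toC (hI M i x)) (toC (hJ M i x)) (toC (hK M i x)) 1
    (h0 a) (h1 a) (h0 b) (h1 b) (h0 b)^*%C (h1 b)^*%C.

(** The spinor of [(a, b)] is factored at [b], so [I_b] takes the place of [I_+]; hence the
    exchanged arguments of [J_field]. *)
Lemma clifford_PhiM a b (i : idx M) x u : img i x ->
  clifford u (PhiM a b i x) = 0 <-> eigen_i (J_field M b a i x) u.
Proof.
move=> ix; have H := clifford_Phi (GC_sym ix) (GC_unit ix) (tp b a ix) u.
by split => [/H /(eigen_J b a u ix)|/(eigen_J b a u ix) /H].
Qed.

(** Polynomial in [a] by the factorization at [b], and in [b] by the one at [a] with [e = -1]. *)
Lemma PhiM_poly (i : idx M) x : img i x ->
  exists c : 'I_n.+1 -> 'I_n.+1 -> form R m, forall a b,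
    PhiM a b i x = \sum_(j < n.+1) \sum_(k < n.+1) (mono n a j * mono n b k) *: c j k.
Proof.
move=> ix; apply: bipolynomial => [b|a].
  have [c cE] := PhiH_hpoly (toC (hg M i x)) (toC (hI M i x)) (toC (hJ M i x)) (toC (hK M i x))
    1 (h0 b) (h1 b) (h0 b)^*%C (h1 b)^*%C.
  exists (fun j => c j) => a; rewrite /PhiM cE; apply: eq_bigr => j _.
  by rewrite monoE // -ltnS.
have [c cE] := PhiH_hpoly (toC (hg M i x)) (toC (hI M i x)) (toC (hJ M i x)) (toC (hK M i x))
    (-1) (h0 a) (h1 a) (h0 a)^*%C (h1 a)^*%C.
exists (fun j => c j) => b.
rewrite /PhiM (PhiH_sym (hQ ix) (GC_sym ix) (GC_unit ix) (IGC ix) (JGC ix) (KGC ix)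
  (h_norm a) (h_norm b)) cE; apply: eq_bigr => j _.
by rewrite monoE // -ltnS.
Qed.

Lemma kform_smooth (i : idx M) (p q r : C) : smoothC_mx (img i) (fun y =>
  (quat (toC (hI M i y)) (toC (hJ M i y)) (toC (hK M i y)) 0 p q r)^T *m toC (hg M i y)).
Proof.
have oV : open (img i) by exact: img_open.
have [_ sg _] := hg_metric M.
apply: smoothC_mxM => //; last exact: smoothC_toC.
by apply: smoothC_mxT => //; exact: quat_smooth.
Qed.

Lemma PhiM_smooth a b (i : idx M) : smooth_form (img i) (PhiM a b i).
Proof.
have oV : open (img i) by exact: img_open.
have s1 : smooth_form (img i) (fun=> one) by move=> S; exact: smoothC_cst.
have sW (k p q r : C) : smooth_form (img i) (fun y => form2 (k *:
   ((quat (toC (hI M i y)) (toC (hJ M i y)) (toC (hK M i y)) 0 p q r)^T *m toC (hg M i y)))).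
  by apply: smooth_form2 => //; apply: smoothC_mxZ => //; exact: kform_smooth.
rewrite /PhiM /PhiH /Phi /expo /psi.
apply: smooth_form_sum => // k; apply: smooth_formZ => //; apply: smooth_iter_wedge => //.
  exact: sW.
apply: smooth_form_sum => // l; apply: smooth_formZ => //; apply: smooth_iter_wedge => //.
by apply: smooth_form2 => //; exact: kform_smooth.
Qed.

(** Reduces a family to one identity off the diagonal: there the coefficients are determined, hence
    the spinor at every parameter, its annihilator, and finally [F]. *)
Lemma spinor_familyE (Psi : C -> C -> idx M -> 'cV[R]_m -> form R m) a b F :
  (forall i x, img i x -> forall al be : C, al != be ->
     Psi al be i x = PhiM (Some al) (Some be) i x) ->
  spinor_family n Psi a b F <-> family3 M b a F.
Proof.
move=> PsiE; split=> -[gF].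
  move=> [c [cE pF]]; split=> // i x ix.
  have [d dE] := PhiM_poly ix.
  have cd j k : c j k i x = d j k.
    apply: (bipolynomial_unique (c := fun j k => c j k i x) (c' := d)) => al be ab.
    by rewrite -(cE i x ix al be ab) PsiE // dE.
  case: gF => _ _ FF _; apply: eigen_i_inj; first exact: FF.
  move=> u /(proj2 ((pF i).2 x ix u)) cl; apply/(clifford_PhiM a b u ix).
  rewrite dE -[RHS]cl; congr clifford; apply: eq_bigr => j _; apply: eq_bigr => k _.
  by rewrite cd.
move=> FE; split=> //.
(* Coefficients are chosen point by point, with 0 outside the image of the chart. Only their
   combination at [(a, b)] has to be smooth, and that is [PhiM]. *)
have ex (p : idx M * 'cV[R]_m) : exists c : 'I_n.+1 -> 'I_n.+1 -> form R m,
    img p.1 p.2 -> forall a b, PhiM a b p.1 p.2 =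
      \sum_(j < n.+1) \sum_(k < n.+1) (mono n a j * mono n b k) *: c j k.
  have [ix|nix] := boolp.pselect (img p.1 p.2); last by exists (fun _ _ => 0).
  by have [c cE] := PhiM_poly ix; exists c.
have [c cE] := boolp.choice ex.
exists (fun j k i x => c (i, x) j k); split.
  by move=> i x ix al be ab; rewrite PsiE // (cE (i, x) ix).
move=> i; split=> [S|x ix u].
  apply: smoothC_eq (@PhiM_smooth a b i S); first exact: img_open.
  by move=> x ix; rewrite (cE (i, x) ix).
rewrite -(cE (i, x) ix a b) FE //; exact: clifford_PhiM.
Qed.

Lemma omega_form2 (i : idx M) x (p q r : C) : img i x ->
  p *: omegaI i x + q *: omegaJ i x + r *: omegaK i x =
  form2 ((quat (toC (hI M i x)) (toC (hJ M i x)) (toC (hK M i x)) 0 p q r)^T *m toC (hg M i x)).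
Proof.
move=> ix; rewrite /omegaI /omegaJ /omegaK /kform !toCM !toCT -!form2Z -!form2D; congr form2.
by rewrite /quat raddf0 add0r !linearD /= !linearZ /= !mulmxDl -!scalemxAl.
Qed.

Definition twisted (al be : C) (i : idx M) x : form R m :=
  sigma i x - (al + be) *: omegaI i x - (al * be) *: sigmabar i x.

Lemma twistedE (al be : C) (i : idx M) x : img i x -> twisted al be i x =
  form2 ((endoB (toC (hI M i x)) (toC (hJ M i x)) (toC (hK M i x)) i0 1 al 1 be)^T
     *m toC (hg M i x)).
Proof.
move=> ix; rewrite /endoB -omega_form2 // /twisted /sigma /sigmabar.
move: (omegaI i x) (omegaJ i x) (omegaK i x) => wI wJ wK.
by apply/ffunP => S; rewrite !ffunE /GRing.scale /=; exact: twisted_coef.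
Qed.

Lemma form_expE (c : C) (W : 'M[C]_m) : form_exp (c *: form2 W) = expo (c *: W) one.
Proof. by rewrite -form2Z. Qed.

Lemma spinor1_twisted (al be : C) (i : idx M) x : spinor1 al be i x =
  (i0 * (al - be)) ^+ n *: form_exp ((i0 * (al - be))^-1 *: twisted al be i x).
Proof. by rewrite exprMn. Qed.

Lemma spinor1_expo (al be : C) (i : idx M) x : img i x -> spinor1 al be i x =
  (i0 * (al - be)) ^+ n *: expo ((i0 * (al - be))^-1 *:
    ((endoB (toC (hI M i x)) (toC (hJ M i x)) (toC (hK M i x)) i0 1 al 1 be)^T
     *m toC (hg M i x))) one.
Proof. by move=> ix; rewrite spinor1_twisted (twistedE al be ix) form_expE. Qed.

Lemma tparam1 (al be : C) : tparam i0 1 al 1 be = i0 * (al - be).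
Proof. by rewrite /tparam mulr1 mul1r. Qed.

(** Both sides are spinors of the graph of the exponent with coefficient [t^n] in degree zero, so
    [graph_spinor_ext] spares a comparison of the two expansions. *)
Lemma spinor1E (al be : C) (i : idx M) x : img i x -> al != be ->
  spinor1 al be i x = PhiM (Some al) (Some be) i x.
Proof.
move=> ix ab; rewrite (spinor1_expo _ _ ix); set t := i0 * (al - be).
have t0 : t != 0 by rewrite mulf_neq0 ?subr_eq0 // i_neq0.
set B := endoB (toC (hI M i x)) (toC (hJ M i x)) (toC (hK M i x)) i0 1 al 1 be.
set G := toC (hg M i x); set W := t^-1 *: (B^T *m G).
have Gs : G^T = G := GC_sym ix.
have BG : B^T *m G = - (G *m B) := quat_imagT (IGC ix) (JGC ix) (KGC ix) _ _ _.
have skW : skew W.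
  by rewrite /skew /W linearZ /= -scalerN; congr (_ *: _); exact: (skewE Gs BG).
have TP := tp (Some be) (Some al) ix.
have tE : tP (Some al) (Some be) = t by rewrite tparam1.
have t0' : tP (Some al) (Some be) != 0 by rewrite tE.
have WE X : W^T *m X = (1 / tP (Some al) (Some be)) *: (G *m (B *m X)).
  by rewrite tE div1r /W linearZ /= trE // -scalemxAl -mulmxA.
have e11 : 1 * 1 = 1 :> C by rewrite mulr1.
apply: (graph_spinor_ext (W := W)) => [X|X|].
- rewrite linearZ /= interior_expo // interior_one linear0 add0r.
  by rewrite [in RHS]linearZ.
- have := Phi_contr Gs (GC_unit ix) TP X e11 t0'.
  by rewrite -(endoB_decomp _ _ _ i_sq (h_norm (Some be))) WE => H; exact: H.
have L0 : (t ^+ n *: expo W one) set0 = t ^+ n.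
  by rewrite ffunE (expo_set0 _ skW) ffunE eqxx /GRing.scale /= mulr1.
have R0 := etrans (Phi_set0 Gs TP 1) (congr1 (fun z => z ^+ n) (etrans (mul1r _) tE)).
exact: etrans L0 (esym R0).
Qed.

Lemma family1E a b F : family1 M a b F <-> family3 M b a F.
Proof. by apply: spinor_familyE => i x ix al be; exact: spinor1E. Qed.

End Families.

(** * Real dimension four *)

Lemma quadratic_coef (F : fieldType) (x y z aa bb cc ab ac bc : F) :
  x * (x * aa + y * ab + z * ac) + y * (x * ab + y * bb + z * bc)
    + z * (x * ac + y * bc + z * cc) =
  x * x * aa + y * y * bb + z * z * cc + 2 * (x * y) * ab + 2 * (x * z) * ac
    + 2 * (y * z) * bc.
Proof. by ring. Qed.

Lemma endoB_norm (F : fieldType) (i al be : F) : i * i = -1 ->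
  - (al * 1 + 1 * be) * - (al * 1 + 1 * be) + (1 * 1 - al * be) * (1 * 1 - al * be)
    + i * (1 * 1 + al * be) * (i * (1 * 1 + al * be)) = - (i * (al - be) * (i * (al - be))).
Proof.
move=> i2; transitivity ((al - be) ^+ 2 + (i * i + 1) * (1 + al * be) ^+ 2); first by ring.
transitivity (- (i * i) * (al - be) ^+ 2); last by ring.
by rewrite i2; ring.
Qed.

Lemma spinor2_coef (F : fieldType) (t q c d o u v w k : F) :
  q = - (t * t) -> t != 0 -> (2 : F) != 0 ->
  t * (o + (t^-1 * (u - c * v - d * w) + 2^-1 * (t^-1 * (t^-1 * (q * k))))) =
  u - c * v + t * (o - 2^-1 * k) - d * w.
Proof. by move=> -> t0 n2; field; apply/andP. Qed.

Lemma wedge_quadratic (R : realType) m (a b c : form R m) (x y z : R[i]) S :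
  wedge b a = wedge a b -> wedge c a = wedge a c -> wedge c b = wedge b c ->
  wedge (x *: a + y *: b + z *: c) (x *: a + y *: b + z *: c) S =
  x * x * wedge a a S + y * y * wedge b b S + z * z * wedge c c S
  + 2 * (x * y) * wedge a b S + 2 * (x * z) * wedge a c S + 2 * (y * z) * wedge b c S.
Proof.
move=> ba ca cb.
have E v : wedge v (x *: a + y *: b + z *: c) =
    x *: wedge v a + y *: wedge v b + z *: wedge v c.
  by rewrite 2!linearD /= 3!linearZ.
rewrite !wedgeDl !wedgeZl !E ba ca cb.
move: (wedge a a) (wedge b b) (wedge c c) (wedge a b) (wedge a c) (wedge b c).
move=> aa bb cc ab ac bc.
by rewrite !ffunE /GRing.scale /=; exact: quadratic_coef.
Qed.

Lemma spinor2_form (R : realType) m (t q c d : R[i]) (o u v w k : form R m) :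
  q = - (t * t) -> t != 0 ->
  t *: (o + (t^-1 *: (u - c *: v - d *: w) + 2^-1 *: (t^-1 *: (t^-1 *: (q *: k))))) =
  u - c *: v + t *: (o - 2^-1 *: k) - d *: w.
Proof.
move=> qE t0; have n2 : (2 : R[i]) != 0 by rewrite pnatr_eq0.
by apply/ffunP => S; rewrite !ffunE /GRing.scale /=; exact: spinor2_coef.
Qed.

Lemma sum5 (V : zmodType) (f : nat -> V) :
  \sum_(k < 5) f k = f 0%N + (f 1%N + (f 2%N + (f 3%N + f 4%N))).
Proof. by rewrite !big_ord_recl big_ord0 addr0. Qed.

Section FourDimensional.
Context {R : realType} (M : hyperkahler R 1).
Notation C := R[i].
Notation m := (4 * 1)%N.
Notation one := (@form_one R m).
Notation i0 := ('i)%C.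
Notation quat_ i x := (quat (toC (hI M i x)) (toC (hJ M i x)) (toC (hK M i x))).
Notation eS i x a := (endoB (toC (hI M i x)) (toC (hJ M i x)) (toC (hK M i x)) i0
  (h0 a) (h1 a) (h0 a) (h1 a)).

Lemma expo_dim4 (W : 'M[C]_m) : skew W ->
  expo W one = one + (form2 W + 2^-1 *: wedge (form2 W) (form2 W)).
Proof.
move=> sk.
have z3 : iter 3 (wedge (form2 W)) one = 0 by apply: iter_tw_nil.
have z4 : iter 4 (wedge (form2 W)) one = 0 by apply: iter_tw_nil.
apply: etrans (sum5 (fun k => (k`!%:R)^-1 *: iter k (wedge (form2 W)) one)) _.
rewrite z3 z4 !scaler0 !addr0.
have -> : 2`! = 2%N by []. have -> : 1`! = 1%N by []. rewrite fact0 invr1 !scale1r.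
by rewrite /= !wedge_one.
Qed.

Section Point.
Variables (i : idx M) (x : 'cV[R]_m).
Hypothesis ix : img i x.
Notation G := (toC (hg M i x)).
Notation wI := (omegaI i x).
Notation wJ := (omegaJ i x).
Notation wK := (omegaK i x).

Lemma kform_skew (A : field M m m) : (toC (A i x))^T *m G = - (G *m toC (A i x)) ->
  skew (toC (kform (hg M) A i x)).
Proof. by move=> AG; rewrite /kform toCM toCT; exact: skewE (GC_sym ix) _ AG. Qed.

Lemma wedge_kformC (A A' : field M m m) :
  skew (toC (kform (hg M) A i x)) -> skew (toC (kform (hg M) A' i x)) ->
  wedge (form2 (toC (kform (hg M) A i x))) (form2 (toC (kform (hg M) A' i x))) =
  wedge (form2 (toC (kform (hg M) A' i x))) (form2 (toC (kform (hg M) A i x))).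
Proof. by move=> s s'; have := tw_tw one s s'; rewrite !wedge_one. Qed.

Lemma null_sq (b : CP1 R) (p q r : C) : eS i x b = quat_ i x 0 p q r ->
  wedge (p *: wI + q *: wJ + r *: wK) (p *: wI + q *: wJ + r *: wK) = 0.
Proof.
move=> bE; rewrite omega_form2 // -bE.
have [_] := top_power (GC_sym ix) (GC_unit ix) (tp b b ix).
by rewrite /= wedge_one.
Qed.

(** Each coefficient of the square is a quadratic form in [p], [q], [r], as 2-forms commute. It
    vanishes on the null vectors by [null_sq], so [null_quadric] applies. *)
Lemma wedge_quat (p q r : C) :
  wedge (p *: wI + q *: wJ + r *: wK) (p *: wI + q *: wJ + r *: wK) =
  (p * p + q * q + r * r) *: wedge wI wI.
Proof.
have sI := kform_skew (IGC ix); have sJ := kform_skew (JGC ix); have sK := kform_skew (KGC ix).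
have JI := wedge_kformC sJ sI; have KI := wedge_kformC sK sI; have KJ := wedge_kformC sK sJ.
apply/ffunP => S; rewrite (wedge_quadratic _ _ _ _ JI KI KJ) [RHS]ffunE /GRing.scale /=.
have H (b : CP1 R) (p' q' r' : C) : eS i x b = quat_ i x 0 p' q' r' ->
    p' * p' * wedge wI wI S + q' * q' * wedge wJ wJ S + r' * r' * wedge wK wK S
    + 2 * (p' * q') * wedge wI wJ S + 2 * (p' * r') * wedge wI wK S
    + 2 * (q' * r') * wedge wJ wK S = 0.
  by move=> bE; rewrite -(wedge_quadratic _ _ _ _ JI KI KJ) (null_sq bE) ffunE.
have n2 : (2 : C) != 0 by rewrite pnatr_eq0.
apply: (null_quadric n2 i_sq).
- exact: (H (Some 0) _ _ _ (endoB10 _ _ _ i0)).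
- exact: (H None _ _ _ (endoB01 _ _ _ i0)).
- exact: (H (Some 1) _ _ _ (endoB11 _ _ _ i0)).
- exact: (H (Some (-1)) _ _ _ (endoB1N1 _ _ _ i0)).
- exact: (H (Some i0) _ _ _ (endoB1i _ _ _ i_sq)).
Qed.

Lemma spinor2E (al be : C) : al != be -> spinor2 al be i x = spinor1 al be i x.
Proof.
move=> ab; have t0 : i0 * (al - be) != 0 by rewrite mulf_neq0 ?subr_eq0 // i_neq0.
have n2 : (2 : C) != 0 by rewrite pnatr_eq0.
rewrite (spinor1_expo _ _ ix) expr1 /endoB.
have BG := quat_imagT (IGC ix) (JGC ix) (KGC ix) (- (al * 1 + 1 * be)) (1 * 1 - al * be)
  (i0 * (1 * 1 + al * be)).
have skW := skewE (GC_sym ix) BG.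
have qE := endoB_norm al be i_sq.
have TE := twistedE al be ix.
have WW := wedge_quat (- (al * 1 + 1 * be)) (1 * 1 - al * be) (i0 * (1 * 1 + al * be)).
rewrite omega_form2 // in WW; rewrite /endoB in TE.
have skW' : skew ((i0 * (al - be))^-1 *: ((quat_ i x 0 (- (al * 1 + 1 * be)) (1 * 1 - al * be)
    (i0 * (1 * 1 + al * be)))^T *m G)) by rewrite /skew [LHS]linearZ /= skW scalerN.
rewrite (expo_dim4 skW') form2Z wedgeZl [wedge _ (_ *: _)]linearZ /= WW -TE.
exact: esym (spinor2_form (al + be) (al * be) one (sigma i x) wI (sigmabar i x)
  (wedge wI wI) qE t0).
Qed.

End Point.
End FourDimensional.

Lemma family2E (R : realType) (M : hyperkahler R 1) a b F :
  family2 M a b F <-> family3 M b a F.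
Proof.
apply: spinor_familyE => i x ix al be ab.
by rewrite -(spinor1E ix ab); exact: spinor2E.
Qed.

Theorem proposition10 (R : realType) (n : nat) (M : hyperkahler R n) :
  [/\ forall a b, gcs (J_field M a b),
      same_family (family1 M) (family3 M),
      n = 1%N -> same_family (family2 M) (family3 M),
      forall a b F, family1 M a b F <-> family3 M b a F &
      n = 1%N -> forall a b F, family2 M a b F <-> family3 M b a F].
Proof.
(* Exchanging the two factors is a bijection of the parameter space and does not change the family
   as a set. *)
have swap (P : gcs_family M) : (forall a b F, P a b F <-> family3 M b a F) ->
    same_family P (family3 M).
  by move=> PE F; split=> -[a [b Fab]]; exists b, a; apply/PE.
have f2 : n = 1%N -> forall a b F, family2 M a b F <-> family3 M b a F.
  by move=> n1; subst n; exact: family2E.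
split=> //; [exact: J_field_gcs|exact/swap/family1E|by move/f2; exact: swap|exact: family1E].
Qed.
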